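(* For all constant $q\in\mathbb{N}$, $$\mathsf{QCPCP}[q]\subseteq\mathsf{BQP}^{\mathsf{NP}[1]}.$$
   Context: All classes are classes of promise problems. A promise problem $A=(A_{\mathrm{yes}},A_{\mathrm{no}})$ is in $\mathsf{QCPCP}[q]$ if there exist a polynomially bounded $p$ and a polynomial-time quantum algorithm $V$ which acts on an input $|x\rangle$ ($|x|=n$) and a polynomial number of ancilla qubits, plus an additional classical bit string $y\in\{0,1\}^{p(n)}$ from which it may read at most $q$ bits non-adaptively (the indices to be read are determined by measuring designated index qubits; the bits read are then supplied as basis-state qubits), followed by a measurement of the first qubit, accepting only if the outcome is $|1\rangle$, such that: if $x\in A_{\mathrm{yes}}$ there is $y$ such that $V$ accepts with probability at least $2/3$; if $x\in A_{\mathrm{no}}$ then for all $y$, $V$ accepts with probability at most $1/3$. $\mathsf{BQP}^{\mathsf{NP}[1]}$ is the class of promise problems that can be solved by a bounded-error polynomial-time quantum algorithm (completeness $2/3$, soundness $1/3$) that makes a single query to an $\mathsf{NP}$ oracle. *)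

(* Defs.v *)
From mathcomp Require Import all_boot all_order all_algebra.
From mathcomp Require Import complex.
From mathcomp Require Import boolp classical_sets reals.

Set Implicit Arguments.
Unset Strict Implicit.
Unset Printing Implicit Defensive.

Import Order.TTheory GRing.Theory Num.Theory.

Definition poly_bounded (f : nat -> nat) : Prop :=
  exists k, forall n, f n <= n ^ k + k.

(* A tape symbol is a bit or the blank [None]. *)
Definition symbol := option bool.

Inductive direction := MoveLeft | MoveRight | Stay.

(* A two-way infinite tape: the cells left of the head (nearest first), and the
   cells from the scanned one rightwards; all the cells not listed are blank. *)
Definition tape : Type := (seq symbol * seq symbol)%type.

Definition tape_read (t : tape) : symbol := head None t.2.

Definition tape_write (s : symbol) (t : tape) : tape := (t.1, s :: behead t.2).

Definition tape_move (d : direction) (t : tape) : tape :=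
  match d with
  | MoveLeft => (behead t.1, head None t.1 :: t.2)
  | MoveRight => (tape_read t :: t.1, behead t.2)
  | Stay => t
  end.

Definition tape_of_bits (w : seq bool) : tape := ([::], map Some w).

(* The bits from the scanned cell up to the first blank to its right. *)
Definition tape_bits (t : tape) : seq bool :=
  pmap id (take (index None t.2) t.2).

Record turing_machine := TuringMachine {
  tm_state : finType;
  tm_work : nat;
  tm_start : tm_state;
  tm_halt : pred tm_state;
  tm_trans : tm_state -> tm_work.+1.-tuple symbol ->
             tm_state * tm_work.+1.-tuple (symbol * direction)
}.

Definition tm_config (M : turing_machine) : Type :=
  (tm_state M * (tm_work M).+1.-tuple tape)%type.

Definition tm_init (M : turing_machine) (ins : seq (seq bool)) : tm_config M :=
  (tm_start M, [tuple tape_of_bits (nth [::] ins i) | i < (tm_work M).+1]).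

Definition tm_step (M : turing_machine) (c : tm_config M) : tm_config M :=
  if tm_halt c.1 then c else
  let a := tm_trans c.1 [tuple tape_read (tnth c.2 i) | i < (tm_work M).+1] in
  (a.1, [tuple tape_move (tnth a.2 i).2 (tape_write (tnth a.2 i).1 (tnth c.2 i))
        | i < (tm_work M).+1]).

(* Started with the i-th input word on its i-th tape, [M] halts within [t] steps
   with [out] on its first tape. *)
Definition tm_computes (M : turing_machine) (ins : seq (seq bool)) (t : nat)
    (out : seq bool) : Prop :=
  let c := iter t (@tm_step M) (tm_init M ins) in
  tm_halt c.1 /\ tape_bits (tnth c.2 ord0) = out.

(* [D n] is computed from 1^n in time polynomial in [n]. *)
Definition polytime_uniform (D : nat -> seq bool) : Prop :=
  exists M t, poly_bounded t /\
    forall n, tm_computes M [:: nseq n true] (t n) (D n).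

Definition polytime_relation (V : seq bool -> seq bool -> bool) : Prop :=
  exists M t, poly_bounded t /\
    forall x y, tm_computes M [:: x; y] (t (size x + size y)) [:: V x y].

Definition NP_language (L : pred (seq bool)) : Prop :=
  exists V k, polytime_relation V /\
    forall x, L x <-> exists y, size y <= size x ^ k + k /\ V x y.

Record promise_problem := PromiseProblem {
  yes_instances : set (seq bool);
  no_instances : set (seq bool);
  yes_no_disjoint : forall x, yes_instances x -> no_instances x -> False
}.

Inductive gate :=
  | Hadamard of nat
  | Tgate of nat
  | CNOT of nat & nat. (* control, target *)

Definition gate_wf (N : nat) (g : gate) : bool :=
  match g with
  | Hadamard i | Tgate i => i < N
  | CNOT i j => [&& i < N, j < N & i != j]
  end.

Definition bits_at (s : seq bool) (l : seq nat) : seq bool :=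
  [seq nth false s i | i <- l].

Definition flip (N : nat) (i : nat) (b : N.-tuple bool) : N.-tuple bool :=
  [tuple tnth b j (+) (val j == i) | j < N].

Section QuantumStates.

Variable R : realType.

Local Open Scope ring_scope.
Local Open Scope complex_scope.

(* The amplitudes of an N-qubit (possibly unnormalised) state in the
   computational basis. *)
Definition qstate (N : nat) : Type := {ffun N.-tuple bool -> R[i]}.

Definition sqmod (z : R[i]) : R := complex.Re z ^+ 2 + complex.Im z ^+ 2.

Definition ket (N : nat) (c : N.-tuple bool) : qstate N :=
  [ffun b => (b == c)%:R].

Definition apply_gate (N : nat) (psi : qstate N) (g : gate) : qstate N :=
  match g with
  | Hadamard i =>
      [ffun b : N.-tuple bool => (Num.sqrt 2)^-1%:C *
        ((-1) ^+ (nth false b i) * psi b + psi (flip i b))]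
  | Tgate i =>
      [ffun b : N.-tuple bool => if nth false b i
        then ((Num.sqrt 2)^-1 +i* (Num.sqrt 2)^-1) * psi b else psi b]
  | CNOT i j =>
      [ffun b : N.-tuple bool => if nth false b i then psi (flip j b) else psi b]
  end.

Definition run_circuit (N : nat) (C : seq gate) (psi : qstate N) : qstate N :=
  foldl (@apply_gate N) psi C.

(* |x>|0^a> *)
Definition input_state (a : nat) (x : seq bool) : qstate (size x + a) :=
  ket [tuple nth false x i | i < size x + a].

(* The unnormalised state after the qubits [l] are measured with outcome [o]. *)
Definition project (N : nat) (l : seq nat) (o : seq bool) (psi : qstate N) :
    qstate N :=
  [ffun b : N.-tuple bool => if bits_at b l == o then psi b else 0].

(* |psi> |z_0 ... z_{r-1}> *)
Definition append_bits (N r : nat) (psi : qstate N) (z : seq bool) :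
    qstate (N + r) :=
  [ffun b : (N + r).-tuple bool =>
    if drop N b == z then psi [tuple nth false b i | i < N] else 0].

(* The squared norm of the component of [psi] whose first qubit is |1>. *)
Definition prob_first_one (N : nat) (psi : qstate N) : R :=
  \sum_(b : N.-tuple bool | nth false b 0) sqmod (psi b).

(* |w>|c> |-> |w>|c (+) L(w)>, with |w> on the qubits [l], |c> on the qubit [a]. *)
Definition apply_oracle (N : nat) (L : pred (seq bool)) (l : seq nat) (a : nat)
    (psi : qstate N) : qstate N :=
  [ffun b : N.-tuple bool => if L (bits_at b l) then psi (flip a b) else psi b].

End QuantumStates.

(* Each of the following encodings is injective and prefix-free. *)
Definition encode_nat (n : nat) : seq bool := rcons (nseq n true) false.

Definition encode_seq (T : Type) (e : T -> seq bool) (s : seq T) : seq bool :=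
  foldr (fun x w => true :: e x ++ w) [:: false] s.

Definition encode_gate (g : gate) : seq bool :=
  match g with
  | Hadamard i => [:: false; false] ++ encode_nat i
  | Tgate i => [:: false; true] ++ encode_nat i
  | CNOT i j => [:: true; false] ++ encode_nat i ++ encode_nat j
  end.

(* [pv_index] lists, for each bit to be read from the proof, the qubits holding
   its position. The bits read are supplied on [size pv_index] fresh qubits,
   numbered after the input and ancilla qubits. *)
Record pcp_verifier := PcpVerifier {
  pv_ancillas : nat;
  pv_before : seq gate;
  pv_index : seq (seq nat);
  pv_after : seq gate
}.

Definition encode_pcp_verifier (V : pcp_verifier) : seq bool :=
  encode_nat (pv_ancillas V) ++ encode_seq encode_gate (pv_before V) ++
  encode_seq (encode_seq encode_nat) (pv_index V) ++
  encode_seq encode_gate (pv_after V).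

Definition pcp_verifier_wf (n : nat) (V : pcp_verifier) : bool :=
  let N := n + pv_ancillas V in
  [&& all (gate_wf N) (pv_before V),
      all (all (fun i => i < N)) (pv_index V)
    & all (gate_wf (N + size (pv_index V))) (pv_after V)].

(* Least significant bit first. *)
Definition nat_of_bits (s : seq bool) : nat :=
  foldr (fun (b : bool) m => b + m.*2) 0 s.

(* The proof positions encoded by the concatenation [o] of the measured blocks. *)
Definition positions (V : pcp_verifier) (o : seq bool) : seq nat :=
  [seq nat_of_bits s | s <- reshape (shape (pv_index V)) o].

Section QCPCP.

Variable R : realType.

Local Open Scope ring_scope.

Definition pcp_state_before (V : pcp_verifier) (x : seq bool) :
    qstate R (size x + pv_ancillas V) :=
  run_circuit (pv_before V) (input_state R (pv_ancillas V) x).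

(* The index measurement only yields positions of a proof of length [m]. Were
   out-of-range reads given a default value instead, a noncomputable proof length
   could be used as advice. *)
Definition pcp_in_range (V : pcp_verifier) (x : seq bool) (m : nat) : Prop :=
  forall b, pcp_state_before V x b != 0 ->
    all (fun j => (j < m)%N) (positions V (bits_at b (flatten (pv_index V)))).

Definition pcp_accept_prob (V : pcp_verifier) (x y : seq bool) : R :=
  let l := flatten (pv_index V) in
  \sum_(o : (size l).-tuple bool)
    prob_first_one (run_circuit (pv_after V)
      (append_bits (size (pv_index V)) (project l o (pcp_state_before V x))
         (bits_at y (positions V o)))).

Definition QCPCP (q : nat) : set promise_problem :=
  [set A | exists (p : nat -> nat) (V : nat -> pcp_verifier),
    [/\ poly_bounded p,
        polytime_uniform (fun n => encode_pcp_verifier (V n)),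
        forall n, pcp_verifier_wf n (V n) /\ (size (pv_index (V n)) <= q)%N
      & forall x, pcp_in_range (V (size x)) x (p (size x))] /\
    [/\ forall x, yes_instances A x ->
          exists y : (p (size x)).-tuple bool,
            2 / 3 <= pcp_accept_prob (V (size x)) x y
      & forall x, no_instances A x ->
          forall y : (p (size x)).-tuple bool,
            pcp_accept_prob (V (size x)) x y <= 1 / 3]]%classic.

End QCPCP.

Record query_circuit := QueryCircuit {
  qc_ancillas : nat;
  qc_before : seq gate;
  qc_query : seq nat;
  qc_answer : nat;
  qc_after : seq gate
}.

Definition encode_query_circuit (C : query_circuit) : seq bool :=
  encode_nat (qc_ancillas C) ++ encode_seq encode_gate (qc_before C) ++
  encode_seq encode_nat (qc_query C) ++ encode_nat (qc_answer C) ++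
  encode_seq encode_gate (qc_after C).

Definition query_circuit_wf (n : nat) (C : query_circuit) : bool :=
  let N := n + qc_ancillas C in
  [&& all (gate_wf N) (qc_before C),
      uniq (qc_answer C :: qc_query C),
      all (fun i => i < N) (qc_answer C :: qc_query C)
    & all (gate_wf N) (qc_after C)].

Section BQP.

Variable R : realType.

Local Open Scope ring_scope.

Definition query_accept_prob (L : pred (seq bool)) (C : query_circuit)
    (x : seq bool) : R :=
  prob_first_one (run_circuit (qc_after C)
    (apply_oracle L (qc_query C) (qc_answer C)
      (run_circuit (qc_before C) (input_state R (qc_ancillas C) x)))).

Definition BQP_NP1 : set promise_problem :=
  [set A | exists (L : pred (seq bool)) (C : nat -> query_circuit),
    [/\ NP_language L,
        polytime_uniform (fun n => encode_query_circuit (C n))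
      & forall n, query_circuit_wf n (C n)] /\
    [/\ forall x, yes_instances A x ->
          2 / 3 <= query_accept_prob L (C (size x)) x
      & forall x, no_instances A x ->
          query_accept_prob L (C (size x)) x <= 1 / 3]]%classic.

End BQP.

(* Main.v *)
(* Instead of reading the proof, guess it: run the verifier on a superposition, copy the
   measured positions together with uniformly random proof bits z, feed z to the
   verifier, and record positions, z and the accept bit as a sample. For a fixed proof
   y, a sample agrees with y and accepts with probability exactly 2^-q times the
   acceptance probability of the verifier on y. A circuit drawing M = poly(n) independent
   samples then asks one NP query: is there a proof y for which at least M / 2^(q+1) of
   the samples agree with y and accept? The expected fraction is at least (4/3) 2^-(q+1)
   for a good proof and at most (2/3) 2^-(q+1) for every proof of a no-instance, so an
   exponential tail bound, together with a union bound over the proofs in the second case,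
   makes the answer correct with the required probability. Nothing has to be measured
   before the query: on the basis states of the query register the samples behave
   classically.

   Uniformity and the NP relation are established on multi-tape Turing machines by
   reading each tape as a stack (or, holding 1^k, as a counter) and composing machines
   with the usual control structures. *)
Require Import Defs.
From mathcomp Require Import all_boot all_order all_algebra.
From mathcomp Require Import complex.
From mathcomp Require Import boolp classical_sets reals.
From mathcomp Require Import ring lra zify.

Set Implicit Arguments.
Unset Strict Implicit.
Unset Printing Implicit Defensive.

(** * The sampling circuit *)

(** The proof length [p] may be noncomputable, so only its bound n^k + k enters the circuit: the
    number of samples is a power of n + c. The oracle may be offered proofs of any length up to that
    of the query plus one, yet only the first p + 1 bits can influence a sample that occurs, because
    measured positions lie below p and padding looks at bit 0. This keeps the union bound finite.
    Over H, T and CNOT all the weights are exact: randomness is H applied to a fresh |0>, and every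
    record is a CNOT onto a fresh |0>. Positions and guesses recorded on the query register stay
    untouched afterwards, so different records are orthogonal and have the effect of a measurement.
    The threshold fraction is 1/Q with Q = 2^(q+1), the success rate that an acceptance probability
    of 1/2 would give; the two cases of the promise lie at 4/(3Q) and 2/(3Q). The machine that
    writes the verifier is arbitrary and leaves unknown contents on its tapes, so the program logic
    has to speak of stacks surrounded by garbage. *)

Definition shift_gate B g :=
  match g with
  | Hadamard i => Hadamard (B + i)
  | Tgate i => Tgate (B + i)
  | CNOT i j => CNOT (B + i) (B + j)
  end.

(* Each instruction has a fresh target qubit, initially |0>; [Coin] puts it in the
   state |+>, and [Copy s d] copies the qubit [s] in the computational basis. *)
Inductive instr := Zero of nat | One of nat | Coin of nat | Copy of nat & nat.

Definition instr_gates (a : instr) : seq gate :=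
  match a with
  | Zero _ => [::]
  | Copy s d => [:: CNOT s d]
  (* H T^4 H = H Z H = X *)
  | One d => [:: Hadamard d; Tgate d; Tgate d; Tgate d; Tgate d; Hadamard d]
  | Coin d => [:: Hadamard d]
  end.

(* A sample is recorded on the query register as a string of tokens: [0 b] is an
   address bit, [1 0 z] asserts that the addressed bit of the proof is [z], and
   [1 1 a] ends the sample, [a] telling whether the verifier accepted. *)
Fixpoint index_instrs loc (l : seq nat) : seq instr :=
  if l is i :: l' then [:: Zero loc, Copy i loc.+1 & index_instrs loc.+2 l'] else [::].

Definition read_instrs1 c loc := [:: One loc; Zero loc.+1; Coin c; Copy c loc.+2].

Definition loc_after (loc : nat) (l : seq nat) := loc + (size l).*2.

Fixpoint read_instrs c loc (ls : seq (seq nat)) : seq instr :=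
  if ls is l :: ls' then
    index_instrs loc l ++ read_instrs1 c (loc_after loc l) ++
    read_instrs c.+1 (loc_after loc l).+3 ls'
  else [::].

Fixpoint locs_after loc (ls : seq (seq nat)) :=
  if ls is l :: ls' then locs_after (loc_after loc l).+3 ls' else loc.

(* A verifier with fewer than q reads guesses the bit 0 of the proof in the missing
   ones, so that every verifier is sampled with the same probability 2^-q. *)
Fixpoint pad_instrs loc k : seq instr :=
  if k is k'.+1 then [:: One loc, Zero loc.+1, Coin loc.+2 & pad_instrs loc.+3 k'] else [::].

Definition end_instrs loc := [:: One loc; One loc.+1; Zero loc.+2].

Section Block.

Variables (q n : nat) (V : pcp_verifier).

(* The qubits of a block: input and ancillas of the verifier, then q+1 qubits of which
   the first ones are the guessed proof bits, then the tokens. The circuit has the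
   input first, then a qubit that stays |0>, the answer qubit n+1, and the blocks. *)
Definition nqubits := n + pv_ancillas V.
Definition token_start := nqubits + q.+1.
Definition pad_start := locs_after token_start (pv_index V).
Definition end_start := pad_start + 3 * (q - size (pv_index V)).
Definition block_width := end_start + 3.

Definition token_instrs :=
  read_instrs nqubits token_start (pv_index V) ++
  pad_instrs pad_start (q - size (pv_index V)) ++ end_instrs end_start.

Definition block_circuit :=
  pv_before V ++ flatten (map instr_gates token_instrs) ++ pv_after V ++
  [:: CNOT 0 end_start.+2].

Definition copy_input B := [seq CNOT i (B + i) | i <- iota 0 n].

Definition block_gates B := copy_input B ++ map (shift_gate B) block_circuit.

Definition block_query B := iota (B + token_start) (block_width - token_start).

Definition block_base j := n + 2 + j * block_width.

Definition sampling_circuit M := QueryCircuit (2 + M * block_width)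
  (flatten [seq block_gates (block_base j) | j <- iota 0 M])
  (flatten [seq block_query (block_base j) | j <- iota 0 M])
  n.+1 [:: CNOT 0 n.+1; CNOT n.+1 0].

End Block.

(** * Stack programs on multi-tape machines *)

Lemma nth_mktuple_nat (T : Type) (x0 : T) n (F : nat -> T) i :
  i < n -> nth x0 [tuple F (val j) | j < n] i = F i.
Proof. by move=> lt_in; rewrite -(tnth_nth x0 _ (Ordinal lt_in)) tnth_mktuple. Qed.

Definition empty_tape : tape := ([::], [::]).
(** A step of the model writes on every tape. A tape left alone gets its scanned symbol written
    back, and on an empty list of cells this creates a listed blank: the pair of lists changes, the
    contents do not. *)
Definition idle_tape (t : tape) : tape := tape_move Stay (tape_write (tape_read t) t).
Definition pop_tape (t : tape) : tape := tape_move MoveRight (tape_write (tape_read t) t).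
Definition push_tape b (t : tape) : tape :=
  tape_write (Some b) (tape_move MoveLeft (tape_write (tape_read t) t)).

Lemma tape_bits_idle t : tape_bits (idle_tape t) = tape_bits t.
Proof. by case: t => l [|[b|] r]. Qed.

Lemma tape_read_bits t : tape_read t = ohead (tape_bits t).
Proof. by case: t => l [|[b|] r]. Qed.

Lemma tape_bits_pop t : tape_read t != None -> tape_bits (pop_tape t) = behead (tape_bits t).
Proof. by case: t => l [|[b|] r]. Qed.

Lemma tape_bits_push b t : tape_bits (push_tape b t) = b :: tape_bits t.
Proof. by case: t => l [|[c|] r]. Qed.

Lemma tape_bits_of_bits s : tape_bits (tape_of_bits s) = s.
Proof. by rewrite /tape_bits /=; elim: s => //= b s ->. Qed.

(** Equality of the infinite tapes, that is, of the lists up to trailing blanks. *)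
Definition same_tape (t u : tape) : Prop :=
  (forall i, nth None t.1 i = nth None u.1 i) /\
  (forall i, nth None t.2 i = nth None u.2 i).

Lemma same_tape_refl t : same_tape t t. Proof. by []. Qed.

Lemma same_tape_trans t u v : same_tape t u -> same_tape u v -> same_tape t v.
Proof. by move=> [h1 h2] [h3 h4]; split=> i; rewrite ?h1 ?h2. Qed.

Lemma same_tape_read t u : same_tape t u -> tape_read t = tape_read u.
Proof. by case=> _ /(_ 0); rewrite !nth0. Qed.

Lemma same_tape_write s t u : same_tape t u -> same_tape (tape_write s t) (tape_write s u).
Proof.
case=> h1 h2; split=> [i|[|i]] //=.
by rewrite !nth_behead.
Qed.

Lemma same_tape_move d t u : same_tape t u -> same_tape (tape_move d t) (tape_move d u).
Proof.
move=> tu; case: (tu) => h1 h2; case: d => //; split=> [i|[|i]] //=.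
- by rewrite !nth_behead.
- by rewrite -!nth0.
- by case: i => [|i] //=; apply: same_tape_read.
- by rewrite !nth_behead.
- by rewrite !nth_behead.
Qed.

Lemma same_tape_idle t : same_tape (idle_tape t) t.
Proof. by case: t => l [|[b|] r]; split=> [i|[|i]] //=; rewrite ?nth_nil. Qed.

Lemma same_tape_bits t u : same_tape t u -> tape_bits t = tape_bits u.
Proof.
case: t u => [l r] [l' r'] [_ /=]; rewrite /tape_bits /=.
elim: r r' => [|[b|] r IH] [|[c|] r'] //= h; try by have := h 0.
have [->] := h 0; congr (_ :: _).
by apply: IH => i; have := h i.+1.
Qed.

Section Machines.

Variable w : nat.

Notation tapes := (w.+1.-tuple tape).
Notation action := (w.+1.-tuple (symbol * direction)).

(** The number of tapes is fixed outside the record, so that machines acting on the same tapes can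
    be composed. *)
Record machine := Machine {
  state : finType;
  start : state;
  final : pred state;
  trans : state -> w.+1.-tuple symbol -> state * action
}.

Definition to_tm (F : machine) : turing_machine :=
  @TuringMachine (state F) w (@start F) (@final F) (@trans F).

Definition step (F : machine) (c : state F * tapes) : state F * tapes :=
  @tm_step (to_tm F) c.

Definition tape_at (tp : tapes) i := nth empty_tape tp i.

Definition apply_action (a : action) (tp : tapes) : tapes :=
  [tuple tape_move (tnth a i).2 (tape_write (tnth a i).1 (tnth tp i)) | i < w.+1].

Definition view (tp : tapes) : w.+1.-tuple symbol := [tuple tape_read (tnth tp i) | i < w.+1].

Definition idle (v : w.+1.-tuple symbol) : action := [tuple (tnth v i, Stay) | i < w.+1].

Lemma step_final F s tp : @final F s -> step (s, tp) = (s, tp).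
Proof. by move=> h; rewrite /step /tm_step /= h. Qed.

Lemma stepE F s tp : ~~ @final F s ->
  step (s, tp) = ((trans s (view tp)).1, apply_action (trans s (view tp)).2 tp).
Proof. by move=> /negPf h; rewrite /step /tm_step /= h. Qed.

Lemma nth_view tp i : nth None (view tp) i = if i < w.+1 then tape_read (tape_at tp i) else None.
Proof.
case: ltnP => h; last by rewrite nth_default // size_tuple.
by rewrite -(tnth_nth None _ (Ordinal h)) tnth_mktuple (tnth_nth empty_tape).
Qed.

Lemma iter_final F t s tp : @final F s -> iter t (@step F) (s, tp) = (s, tp).
Proof. by move=> h; elim: t => //= t ->; rewrite step_final. Qed.

(** The time may drop to the first moment at which [F] is final: from then on [F] stands still,
    whereas [G] goes on with its own next phase. *)
Lemma iter_simulate F G (e : state F -> state G) t s tp s' tp' :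
  (forall s v, ~~ final s -> ~~ final (e s) /\
     trans (e s) v = (e (trans s v).1, (trans s v).2)) ->
  iter t (@step F) (s, tp) = (s', tp') -> final s' ->
  exists2 t', t' <= t & iter t' (@step G) (e s, tp) = (e s', tp').
Proof.
move=> sim; elim: t s tp => [|t IH] s tp.
  by move=> [-> ->] _; exists 0.
have [fs|nfs] := boolP (final s).
  by rewrite iter_final // => -[-> ->] _; exists 0.
rewrite iterSr stepE // => /IH{}IH /IH[t' le_t' h].
exists t'.+1; rewrite ?ltnS // iterSr.
have [nfe eqt] := sim s (view tp) nfs.
by rewrite stepE // eqt.
Qed.

Definition triple (F : machine) (P : tapes -> Prop) (t : nat) (Q : tapes -> Prop) :=
  forall tp, P tp -> exists t' s tp',
    [/\ t' <= t, iter t' (@step F) (start F, tp) = (s, tp'), final s & Q tp'].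

(** Control transitions (handing over, testing, looping) take a step that idles on all tapes, so the
    assertions between two phases have to survive it. *)
Definition idle_closed (P : tapes -> Prop) :=
  forall tp, P tp -> P (apply_action (idle (view tp)) tp).

Lemma triple_weaken F (P P' Q Q' : tapes -> Prop) t t' :
  (forall tp, P' tp -> P tp) -> t <= t' -> (forall tp, Q tp -> Q' tp) ->
  triple F P t Q -> triple F P' t' Q'.
Proof.
move=> hP ht hQ h tp /hP/h[u [s [tp' [lt e f q]]]].
by exists u, s, tp'; split=> //; [apply: leq_trans ht | apply: hQ].
Qed.

Definition nop : machine := @Machine unit tt xpredT (fun s v => (s, idle v)).

Lemma triple_nop P : triple nop P 0 P.
Proof. by move=> tp Ptp; exists 0, tt, tp. Qed.

Definition seqm (F G : machine) : machine :=
  @Machine (state F + state G)%type (inl (start F))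
    (fun s => if s is inr s' then final s' else false)
    (fun s v => match s with
      | inl s => if final s then (inr (start G), idle v)
                 else (inl (trans s v).1, (trans s v).2)
      | inr s => (inr (trans s v).1, (trans s v).2)
      end).

Lemma triple_seq F G P Q R t u : idle_closed Q ->
  triple F P t Q -> triple G Q u R -> triple (seqm F G) P (t + u).+1 R.
Proof.
move=> clQ hF hG tp /hF[t' [s [tp' [le_t ht fs Qtp]]]].
have [u' [s2 [tp2 [le_u hu fs2 Rtp]]]] := hG _ (clQ _ Qtp).
have [t1 le_t1 e1] := @iter_simulate F (seqm F G) inl t' _ _ _ _
  (fun s v nf => conj isT (f_equal (fun b : bool => if b then _ else _) (negPf nf))) ht fs.
have [u1 le_u1 e2] := @iter_simulate G (seqm F G) inr u' _ _ _ _
  (fun s v nf => conj nf erefl) hu fs2.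
exists (u1 + t1.+1), (inr s2), tp2; split=> //; first by lia.
by rewrite iterD iterS [X in step X]e1 stepE //= fs.
Qed.

Definition ifm r (g : pred symbol) (F G : machine) : machine :=
  @Machine (option (state F + state G)) None
    (fun s => match s with
      | None => false | Some (inl s) => final s | Some (inr s) => final s end)
    (fun s v => match s with
      | None => (Some (if g (nth None v r) then inl (start F) else inr (start G)), idle v)
      | Some (inl s) => (Some (inl (trans s v).1), (trans s v).2)
      | Some (inr s) => (Some (inr (trans s v).1), (trans s v).2)
      end).

Lemma triple_if r (g : pred symbol) F G (P Q : tapes -> Prop) t : r <= w -> idle_closed P ->
  triple F (fun tp => P tp /\ g (tape_read (tape_at tp r))) t Q ->
  triple G (fun tp => P tp /\ ~~ g (tape_read (tape_at tp r))) t Q ->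
  triple (ifm r g F G) P t.+1 Q.
Proof.
move=> ler clP hF hG tp Ptp.
set tp1 := apply_action (idle (view tp)) tp.
have rd : tape_read (tape_at tp1 r) = tape_read (tape_at tp r).
  rewrite /tape_at /tp1 -!(tnth_nth empty_tape _ (Ordinal (ler : r < w.+1))).
  by rewrite !tnth_mktuple.
have first : step (start (ifm r g F G), tp) =
   (Some (if g (tape_read (tape_at tp r)) then inl (start F) else inr (start G)), tp1).
  by rewrite stepE //= nth_view ltnS ler.
case: (boolP (g (tape_read (tape_at tp r)))) first => gr first.
  have [|u [s [tp2 [le_u hu fs Qt]]]] := hF tp1; first by rewrite rd; split=> //; exact: clP.
  have [u1 le1 e1] := @iter_simulate F (ifm r g F G) (Some \o inl) u _ _ _ _
    (fun s v nf => conj nf erefl) hu fs.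
  by exists u1.+1, (Some (inl s)), tp2; split=> //; [lia | rewrite iterSr first].
have [|u [s [tp2 [le_u hu fs Qt]]]] := hG tp1; first by rewrite rd; split=> //; exact: clP.
have [u1 le1 e1] := @iter_simulate G (ifm r g F G) (Some \o inr) u _ _ _ _
  (fun s v nf => conj nf erefl) hu fs.
by exists u1.+1, (Some (inr s)), tp2; split=> //; [lia | rewrite iterSr first].
Qed.

(** [None] performs the test, [Some None] is the exit and [Some (Some s)] runs the body, whose final
    states lead back to the test. *)
Definition whilem r (g : pred symbol) (F : machine) : machine :=
  @Machine (option (option (state F))) None
    (fun s => if s is Some None then true else false)
    (fun s v => match s with
      | None => (if g (nth None v r) then Some (Some (start F)) else Some None, idle v)
      | Some None => (s, idle v)
      | Some (Some s) => if final s then (None, idle v)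
                         else (Some (Some (trans s v).1), (trans s v).2)
      end).

Lemma triple_while_exit r (g : pred symbol) F (P : tapes -> Prop) : r <= w -> idle_closed P ->
  (forall tp, P tp -> ~~ g (tape_read (tape_at tp r))) ->
  triple (whilem r g F) P 1 P.
Proof.
move=> ler clP hP tp Ptp; exists 1, (Some None), (apply_action (idle (view tp)) tp).
by split=> //; [rewrite /= stepE //= nth_view ltnS ler (negPf (hP _ Ptp)) | exact: clP].
Qed.

Lemma triple_while_step r (g : pred symbol) F (P Q R : tapes -> Prop) t u :
  r <= w -> idle_closed P -> idle_closed Q ->
  (forall tp, P tp -> g (tape_read (tape_at tp r))) ->
  triple F P t Q -> triple (whilem r g F) Q u R ->
  triple (whilem r g F) P (t + u).+2 R.
Proof.
move=> ler clP clQ hP hF hW tp Ptp.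
have [t' [s [tp' [le_t ht fs Qtp]]]] := hF _ (clP _ Ptp).
have [u' [s2 [tp2 [le_u hu fs2 Rtp]]]] := hW _ (clQ _ Qtp).
have [t1 le_t1 e1] := @iter_simulate F (whilem r g F) (Some \o Some) t' _ _ _ _
  (fun s v nf => conj isT (f_equal (fun b : bool => if b then _ else _) (negPf nf))) ht fs.
exists (u' + t1.+2), s2, tp2; split=> //; first by lia.
rewrite iterD iterS iterSr stepE //= nth_view ltnS ler (hP _ Ptp) [X in step X]e1 stepE //= fs.
exact: hu.
Qed.

Lemma tape_at_action (f : nat -> symbol * direction) tp i : i < w.+1 ->
  tape_at (apply_action [tuple f (val j) | j < w.+1] tp) i =
  tape_move (f i).2 (tape_write (f i).1 (tape_at tp i)).
Proof.
move=> lt_i; rewrite /tape_at -!(tnth_nth _ _ (Ordinal lt_i)).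
by rewrite tnth_mktuple tnth_mktuple.
Qed.

Definition act r (f : symbol -> symbol * direction) (v : w.+1.-tuple symbol) : action :=
  [tuple if val i == r then f (nth None v r) else (nth None v (val i), Stay) | i < w.+1].

Definition act_tape (f : symbol -> symbol * direction) (t : tape) : tape :=
  tape_move (f (tape_read t)).2 (tape_write (f (tape_read t)).1 t).

Lemma tape_at_act r f tp i : i < w.+1 ->
  tape_at (apply_action (act r f (view tp)) tp) i =
  if i == r then act_tape f (tape_at tp i) else idle_tape (tape_at tp i).
Proof.
move=> lt_i; rewrite (tape_at_action (fun i => if i == r then _ else (nth None (view tp) i, Stay))) //.
by case: eqP => [<-|_]; rewrite nth_view lt_i.
Qed.

Lemma tape_at_idle tp i : i < w.+1 ->
  tape_at (apply_action (idle (view tp)) tp) i = idle_tape (tape_at tp i).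
Proof.
move=> lt_i; rewrite /tape_at -!(tnth_nth empty_tape _ (Ordinal lt_i)) /idle_tape.
by rewrite !tnth_mktuple.
Qed.

(* The first tapes hold the stacks [sg], possibly with garbage elsewhere, while
   the other ones agree with [rho] up to trailing blanks. *)
Definition holds (sg : seq (seq bool)) (rho : nat -> tape) (tp : tapes) : Prop :=
  [/\ size sg <= w.+1,
      forall i, i < size sg -> tape_bits (tape_at tp i) = nth [::] sg i
    & forall i, size sg <= i -> i < w.+1 -> same_tape (tape_at tp i) (rho i)].

Lemma holds_idle sg rho : idle_closed (holds sg rho).
Proof.
move=> tp [le_s hs hr]; split=> // i.
- move=> lt_i; rewrite tape_at_idle ?tape_bits_idle ?hs //; exact: leq_trans le_s.
- move=> le_i lt_i; rewrite tape_at_idle //.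
  exact: same_tape_trans (same_tape_idle _) (hr _ le_i lt_i).
Qed.

(** Quantifying over [rho] builds in a frame rule: the tapes beyond the stacks keep their contents
    up to trailing blanks. *)
Definition exec (F : machine) (sg : seq (seq bool)) (t : nat) (sg' : seq (seq bool)) :=
  forall rho, triple F (holds sg rho) t (holds sg' rho).

Definition upd (sg : seq (seq bool)) r v := set_nth [::] sg r v.

Lemma exec_weaken F sg t t' sg' : t <= t' -> exec F sg t sg' -> exec F sg t' sg'.
Proof. by move=> le_t h rho; apply: triple_weaken (h rho). Qed.

Lemma exec_nop sg : exec nop sg 0 sg.
Proof. by move=> rho; apply: triple_nop. Qed.

Lemma exec_seq F G sg sg' sg'' t u :
  exec F sg t sg' -> exec G sg' u sg'' -> exec (seqm F G) sg (t + u).+1 sg''.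
Proof. by move=> hF hG rho; apply: triple_seq (holds_idle (rho := rho)) (hF rho) (hG rho). Qed.

Lemma holds_read sg rho tp r : holds sg rho tp -> r < size sg ->
  tape_read (tape_at tp r) = ohead (nth [::] sg r).
Proof. by case=> _ hs _ lt_r; rewrite tape_read_bits hs. Qed.

Lemma exec_if r (g : pred symbol) F G sg t sg' : r < size sg ->
  exec (if g (ohead (nth [::] sg r)) then F else G) sg t sg' ->
  exec (ifm r g F G) sg t.+1 sg'.
Proof.
move=> lt_r h rho tp htp; have [le_s _ _] := htp.
have le_r : r <= w by rewrite -ltnS; exact: leq_trans le_s.
apply: (triple_if le_r (holds_idle (rho := rho))) (htp) => tp' [h' g'].
- by move: h; rewrite -(holds_read h') // g' => /(_ rho); apply.
- by move: h; rewrite -(holds_read h') // (negPf g') => /(_ rho); apply.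
Qed.

Lemma exec_while_exit r (g : pred symbol) F sg : r < size sg ->
  ~~ g (ohead (nth [::] sg r)) -> exec (whilem r g F) sg 1 sg.
Proof.
move=> lt_r ng rho tp htp; have [le_s _ _] := htp.
have le_r : r <= w by rewrite -ltnS; exact: leq_trans le_s.
apply: (triple_while_exit _ le_r (holds_idle (rho := rho))) (htp) => tp' h'.
by rewrite (holds_read h').
Qed.

Lemma exec_while_step r (g : pred symbol) F sg sg' sg'' t u : r < size sg ->
  g (ohead (nth [::] sg r)) -> exec F sg t sg' -> exec (whilem r g F) sg' u sg'' ->
  exec (whilem r g F) sg (t + u).+2 sg''.
Proof.
move=> lt_r gr hF hW rho tp htp; have [le_s _ _] := htp.
have le_r : r <= w by rewrite -ltnS; exact: leq_trans le_s.
apply: (triple_while_step le_r (holds_idle (rho := rho)) (holds_idle (rho := rho)) _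
  (hF rho) (hW rho)) (htp) => tp' h'.
by rewrite (holds_read h').
Qed.

Definition pop r : machine :=
  @Machine bool false id (fun s v => (true, act r (fun c => (c, MoveRight)) v)).

(** The model writes before it moves, so pushing takes two steps: move to the left, then overwrite
    whatever an earlier pop left there. *)
Definition push r b : machine :=
  @Machine (option bool) None (fun s => s == Some true)
    (fun s v => if s is None then (Some false, act r (fun c => (c, MoveLeft)) v)
                else (Some true, act r (fun _ => (Some b, Stay)) v)).

Lemma step_pop tp r :
  exists tp', step (start (pop r), tp) = (true, tp') /\
    forall i, i < w.+1 -> tape_at tp' i =
      (if i == r then pop_tape else idle_tape) (tape_at tp i).
Proof.
eexists; split; first by rewrite stepE.
by move=> i lt_i; rewrite tape_at_act //; case: eqP.
Qed.

Lemma step_push tp r b :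
  exists tp', iter 2 (@step (push r b)) (None, tp) = (Some true, tp') /\
    forall i, i < w.+1 -> tape_at tp' i =
      (if i == r then push_tape b else idle_tape \o idle_tape) (tape_at tp i).
Proof.
eexists; split; first by rewrite /= [X in step X]stepE // stepE.
by move=> i lt_i; rewrite /= !tape_at_act //; case: eqP.
Qed.

Lemma nth_upd sg r v i :
  nth [::] (upd sg r v) i = if i == r then v else nth [::] sg i.
Proof. by rewrite nth_set_nth. Qed.

Lemma size_upd sg r v : r < size sg -> size (upd sg r v) = size sg.
Proof. by rewrite size_set_nth => /maxn_idPr. Qed.

Lemma exec_pop r sg : r < size sg -> nth [::] sg r != [::] ->
  exec (pop r) sg 1 (upd sg r (behead (nth [::] sg r))).
Proof.
move=> lt_r nz rho tp htp; have [le_s hs hr] := htp.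
have [tp' [e h]] := step_pop tp r.
exists 1, true, tp'; split=> //; split; rewrite size_upd // => i lt_i.
- rewrite nth_upd // h; last exact: leq_trans le_s.
  case: eqP => [->|_]; last by rewrite tape_bits_idle hs.
  by rewrite tape_bits_pop ?hs // (holds_read htp) //; case: (nth _ _ _) nz.
- move=> lt_w; rewrite h //; case: eqP => [er|_]; first by rewrite er leqNgt lt_r in lt_i.
  exact: same_tape_trans (same_tape_idle _) (hr _ lt_i lt_w).
Qed.

Lemma exec_push r b sg : r < size sg ->
  exec (push r b) sg 2 (upd sg r (b :: nth [::] sg r)).
Proof.
move=> lt_r rho tp htp; have [le_s hs hr] := htp.
have [tp' [e h]] := step_push tp r b.
exists 2, (Some true), tp'; split=> //; split; rewrite size_upd // => i lt_i.
- rewrite nth_upd // h; last exact: leq_trans le_s.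
  case: eqP => [->|_]; last by rewrite /= !tape_bits_idle hs.
  by rewrite tape_bits_push ?hs.
- move=> lt_w; rewrite h //; case: eqP => [er|_]; first by rewrite er leqNgt lt_r in lt_i.
  apply: same_tape_trans (hr _ lt_i lt_w).
  exact: same_tape_trans (same_tape_idle _) (same_tape_idle _).
Qed.

(** A match on the word held by a stack, as [loop] is a fold over it; both consume what they
    read. *)
Definition popcase r (Fe F0 F1 : machine) : machine :=
  ifm r (pred1 None) Fe
    (ifm r (pred1 (Some true)) (seqm (pop r) F1) (seqm (pop r) F0)).

Definition loop r (F0 F1 : machine) : machine :=
  whilem r (predC1 None) (popcase r nop F0 F1).

Lemma exec_popcase r Fe F0 F1 sg t sg' : r < size sg ->
  (if nth [::] sg r is b :: v then exec (if b then F1 else F0) (upd sg r v) t sg'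
   else exec Fe sg t sg') ->
  exec (popcase r Fe F0 F1) sg (t + 4) sg'.
Proof.
move=> lt_r h; apply: (@exec_weaken _ _ (t + 2).+2); first by lia.
apply: exec_if => //.
case E: (nth [::] sg r) h => [|b v] h /=; first by apply: exec_weaken h; lia.
apply: (@exec_weaken _ _ (1 + t).+2); first by lia.
apply: exec_if => //.
have hp : exec (pop r) sg 1 (upd sg r v).
  by have := @exec_pop r sg lt_r; rewrite E; apply.
by rewrite E; case: b {E} h => h; apply: exec_seq h.
Qed.

Lemma exec_loop_nil r F0 F1 sg : r < size sg -> nth [::] sg r = [::] ->
  exec (loop r F0 F1) sg 1 sg.
Proof. by move=> lt_r E; apply: exec_while_exit; rewrite ?E. Qed.

(** Unfolds one round, so that each loop is verified by induction on the word or counter that drives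
    it. The 6 consists of four steps of [popcase] and two of the loop. *)
Lemma exec_loop_cons r F0 F1 sg b v sg' sg'' t u : r < size sg ->
  nth [::] sg r = b :: v -> exec (if b then F1 else F0) (upd sg r v) t sg' ->
  exec (loop r F0 F1) sg' u sg'' -> exec (loop r F0 F1) sg (t + u + 6) sg''.
Proof.
move=> lt_r E hF hL; apply: (@exec_weaken _ _ (t + 4 + u).+2); first by lia.
apply: exec_while_step hL => //; first by rewrite E.
by apply: exec_popcase; rewrite // E.
Qed.

Definition move a b := loop a (push b false) (push b true).
Definition clear a := loop a nop nop.

Lemma exec_clear a sg : a < size sg ->
  exec (clear a) sg (6 * size (nth [::] sg a) + 1) (upd sg a [::]).
Proof.
move E: (nth [::] sg a) => v; elim: v sg E => [|b v IH] sg E lt_a.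
  have -> : upd sg a [::] = sg.
    apply: (@eq_from_nth _ [::]) => [|i]; rewrite size_upd //.
    by rewrite nth_upd //; case: eqP => // ->.
  exact: exec_loop_nil.
apply: (@exec_weaken _ _ (0 + (6 * size v + 1) + 6)); first by rewrite /=; lia.
apply: exec_loop_cons E _ _; rewrite ?if_same //; first exact: exec_nop.
have := IH (upd sg a v); rewrite nth_upd // eqxx size_upd // /upd set_set_nth eqxx.
by apply.
Qed.

Lemma exec_move a b sg : a < size sg -> b < size sg -> a != b ->
  exec (move a b) sg (8 * size (nth [::] sg a) + 1)
    (upd (upd sg a [::]) b (catrev (nth [::] sg a) (nth [::] sg b))).
Proof.
move=> + + ab; move E: (nth [::] sg a) => v; elim: v sg E => [|c v IH] sg E lt_a lt_b.
  have -> : upd (upd sg a [::]) b (catrev [::] (nth [::] sg b)) = sg.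
    apply: (@eq_from_nth _ [::]) => [|i]; rewrite !size_upd ?size_upd //.
    rewrite !nth_upd ?size_upd // => _.
    by case: eqP => [->|_] //; case: eqP => // ->.
  exact: exec_loop_nil.
apply: (@exec_weaken _ _ (2 + (8 * size v + 1) + 6)); first by rewrite /=; lia.
have lt_b' : b < size (upd sg a v) by rewrite size_upd.
set sg1 := upd (upd sg a v) b (c :: nth [::] (upd sg a v) b).
have hp : exec (if c then push b true else push b false) (upd sg a v) 2 sg1.
  by rewrite /sg1; case: (c); exact: exec_push.
apply: (exec_loop_cons lt_a E hp).
have sz1 : size sg1 = size sg by rewrite /sg1 !size_upd.
have Ea : nth [::] sg1 a = v by rewrite /sg1 !nth_upd // (negPf ab) eqxx.
have Eb : nth [::] sg1 b = c :: nth [::] sg b.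
  by rewrite /sg1 !nth_upd // eqxx eq_sym (negPf ab).
have lt_a1 : a < size sg1 by rewrite sz1.
have lt_b1 : b < size sg1 by rewrite sz1.
suff <- : upd (upd sg1 a [::]) b (catrev v (nth [::] sg1 b)) =
          upd (upd sg a [::]) b (catrev (c :: v) (nth [::] sg b)) by exact: IH.
rewrite Eb; apply: (@eq_from_nth _ [::]) => [|i]; rewrite !size_upd ?size_upd ?sz1 //.
rewrite /sg1 !nth_upd ?size_upd ?sz1 // => _.
by do 2 case: eqP => //.
Qed.

Fixpoint push_many r k : machine := if k is k'.+1 then seqm (push r true) (push_many r k') else nop.

Lemma exec_push_many r k sg : r < size sg ->
  exec (push_many r k) sg (3 * k) (upd sg r (nseq k true ++ nth [::] sg r)).
Proof.
move=> lt_r; elim: k sg lt_r => [|k IH] sg lt_r /=.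
  have -> : upd sg r (nth [::] sg r) = sg; last exact: exec_nop.
  apply: (@eq_from_nth _ [::]) => [|i]; rewrite size_upd // nth_upd // => _.
  by case: eqP => // ->.
apply: (@exec_weaken _ _ (2 + 3 * k).+1); first by lia.
apply: exec_seq (exec_push true lt_r) _.
have := IH (upd sg r (true :: nth [::] sg r)); rewrite size_upd // nth_upd // eqxx.
rewrite /upd set_set_nth eqxx -cat_rcons -cats1 -[[:: true]]/(nseq 1 true) -nseqD addn1.
exact.
Qed.

Lemma triple_tm_computes F ins t out :
  triple F (fun tp => forall i, i < w.+1 -> tape_at tp i = tape_of_bits (nth [::] ins i)) t
    (fun tp => tape_bits (tape_at tp 0) = out) ->
  tm_computes (to_tm F) ins t out.
Proof.
move=> h; have [|u [s [tp [le_u e fs out_tp]]]] :=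
  h [tuple tape_of_bits (nth [::] ins i) | i < w.+1].
  by move=> i; exact: (@nth_mktuple_nat _ _ _ (fun i => tape_of_bits (nth [::] ins i))).
(* A halted configuration no longer changes, so halting within [t] steps suffices. *)
rewrite /tm_computes -(subnK le_u) iterD; set c := iter u _ _.
have -> : c = (s, tp) := e.
have -> := @iter_final F (t - u) s tp fs.
by rewrite (tnth_nth empty_tape).
Qed.

Lemma exec_tm_computes F ins sg t sg' : 0 < size sg' -> size sg = w.+1 ->
  (forall i, nth [::] sg i = nth [::] ins i) -> exec F sg t sg' ->
  tm_computes (to_tm F) ins t (nth [::] sg' 0).
Proof.
move=> gt0 sz_sg sg_ins h; apply: triple_tm_computes.
apply: triple_weaken (h (fun _ => empty_tape)) => // tp.
- move=> tp_ins; split=> [|i lt_i|i le_i lt_i]; first by rewrite sz_sg.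
  + by rewrite tp_ins -?sz_sg // tape_bits_of_bits sg_ins.
  + by rewrite -sz_sg ltnNge le_i in lt_i.
- by case=> _ /(_ 0 gt0).
Qed.

End Machines.

(** * The verifier of the query *)

Ltac xseq := eapply exec_seq.
Ltac xpush := apply: exec_push; by [].

Fixpoint decimate (b : bool) (s : seq bool) : seq bool :=
  match s with
  | c :: d :: s' => (if b then d else c) :: decimate b s'
  | [:: c] => if b then [::] else [:: c]
  | [::] => [::]
  end.

Lemma decimate_ind (P : seq bool -> Prop) : P [::] -> (forall c, P [:: c]) ->
  (forall c d s, P s -> P [:: c, d & s]) -> forall s, P s.
Proof.
move=> P0 P1 P2 s; elim: {s}(size s).+1 {-2}s (ltnSn (size s)) => // n IH [|c [|d s]] //= lt_s.
by apply: P2; apply: IH; lia.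
Qed.

Lemma size_decimate b s : size (decimate b s) <= size s.
Proof. by elim/decimate_ind: s => [|c|c d s IH] //=; [case: b | lia]. Qed.

Lemma nth_decimate b s i : nth false (decimate b s) i = nth false s (b + i.*2).
Proof.
elim/decimate_ind: s i => [|c|c d s IH] i /=.
- by rewrite !nth_nil.
- by case: (b); case: i => [|i] //=; rewrite ?nth_nil.
- by case: i => [|i]; [case: (b) | rewrite /= IH doubleS; case: (b)].
Qed.

(* Addresses are read least significant bit first, so each bit halves the table. *)
Lemma head_foldl_decimate s y : head false (foldl (fun y b => decimate b y) y s) = nth false y (nat_of_bits s).
Proof. by elim: s y => [|b s IH] y /=; rewrite ?nth0 // IH nth_decimate. Qed.

(* The entry of the proof addressed by the bits read so far is at the head of
   [addr]; [bad] is nonempty if the current sample disagrees with the proof. *)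
Record check_state := CheckState {
  addr : seq bool; bad : seq bool; pos : seq bool; neg : seq bool
}.

Section Check.

Variables (Q : nat) (y : seq bool).

Definition check_index b st :=
  CheckState (decimate b (addr st)) (bad st) (pos st) (neg st).

Definition check_value b st :=
  CheckState y (if head false (addr st) == b then bad st else true :: bad st) (pos st) (neg st).

Definition check_end b st :=
  CheckState (addr st) [::] (if b && nilp (bad st) then nseq Q true ++ pos st else pos st)
    (true :: neg st).

Fixpoint check_run (x : seq bool) st :=
  match x with
  | [:: false, b & x'] => check_run x' (check_index b st)
  | [:: true, false, b & x'] => check_run x' (check_value b st)
  | [:: true, true, b & x'] => check_run x' (check_end b st)
  | _ => st
  end.

(* Each successful sample adds [Q] to [pos] and each sample adds 1 to [neg], so the
   threshold is a 1/Q fraction of successes. *)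
Definition check (x : seq bool) : bool :=
  let st := check_run x (CheckState y [::] [::] [::]) in size (neg st) <= size (pos st).

(* Tapes: 0 query, 1 proof, 2 [addr], 3 scratch, 4 [bad], 5 [pos], 6 [neg]. *)
Notation nop := (nop 6).
Notation push := (push 6).
Notation move := (move 6).
Notation clear := (clear 6).

(** To keep the second bits, each popped bit only triggers the copy of its successor; to keep the
    first ones, it is copied and its successor dropped. The empty branch of [popcase] covers odd
    lengths. *)
Definition halve_loop b : machine 6 :=
  if b then let f := popcase 2 nop (push 3 false) (push 3 true) in loop 2 f f
  else loop 2 (seqm (push 3 false) (popcase 2 nop nop nop)) (seqm (push 3 true) (popcase 2 nop nop nop)).

Definition halve_m b : machine 6 :=
  seqm (halve_loop b) (move 3 2).

(** Reading a stack destroys it: [y] is reversed onto the scratch tape and from there pushed both to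
    its own tape and to the address table. *)
Definition restore_m : machine 6 :=
  seqm (clear 2) (seqm (move 1 3)
    (loop 3 (seqm (push 1 false) (push 2 false)) (seqm (push 1 true) (push 2 true)))).

Definition value_m b : machine 6 :=
  seqm (ifm 2 (pred1 (Some true)) (if b then nop else push 4 true)
                                  (if b then push 4 true else nop))
       restore_m.

Definition sample_end_m (b : bool) : machine 6 :=
  seqm (if b then ifm 4 (pred1 None) (push_many 6 5 Q) nop else nop)
       (seqm (clear 4) (push 6 true)).

(** Mirrors [check_run], truncated tokens included: the relation has to be decided on all pairs of
    strings, not only on those that the circuit can produce. *)
Definition check_body : machine 6 :=
  loop 0 (popcase 0 nop (halve_m false) (halve_m true))
           (popcase 0 nop
             (popcase 0 nop (value_m false) (value_m true))
             (popcase 0 nop (sample_end_m false) (sample_end_m true))).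

(** Truncated subtraction in unary: tape 4, cleared beforehand, receives one bit for each unit of
    [neg] that [pos] cannot match. *)
Definition compare_m : machine 6 :=
  let f := popcase 5 (push 4 true) nop nop in loop 6 f f.

Definition check_m : machine 6 :=
  seqm restore_m (seqm
   check_body
   (seqm (clear 4) (seqm
     compare_m
     (ifm 4 (pred1 None) (push 0 true) (push 0 false))))).

Lemma exec_halve b x y1 s bd p q :
  exec (halve_m b) [:: x; y1; s; [::]; bd; p; q] (30 * size s + 30)
    [:: x; y1; decimate b s; [::]; bd; p; q].
Proof.
have H : forall tmp, exec (halve_loop b)
  [:: x; y1; s; tmp; bd; p; q] (15 * size s + 1) [:: x; y1; [::]; catrev (decimate b s) tmp; bd; p; q].
  rewrite /halve_loop; elim/decimate_ind: s => [|c|c d s IH] tmp.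
  - by case: b; apply: exec_loop_nil.
  - case: b.
    + apply: (@exec_weaken _ _ _ (4 + 1 + 6)) => //.
      apply: (@exec_loop_cons _ 2 _ _ _ c [::]) => //; last exact: exec_loop_nil.
      by rewrite if_same; apply: (@exec_popcase _ 2 _ _ _ _ 0); last exact: exec_nop.
    + apply: (@exec_weaken _ _ _ ((2 + (0 + 4)).+1 + 1 + 6)) => //.
      apply: (@exec_loop_cons _ 2 _ _ _ c [::]) => //; last exact: exec_loop_nil.
      by case: c; (xseq; first xpush); apply: exec_popcase => //; exact: exec_nop.
  - have {}IH := IH ((if b then d else c) :: tmp).
    apply: (@exec_weaken _ _ _ (7 + (15 * size s + 1) + 6)); first by rewrite /=; lia.
    case: b IH => IH.
    + apply: (@exec_loop_cons _ 2 _ _ _ c [:: d & s]) IH => //.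
      rewrite if_same; apply: (@exec_weaken _ _ _ (2 + 4)) => //.
      by apply: exec_popcase => //=; case: d; xpush.
    + apply: (@exec_loop_cons _ 2 _ _ _ c [:: d & s]) IH => //.
      apply: (@exec_weaken _ _ _ (2 + (0 + 4)).+1) => //.
      by case: c; (xseq; first xpush); apply: exec_popcase => //=; case: d; exact: exec_nop.
have sz := size_decimate b s.
apply: (@exec_weaken _ _ _ ((15 * size s + 1) + (8 * size (catrev (decimate b s) [::]) + 1)).+1).
  by rewrite size_rev; lia.
apply: exec_seq (H [::]) _.
have := @exec_move 6 3 2 [:: x; y1; [::]; rev (decimate b s); bd; p; q] erefl erefl erefl.
by rewrite /upd /= -[catrev _ [::]]/(rev _) revK.
Qed.

Lemma exec_restore x s bd p q :
  exec restore_m [:: x; y; s; [::]; bd; p; q] (6 * size s + 20 * size y + 10)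
    [:: x; y; y; [::]; bd; p; q].
Proof.
have H v y1 y2 : exec (loop 3 (seqm (push 1 false) (push 2 false))
    (seqm (push 1 true) (push 2 true))) [:: x; y1; y2; v; bd; p; q] (11 * size v + 1)
    [:: x; catrev v y1; catrev v y2; [::]; bd; p; q].
  elim: v y1 y2 => [|c v IH] y1 y2; first exact: exec_loop_nil.
  apply: (@exec_weaken _ _ _ ((2 + 2).+1 + (11 * size v + 1) + 6)); first by rewrite /=; lia.
  apply: (@exec_loop_cons _ 3 _ _ _ c v) (IH (c :: y1) (c :: y2)) => //.
  by case: (c); (xseq; xpush).
apply: (@exec_weaken _ _ _ ((6 * size s + 1) + ((8 * size y + 1) + (11 * size (rev y) + 1)).+1).+1).
  by rewrite size_rev; lia.
apply: exec_seq (exec_clear (a := 2) (sg := [:: x; y; s; [::]; bd; p; q]) erefl) _.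
apply: exec_seq (exec_move (a := 1) (b := 3) (sg := [:: x; y; [::]; [::]; bd; p; q]) erefl erefl erefl) _.
by have := H (rev y) [::] [::]; rewrite -!/(rev _) revK.
Qed.

Lemma exec_value b x s bd p q :
  exec (value_m b) [:: x; y; s; [::]; bd; p; q] (6 * size s + 20 * size y + 20)
    [:: x; y; y; [::]; if head false s == b then bd else true :: bd; p; q].
Proof.
apply: (@exec_weaken _ _ _ (3 + (6 * size s + 20 * size y + 10)).+1); first by lia.
apply: exec_seq _ (@exec_restore x s _ p q).
apply: exec_if => //=.
have -> : (ohead s == Some true) = head false s by case: s => [|[]].
by case: (head false s); case: b => /=; try xpush; apply: exec_weaken (@exec_nop _ _).
Qed.

Lemma exec_sample_end b x s bd p q :
  exec (sample_end_m b) [:: x; y; s; [::]; bd; p; q] (3 * Q + 6 * size bd + 10)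
    [:: x; y; s; [::]; [::]; if b && nilp bd then nseq Q true ++ p else p; true :: q].
Proof.
apply: (@exec_weaken _ _ _ ((3 * Q).+1 + ((6 * size bd + 1) + 2).+1).+1); first by lia.
apply: (@exec_seq _ _ _ _ [:: x; y; s; [::]; bd; if b && nilp bd then nseq Q true ++ p else p; q]).
  case: b => /=; last by apply: exec_weaken (@exec_nop _ _).
  apply: exec_if => //=; case: bd => [|c bd] /=; last by apply: exec_weaken (@exec_nop _ _).
  exact: (@exec_push_many 6 5 Q [:: x; y; s; [::]; [::]; p; q]).
apply: exec_seq (exec_clear (a := 4) (sg := [:: _; _; _; _; _; _; _]) erefl) _.
by xpush.
Qed.

Notation stacks x st := [:: x; y; addr st; [::]; bad st; pos st; neg st].

Lemma check_run_ind (P : seq bool -> Prop) :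
  P [::] -> (forall x b, P x -> P [:: false, b & x]) ->
  (forall x b c, P x -> P [:: true, b, c & x]) -> P [:: false] -> P [:: true] ->
  (forall b, P [:: true; b]) -> forall x, P x.
Proof.
move=> P0 P1 P2 P3 P4 P5 x; elim: {x}(size x).+1 {-2}x (ltnSn (size x)) => // n IH.
case=> [|[] [|b [|c x]]] //= lt_x; try by [exact: P5 | exact: (P1 [::])].
- by apply: P2; apply: IH; lia.
- by apply: P1; apply: IH => /=; lia.
Qed.

(** The bound [m] is preserved: the address table shrinks or is reset to [y], and [bad] gains at
    most one bit per token, which is paid for by the bits of [x] just consumed. Hence no round costs
    more than [D]. *)
Lemma exec_check_run x st m :
  size (addr st) <= m -> size y <= m -> size (bad st) + size x <= m ->
  exec check_body (stacks x st) (size x * (30 * m + 3 * Q + 60) + 1)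
    (stacks [::] (check_run x st)).
Proof.
move=> + ym; set D := 30 * m + 3 * Q + 60; rewrite /check_body.
elim/check_run_ind: x st => [|x b IH|x b c IH|||b] [s bd p q] /= sm bm.
- exact: exec_loop_nil.
- have sz := size_decimate b s.
  apply: (@exec_weaken _ _ _ ((30 * size s + 30 + 4) + (size x * D + 1) + 6)).
    by rewrite !mulSn; lia.
  apply: (@exec_loop_cons _ 0 _ _ _ false [:: b & x]) (IH _ _ _) => //=; try lia.
  apply: exec_popcase => //=.
  by case: (b); apply: exec_halve.
- case: b.
  + apply: (@exec_weaken _ _ _ ((3 * Q + 6 * size bd + 10 + 4 + 4) + (size x * D + 1) + 6)).
      by rewrite !mulSn; lia.
    apply: (@exec_loop_cons _ 0 _ _ _ true [:: true, c & x]) (IH _ _ _) => //=; try lia.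
    apply: exec_popcase => //=; apply: exec_popcase => //=.
    by case: (c); apply: exec_sample_end.
  + apply: (@exec_weaken _ _ _ ((6 * size s + 20 * size y + 20 + 4 + 4) + (size x * D + 1) + 6)).
      by rewrite !mulSn; lia.
    apply: (@exec_loop_cons _ 0 _ _ _ true [:: false, c & x]) (IH _ _ _) => //=;
      try by case: ifP => /=; lia.
    apply: exec_popcase => //=; apply: exec_popcase => //=.
    by case: (c); apply: exec_value.
- apply: (@exec_weaken _ _ _ ((0 + 4) + 1 + 6)); first by rewrite /D; lia.
  apply: (@exec_loop_cons _ 0 _ _ _ false [::]) (@exec_loop_nil _ _ _ _ _ _ _) => //.
  by apply: exec_popcase => //; exact: exec_nop.
- apply: (@exec_weaken _ _ _ ((0 + 4) + 1 + 6)); first by rewrite /D; lia.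
  apply: (@exec_loop_cons _ 0 _ _ _ true [::]) (@exec_loop_nil _ _ _ _ _ _ _) => //.
  by apply: exec_popcase => //; exact: exec_nop.
- apply: (@exec_weaken _ _ _ ((0 + 4 + 4) + 1 + 6)); first by rewrite /D; lia.
  apply: (@exec_loop_cons _ 0 _ _ _ true [:: b]) (@exec_loop_nil _ _ _ _ _ _ _) => //.
  by apply: exec_popcase => //=; case: b; apply: exec_popcase => //; exact: exec_nop.
Qed.

Lemma exec_compare s bd p q y1 :
  exec compare_m [:: [::]; y1; s; [::]; bd; p; q] (12 * size q + 1)
    [:: [::]; y1; s; [::]; nseq (size q - size p) true ++ bd; drop (size q) p; [::]].
Proof.
rewrite /compare_m; elim: q p bd => [|c q IH] p bd /=; first by rewrite drop0; exact: exec_loop_nil.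
apply: (@exec_weaken _ _ _ ((2 + 4) + (12 * size q + 1) + 6)); first by lia.
case: p => [|d p].
- apply: (@exec_loop_cons _ 6 _ _ _ c q [:: [::]; y1; s; [::]; true :: bd; [::]; q]) => //=.
    by rewrite if_same; apply: exec_popcase => //=; xpush.
  have := IH [::] (true :: bd); rewrite !subn0 /=.
  by rewrite -cat_rcons -cats1 -[[:: true]]/(nseq 1 true) -nseqD [size q + 1]addn1.
- apply: (@exec_loop_cons _ 6 _ _ _ c q) (IH p bd) => //=.
  rewrite if_same; apply: (@exec_popcase _ 5 _ _ _ _ 2) => //=.
  by rewrite if_same; apply: exec_weaken (@exec_nop _ _).
Qed.

(** These lengths bound the final clearing of [bad] and the comparison, whose number of rounds is
    the length of [neg]. *)
Lemma size_check_run x st :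
  size (bad (check_run x st)) <= size (bad st) + size x /\
  size (neg (check_run x st)) <= size (neg st) + size x.
Proof.
elim/check_run_ind: x st => [|x b IH|x b c IH|||b] st /=; rewrite ?addn0; try by split; lia.
- by have /= := IH (check_index b st); lia.
- case: b; first by have /= := IH (check_end c st); lia.
  by have /= := IH (check_value c st); case: ifP => /= _; lia.
- by case: b => /=; split; lia.
Qed.

Lemma exec_check x m : size x + size y <= m ->
  exec check_m [:: x; y; [::]; [::]; [::]; [::]; [::]]
    (m * (30 * m + 3 * Q + 60) + 60 * m + 60)
    [:: [:: check x]; y; addr (check_run x (CheckState y [::] [::] [::])); [::];
       nseq (size (neg (check_run x (CheckState y [::] [::] [::]))) -
             size (pos (check_run x (CheckState y [::] [::] [::])))) true;
       drop (size (neg (check_run x (CheckState y [::] [::] [::]))))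
          (pos (check_run x (CheckState y [::] [::] [::]))); [::]].
Proof.
move=> le_m; have [] := size_check_run x (CheckState y [::] [::] [::]).
rewrite /check; set st := check_run _ _; rewrite /= !add0n => sb sn.
pose t1 := 6 * 0 + 20 * size y + 10.
pose t2 := size x * (30 * m + 3 * Q + 60) + 1.
apply: (@exec_weaken _ _ _ (t1 + (t2 + ((6 * size (bad st) + 1) +
   ((12 * size (neg st) + 1) + 3).+1).+1).+1).+1).
  have : size x * (30 * m + 3 * Q + 60) <= m * (30 * m + 3 * Q + 60) by rewrite leq_mul2r; lia.
  by rewrite /t1 /t2; lia.
apply: exec_seq (@exec_restore x [::] [::] [::] [::]) _.
apply: exec_seq (@exec_check_run x (CheckState y [::] [::] [::]) m _ _ _) _ => /=; try lia.
apply: exec_seq (@exec_clear _ 4 (stacks [::] st) erefl) _.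
apply: exec_seq (@exec_compare (addr st) [::] (pos st) (neg st) y) _.
rewrite cats0; apply: exec_if => //=.
rewrite -subn_eq0; case E: (size (neg st) - size (pos st)) => [|k] /=; xpush.
Qed.

End Check.

(** * Closure properties of polynomial bounds *)

Lemma poly_bounded_leq (f g : nat -> nat) : (forall n, f n <= g n) -> poly_bounded g -> poly_bounded f.
Proof. by move=> fg [k gk]; exists k => n; apply: leq_trans (fg n) (gk n). Qed.

Lemma poly_bounded_id : poly_bounded id.
Proof. by exists 1 => n; rewrite expn1 leq_addr. Qed.

Lemma poly_bounded_const c : poly_bounded (fun=> c).
Proof. by exists c => n; rewrite leq_addl. Qed.

(** In this form closure is immediate: products add exponents and, the base being at least 2, a sum
    is absorbed by one more factor. *)
Lemma poly_boundedP f : poly_bounded f <-> exists k, forall n, f n <= (n + 2) ^ k.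
Proof.
split=> -[k fk].
  exists k => n; apply: leq_trans (fk n) _.
  case: k {fk} => [|k] //; apply: (@leq_trans (n ^ k.+1 + 2 ^ k.+1)).
    by rewrite leq_add2l ltnW // ltn_expl.
  elim: k => [|k IH]; first by rewrite !expn1.
  rewrite ![_ ^ k.+2]expnS mulnDl; apply: (@leq_trans ((n + 2) * (n ^ k.+1 + 2 ^ k.+1))).
    by rewrite mulnDl leq_add // leq_mul2l ?leq_addr ?leq_addl orbT.
  by rewrite -mulnDl leq_mul2l IH orbT.
(* The summand 3^k covers n = 0 and n = 1; for larger n, n + 2 <= n^2 and the exponent 2k
   suffices. *)
exists (3 ^ k + 2 * k) => n; apply: leq_trans (fk n) _.
have small c : c <= 3 -> c ^ k <= 3 ^ k by case: (k) => // k' h; rewrite leq_exp2r.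
case: n => [|[|n]]; first by have := small 2 isT; rewrite add0n; lia.
  by have := small 3 isT; rewrite add1n; lia.
apply: leq_trans (leq_addr _ _); apply: (@leq_trans (n.+2 ^ (2 * k))).
  by case: (k) => // k'; rewrite expnM leq_exp2r //; nia.
by rewrite leq_pexp2l // leq_addl.
Qed.

Lemma poly_boundedM f g : poly_bounded f -> poly_bounded g -> poly_bounded (fun n => f n * g n).
Proof.
move=> /poly_boundedP[k fk] /poly_boundedP[l gl]; apply/poly_boundedP.
by exists (k + l) => n; rewrite expnD leq_mul.
Qed.

Lemma poly_boundedD f g : poly_bounded f -> poly_bounded g -> poly_bounded (fun n => f n + g n).
Proof.
move=> /poly_boundedP[k fk] /poly_boundedP[l gl]; apply/poly_boundedP.
exists (k + l).+1 => n; apply: leq_trans (leq_add (fk n) (gl n)) _.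
apply: (@leq_trans ((n + 2) ^ (k + l) + (n + 2) ^ (k + l))).
  by rewrite leq_add // leq_pexp2l ?addn2 // ?leq_addr ?leq_addl.
by rewrite addnn -mul2n expnS leq_mul2r leq_addl orbT.
Qed.

Ltac poly_bound := repeat first
  [ exact: poly_bounded_id | exact: poly_bounded_const | assumption
  | apply: poly_boundedM | apply: poly_boundedD ].

Lemma check_polytime Q : polytime_relation (fun x y => check Q y x).
Proof.
exists (to_tm (check_m Q)), (fun m => m * (30 * m + 3 * Q + 60) + 60 * m + 60).
split; first by poly_bound.
move=> x y; apply: exec_tm_computes (exec_check Q (leqnn _)) => //.
by do 8 case=> //.
Qed.

(** * The generator of the circuit *)

(** The encoding of a list without its terminator, hence a morphism for concatenation: the code can
    be written piecewise and closed once at the end. *)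
Definition encode_items (T : Type) (e : T -> seq bool) (s : seq T) : seq bool :=
  flatten [seq true :: e x | x <- s].

Lemma encode_seqE T (e : T -> seq bool) s : encode_seq e s = rcons (encode_items e s) false.
Proof. by elim: s => //= x s ->; rewrite rcons_cat. Qed.

Lemma encode_seq_cons T (e : T -> seq bool) x s :
  encode_seq e (x :: s) = true :: e x ++ encode_seq e s.
Proof. by []. Qed.

Lemma encode_items_cat T (e : T -> seq bool) s1 s2 :
  encode_items e (s1 ++ s2) = encode_items e s1 ++ encode_items e s2.
Proof. by rewrite /encode_items map_cat flatten_cat. Qed.

Lemma catrev_cat (T : Type) (s1 s2 s : seq T) : catrev (s1 ++ s2) s = catrev s2 (catrev s1 s).
Proof. by rewrite !catrevE rev_cat catA. Qed.

Notation unary k := (nseq k true).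

Lemma catrev_unary k s : catrev (unary k) s = unary k ++ s.
Proof. by elim: k s => //= k IH s; rewrite IH -cat_rcons -cats1 -[[:: true]]/(unary 1) -nseqD addn1. Qed.

Lemma unaryD k l : unary k ++ unary l = unary (k + l). Proof. by rewrite nseqD. Qed.

Lemma unaryS k s : unary k ++ true :: s = unary k.+1 ++ s.
Proof. by rewrite -cat_rcons -cats1 -[[:: true]]/(unary 1) -nseqD addn1. Qed.

(* Templates of strings to be written: literal bits and copies of unary registers. *)
Inductive item := Bit of bool | Unary of nat.

Section Generator.

Variables (w q : nat).

Notation push := (push w).
Notation pop := (pop w).
Notation nop := (nop w).
Notation emitr := 8.

(** Reading a counter consumes it, so a second copy goes to the scratch stack, from which the
    register is rebuilt. *)
Definition copy_unary r d :=
  seqm (loop r nop (seqm (push emitr true) (push d true))) (loop emitr nop (push r true)).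

Fixpoint emit d (l : seq item) : machine w :=
  match l with
  | [::] => nop
  | Bit b :: l => seqm (push d b) (emit d l)
  | Unary r :: l => seqm (copy_unary r d) (emit d l)
  end.

Definition item_bits (sg : seq (seq bool)) it :=
  match it with Bit b => [:: b] | Unary r => nth [::] sg r end.

Definition items_bits sg l := flatten (map (item_bits sg) l).

Definition item_ok (sg : seq (seq bool)) m d it :=
  match it with
  | Bit b => true
  | Unary r => [&& r < size sg, r != d, r != emitr, size (nth [::] sg r) <= m &
               nth [::] sg r == unary (size (nth [::] sg r))]
  end.

Lemma upd_same sg r v : r < size sg -> nth [::] sg r = v -> upd sg r v = sg.
Proof.
move=> lt_r <-; apply: (@eq_from_nth _ [::]) => [|i]; rewrite size_upd // => lt_i.
by rewrite nth_upd //; case: eqP => // ->.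
Qed.

Lemma exec_copy_unary sg r d k :
  [&& r < size sg, d < size sg, emitr < size sg, r != d, r != emitr & d != emitr] ->
  nth [::] sg r = unary k -> nth [::] sg emitr = [::] ->
  exec (copy_unary r d) sg (20 * k + 5) (upd sg d (unary k ++ nth [::] sg d)).
Proof.
case/and5P=> lt_r lt_d lt_t rd /andP[rt dt] Er Et.
have H1 j s : size s = size sg -> nth [::] s r = unary j ->
   exec (loop r nop (seqm (push emitr true) (push d true))) s (11 * j + 1)
     (upd (upd (upd s r [::]) emitr (unary j ++ nth [::] s emitr)) d (unary j ++ nth [::] s d)).
  elim: j s => [|j IH] s sz Es.
    rewrite (upd_same (r := r)) ?sz // (upd_same (r := emitr)) ?sz // (upd_same (r := d)) ?sz //.
    by apply: exec_loop_nil; rewrite ?sz.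
  set s1 := upd (upd (upd s r (unary j)) emitr (true :: nth [::] s emitr)) d (true :: nth [::] s d).
  have sz1 : size s1 = size sg by rewrite /s1 !size_upd ?size_upd ?sz.
  have nth1 i : nth [::] s1 i = if i == d then true :: nth [::] s d else
      if i == emitr then true :: nth [::] s emitr else if i == r then unary j else nth [::] s i.
    by rewrite /s1 !nth_upd // ?size_upd ?sz // !size_upd ?sz.
  apply: (@exec_weaken _ _ _ ((2 + 2).+1 + (11 * j + 1) + 6)); first by lia.
  have {IH} := IH s1 sz1; rewrite !nth1 !eqxx (negPf rd) (negPf rt) => /(_ erefl).
  rewrite [emitr == d]eq_sym (negPf dt) !unaryS => IH.
  have -> : upd (upd (upd s r [::]) emitr (unary j.+1 ++ nth [::] s emitr)) d (unary j.+1 ++ nth [::] s d)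
      = upd (upd (upd s1 r [::]) emitr (unary j.+1 ++ nth [::] s emitr)) d (unary j.+1 ++ nth [::] s d).
    apply: (@eq_from_nth _ [::]) => [|i]; rewrite !size_upd ?size_upd ?sz1 ?sz // => _.
    by rewrite !nth_upd ?nth1; do 3 case: eqP => //.
  apply: (@exec_loop_cons w r _ _ s true (unary j) s1 _ _ _ _ _ _ IH); rewrite ?sz //.
  apply: (@exec_seq _ _ _ _ (upd (upd s r (unary j)) emitr (true :: nth [::] s emitr))).
    have := @exec_push w emitr true (upd s r (unary j)); rewrite size_upd ?sz // nth_upd ?sz //.
    by rewrite eq_sym (negPf rt); apply.
  have := @exec_push w d true (upd (upd s r (unary j)) emitr (true :: nth [::] s emitr)).
  rewrite !size_upd ?size_upd ?sz // !nth_upd ?size_upd ?sz // (negPf dt) eq_sym (negPf rd).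
  exact.
have H2 j s : size s = size sg -> nth [::] s emitr = unary j ->
   exec (loop emitr nop (push r true)) s (8 * j + 1)
     (upd (upd s emitr [::]) r (unary j ++ nth [::] s r)).
  elim: j s => [|j IH] s sz Es.
    rewrite (upd_same (r := emitr)) ?sz // (upd_same (r := r)) ?sz //.
    by apply: exec_loop_nil; rewrite ?sz.
  set s1 := upd (upd s emitr (unary j)) r (true :: nth [::] s r).
  have sz1 : size s1 = size sg by rewrite /s1 !size_upd ?size_upd ?sz.
  have nth1 i : nth [::] s1 i = if i == r then true :: nth [::] s r else
      if i == emitr then unary j else nth [::] s i.
    by rewrite /s1 !nth_upd // ?size_upd ?sz.
  apply: (@exec_weaken _ _ _ (2 + (8 * j + 1) + 6)); first by lia.
  have {IH} := IH s1 sz1; rewrite !nth1 !eqxx [emitr == r]eq_sym (negPf rt) => /(_ erefl).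
  rewrite unaryS => IH.
  have -> : upd (upd s emitr [::]) r (unary j.+1 ++ nth [::] s r) =
            upd (upd s1 emitr [::]) r (unary j.+1 ++ nth [::] s r).
    apply: (@eq_from_nth _ [::]) => [|i]; rewrite !size_upd ?size_upd ?sz1 ?sz // => _.
    by rewrite !nth_upd ?nth1; do 2 case: eqP => //.
  apply: (@exec_loop_cons w emitr _ _ s true (unary j) s1 _ _ _ _ _ _ IH); rewrite ?sz //.
  have := @exec_push w r true (upd s emitr (unary j)); rewrite size_upd ?sz // nth_upd ?sz //.
  by rewrite (negPf rt); apply.
apply: (@exec_weaken _ _ _ ((11 * k + 1) + (8 * k + 1)).+1); first by lia.
apply: exec_seq (H1 k sg erefl Er) _; rewrite Et cats0.
set s1 := upd _ d _.
have sz1 : size s1 = size sg by rewrite /s1 !size_upd ?size_upd.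
have nth1 i : nth [::] s1 i = if i == d then unary k ++ nth [::] sg d else
      if i == emitr then unary k else if i == r then [::] else nth [::] sg i.
  by rewrite /s1 !nth_upd // ?size_upd // !size_upd.
have := H2 k s1 sz1; rewrite !nth1 !eqxx [emitr == d]eq_sym (negPf dt) (negPf rd) (negPf rt).
move=> /(_ erefl); rewrite cats0.
have -> : upd (upd s1 emitr [::]) r (unary k) = upd sg d (unary k ++ nth [::] sg d); last by [].
apply: (@eq_from_nth _ [::]) => [|i]; rewrite !size_upd ?size_upd ?sz1 // => _.
rewrite !nth_upd.
case: (eqVneq i r) => [->|_]; first by rewrite (negPf rd) Er.
case: (eqVneq i d) => [->|_]; first by rewrite (negPf dt).
by case: (eqVneq i emitr) => [->|].
Qed.

Lemma exec_emit sg d l m : d < size sg -> emitr < size sg -> d != emitr ->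
  nth [::] sg emitr = [::] -> all (item_ok sg m d) l ->
  exec (emit d l) sg (size l * (20 * m + 10)) (upd sg d (catrev (items_bits sg l) (nth [::] sg d))).
Proof.
move=> lt_d lt_t dt; elim: l sg lt_d lt_t => [|it l IH] sg lt_d lt_t Et.
  by rewrite upd_same // => _; exact: exec_nop.
case/andP=> ok_it ok_l.
set s1 := upd sg d (catrev (item_bits sg it) (nth [::] sg d)).
have hs1 : exec (if it is Unary r then copy_unary r d else if it is Bit b then push d b else nop)
    sg (20 * m + 9) s1.
  case: it ok_it @s1 => [b _|r /and5P[lt_r rd rt le_m /eqP Er]] s1.
    by apply: exec_weaken (exec_push b lt_d); lia.
  apply: (@exec_weaken _ _ _ (20 * size (nth [::] sg r) + 5)); first by lia.
  rewrite /s1 /= Er catrev_unary size_nseq.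
  by apply: exec_copy_unary => //; apply/and5P; split=> //; rewrite rt.
have nth1 i : nth [::] s1 i = if i == d then catrev (item_bits sg it) (nth [::] sg d) else nth [::] sg i.
  by rewrite nth_upd.
have h2 : exec (emit d l) s1 (size l * (20 * m + 10))
    (upd s1 d (catrev (items_bits s1 l) (nth [::] s1 d))).
  apply: IH; rewrite ?size_upd ?nth1 ?[emitr == d]eq_sym ?(negPf dt) //.
  apply: sub_all ok_l => -[//|r] /and5P[lt_r rd rt le_m Er].
  by rewrite /= size_upd ?nth1 ?(negPf rd) //; apply/and5P.
have Eb : items_bits s1 l = items_bits sg l.
  elim: (l) ok_l => // a l' IHl /= /andP[ok_a /IHl]; rewrite /items_bits /= => ->.
  by case: a ok_a => [//|r /and5P[_ rd _ _ _]] /=; rewrite nth1 (negPf rd).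
rewrite Eb nth1 eqxx /s1 {2}/upd set_set_nth eqxx -/(upd sg d _) in h2.
rewrite /items_bits /= -/(items_bits sg l) catrev_cat.
apply: (@exec_weaken _ _ _ ((20 * m + 9) + size l * (20 * m + 10)).+1); first by rewrite mulSn; lia.
by move: (exec_seq hs1 h2); case: (it).
Qed.

(* Tapes of the generator: 0 input and output, 1 the input length, 2 the gates written so
   far and 3 the query list, both reversed, 4 first qubit of the block, 5 next token
   qubit and 6 next guessed proof bit, both relative to the block, 7 the part of
   the verifier still to be read, 8 scratch, 9 reads still to be made, 10 blocks still
   to be written, 11 the code of the verifier. *)
Definition regs nn out qout b loc np e i x enc : seq (seq bool) :=
  [:: [::]; unary nn; out; qout; unary b; unary loc; unary np; e; [::]; unary i; unary x; enc].

Lemma exec_pop_e nn out qout b loc np c e i x enc :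
  exec (pop 7) (regs nn out qout b loc np (c :: e) i x enc) 1 (regs nn out qout b loc np e i x enc).
Proof. exact: exec_pop. Qed.

Definition unary_regs := [:: 1; 4; 5; 6; 9].
Definition gate_item it := if it is Unary r then r \in unary_regs else true.

Definition tokens_size (ls : seq (seq nat)) := sumn [seq (size l).*2 + 3 | l <- ls].

Lemma locs_afterE loc ls : locs_after loc ls = loc + tokens_size ls.
Proof.
elim: ls loc => [|l ls IH] loc /=; first by rewrite addn0.
by rewrite IH /loc_after /tokens_size /=; lia.
Qed.

(** * Writing the gates and the query qubits of one block *)

Section Block.

Variables (nn : nat) (out0 qout0 : seq bool) (b loc0 x : nat) (enc : seq bool) (m : nat).
Hypotheses (nn_m : nn <= m) (b_m : b <= m).

Definition gate_bits gs := encode_items encode_gate (map (shift_gate b) gs).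
Definition query_bits k := encode_items encode_nat (iota (b + loc0) k).

(** Progress inside the block with base [b]: the gates [gs], numbered relative to the block, are
    written and [k] token qubits, starting at [loc0], are listed for the query. *)
Definition st np i e gs k :=
  regs nn (catrev (gate_bits gs) out0) (catrev (query_bits k) qout0) b (loc0 + k) np e i x enc.

Notation bnd := (2000 * m.+1).

Lemma exec_emit_regs d l out qout loc np e i : all gate_item l -> (d == 2) || (d == 3) ->
  loc <= m -> np <= m -> i <= m ->
  exec (emit d l) (regs nn out qout b loc np e i x enc) (size l * (20 * m + 10))
    (upd (regs nn out qout b loc np e i x enc) d
      (catrev (items_bits (regs nn out qout b loc np e i x enc) l)
        (nth [::] (regs nn out qout b loc np e i x enc) d))).
Proof.
move=> ok_l d23 loc_m np_m i_m; apply: exec_emit => //; try by case/orP: d23 => /eqP ->.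
apply: sub_all ok_l => -[//|r]; rewrite /gate_item !inE.
by case/or4P=> [/eqP->|/eqP->|/eqP->|/orP[/eqP->|/eqP->]] /=; rewrite !size_nseq eqxx;
  case/orP: d23 => /eqP -> /=; rewrite andbT.
Qed.

Lemma gate_bits_cat g1 g2 : gate_bits (g1 ++ g2) = gate_bits g1 ++ gate_bits g2.
Proof. by rewrite /gate_bits map_cat encode_items_cat. Qed.

Lemma exec_emit_gates l gs' np i e gs k : all gate_item l -> loc0 + k <= m -> np <= m -> i <= m ->
  items_bits (st np i e gs k) l = gate_bits gs' ->
  exec (emit 2 l) (st np i e gs k) (size l * (20 * m + 10)) (st np i e (gs ++ gs') k).
Proof.
move=> ok_l loc_m np_m i_m El; have := @exec_emit_regs 2 l (catrev (gate_bits gs) out0)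
  (catrev (query_bits k) qout0) (loc0 + k) np e i ok_l erefl loc_m np_m i_m.
by rewrite /= -/(st np i e gs k) El /st gate_bits_cat catrev_cat.
Qed.

(** Token qubits are handed out consecutively, so listing one for the query and advancing the
    counter is a single operation; the query list is complete as soon as the gates are. *)
Definition alloc := seqm (emit 3 [:: Bit true; Unary 4; Unary 5; Bit false]) (push 5 true).

Lemma encode_nat_unary k l : unary k ++ unary l ++ [:: false] = encode_nat (k + l).
Proof. by rewrite catA unaryD cats1. Qed.

Lemma exec_alloc np i e gs k : loc0 + k <= m -> np <= m -> i <= m ->
  exec alloc (st np i e gs k) (80 * m + 60) (st np i e gs k.+1).
Proof.
move=> loc_m np_m i_m; have := @exec_emit_regs 3 [:: Bit true; Unary 4; Unary 5; Bit false]
  (catrev (gate_bits gs) out0) (catrev (query_bits k) qout0) (loc0 + k) np e i erefl erefl loc_m np_m i_m.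
have -> : items_bits (regs nn (catrev (gate_bits gs) out0) (catrev (query_bits k) qout0) b (loc0 + k) np e i x enc)
    [:: Bit true; Unary 4; Unary 5; Bit false] = true :: encode_nat (b + loc0 + k).
  by rewrite /items_bits /= encode_nat_unary addnA.
move=> h.
apply: (@exec_weaken _ _ _ (4 * (20 * m + 10) + 2).+1); first by lia.
apply: exec_seq h _; rewrite /st /query_bits -[in iota _ k.+1]addn1 iotaD encode_items_cat catrev_cat.
by rewrite addnS /encode_items [flatten [:: _]]/= cats0; exact: exec_push.
Qed.

(** Relocation by [b] while transcribing: in unary, addition is concatenation, so 1^b is written
    before the number is copied from the code. *)
Definition number_m := seqm (emit 2 [:: Unary 4])
  (seqm (whilem 7 (pred1 (Some true)) (seqm (pop 7) (push 2 true))) (seqm (pop 7) (push 2 false))).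

Lemma exec_number j out qout loc np e i : loc <= m -> np <= m -> i <= m -> j <= m ->
  exec number_m (regs nn out qout b loc np (encode_nat j ++ e) i x enc) (30 * m + 40)
    (regs nn (catrev (encode_nat (b + j)) out) qout b loc np e i x enc).
Proof.
move=> loc_m np_m i_m j_m.
have := @exec_emit_regs 2 [:: Unary 4] out qout loc np (encode_nat j ++ e) i erefl erefl loc_m np_m i_m.
have -> : items_bits (regs nn out qout b loc np (encode_nat j ++ e) i x enc) [:: Unary 4] = unary b.
  by rewrite /items_bits /= cats0.
move=> h.
have H o : exec (whilem 7 (pred1 (Some true)) (seqm (pop 7) (push 2 true)))
   (regs nn o qout b loc np (encode_nat j ++ e) i x enc) (6 * j + 1)
   (regs nn (unary j ++ o) qout b loc np (false :: e) i x enc).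
  elim: j o {h j_m} => [|j IH] o; first exact: exec_while_exit.
  apply: (@exec_weaken _ _ _ ((1 + 2).+1 + (6 * j + 1)).+2); first by lia.
  have {}IH := IH (true :: o); rewrite unaryS in IH.
  apply: exec_while_step IH => //.
  by apply: exec_seq (@exec_pop_e _ _ _ _ _ _ _ _ _ _ _) _; exact: exec_push.
apply: (@exec_weaken _ _ _ (1 * (20 * m + 10) + ((6 * j + 1) + (1 + 2).+1).+1).+1); first by lia.
apply: exec_seq h _; apply: exec_seq (H _) _.
apply: exec_seq (@exec_pop_e _ _ _ _ _ _ _ _ _ _ _) _.
have -> : catrev (encode_nat (b + j)) out = false :: unary j ++ catrev (unary b) out.
  by rewrite /encode_nat -cats1 catrev_cat !catrev_unary catA unaryD addnC.
exact: exec_push.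
Qed.

Definition gates_m := seqm
  (whilem 7 (pred1 (Some true)) (seqm (pop 7) (popcase 7 nop
     (popcase 7 nop (seqm (emit 2 [:: Bit true; Bit false; Bit false]) number_m)
                    (seqm (emit 2 [:: Bit true; Bit false; Bit true]) number_m))
     (seqm (pop 7) (seqm (emit 2 [:: Bit true; Bit true; Bit false]) (seqm number_m number_m))))))
  (pop 7).

Lemma exec_gates gs' np i e gs k : loc0 + k <= m -> np <= m -> i <= m ->
  size (encode_seq encode_gate gs') <= m ->
  exec gates_m (st np i (encode_seq encode_gate gs' ++ e) gs k) (bnd * (size gs').+1)
    (st np i e (gs ++ gs') k).
Proof.
move=> loc_m np_m i_m sz_m; apply: (@exec_weaken _ _ _ ((bnd * size gs' + 1) + 1).+1).
  by rewrite mulnS; lia.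
rewrite /gates_m; set body := (X in whilem 7 _ X).
suff H : exec (whilem 7 (pred1 (Some true)) body)
   (st np i (encode_seq encode_gate gs' ++ e) gs k) (bnd * size gs' + 1)
   (st np i (false :: e) (gs ++ gs') k).
  by apply: exec_seq H _; exact: exec_pop.
elim: gs' gs sz_m => [|g gs' IH] gs sz_m.
  by rewrite cats0 muln0; exact: exec_while_exit.
rewrite encode_seq_cons /= size_cat in sz_m.
have {}IH := IH (rcons gs g); rewrite cat_rcons in IH.
rewrite encode_seq_cons cat_cons -catA.
apply: (@exec_weaken _ _ _ ((900 * m + 900) + (bnd * size gs' + 1)).+2).
  by rewrite [size (_ :: _)]/= mulnS; lia.
apply: exec_while_step (IH _) => //; last by lia.
clear IH; set e1 := encode_seq _ _ ++ e.
rewrite /body; apply: (@exec_weaken _ _ _ (1 + (800 * m + 850)).+1); first by lia.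
apply: exec_seq (@exec_pop_e _ _ _ _ _ _ _ _ _ _ _) _.
have szn j : size (encode_nat j) = j.+1 by rewrite size_rcons size_nseq.
rewrite -cats1 /st gate_bits_cat catrev_cat -/(st np i e gs k).
apply: (@exec_weaken _ _ _ (800 * m + 840 + 4)); first by lia.
have em c1 c2 e' := @exec_emit_regs 2 [:: Bit true; Bit c1; Bit c2] (catrev (gate_bits gs) out0)
  (catrev (query_bits k) qout0) (loc0 + k) np e' i erefl erefl loc_m np_m i_m.
case: g sz_m => [j|j|j l] /= sz_m; rewrite ?size_cat szn in sz_m; apply: exec_popcase => //=;
  [apply: (@exec_weaken _ _ _ (800 * m + 800 + 4)); [by lia|apply: exec_popcase => //=].. | ].
- apply: (@exec_weaken _ _ _ (3 * (20 * m + 10) + (30 * m + 40)).+1); first by lia.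
  apply: exec_seq (em _ _ _) _.
  by rewrite cats0; apply: exec_number => //; lia.
- apply: (@exec_weaken _ _ _ (3 * (20 * m + 10) + (30 * m + 40)).+1); first by lia.
  apply: exec_seq (em _ _ _) _.
  by rewrite cats0; apply: exec_number => //; lia.
- rewrite szn in sz_m.
  apply: (@exec_weaken _ _ _ (1 + (3 * (20 * m + 10) + ((30 * m + 40) + (30 * m + 40)).+1).+1).+1); first by lia.
  apply: exec_seq (@exec_pop_e _ _ _ _ _ _ _ _ _ _ _) _.
  apply: exec_seq (em _ _ _) _.
  by rewrite cats0 catrev_cat -catA; apply: exec_seq; apply: exec_number => //; lia.
Qed.

Definition tokens (a : seq instr) := flatten (map instr_gates a).

(** [Zero] has no gates, so an address token is an allocation, a CNOT from the transcribed qubit to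
    the next token qubit, and a second allocation. *)
Definition index_m := seqm
  (whilem 7 (pred1 (Some true)) (seqm (pop 7) (seqm alloc
    (seqm (emit 2 [:: Bit true; Bit true; Bit false]) (seqm number_m
    (seqm (emit 2 [:: Unary 4; Unary 5; Bit false]) alloc))))))
  (pop 7).

Lemma size_encode_nat j : size (encode_nat j) = j.+1.
Proof. by rewrite size_rcons size_nseq. Qed.

Lemma exec_index l np i e gs k : loc0 + (k + (size l).*2) <= m -> np <= m -> i <= m ->
  size (encode_seq encode_nat l) <= m ->
  exec index_m (st np i (encode_seq encode_nat l ++ e) gs k) (bnd * (size l).+1)
    (st np i e (gs ++ tokens (index_instrs (loc0 + k) l)) (k + (size l).*2)).
Proof.
move=> loc_m np_m i_m sz_m; apply: (@exec_weaken _ _ _ ((bnd * size l + 1) + 1).+1).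
  by rewrite mulnS; lia.
rewrite /index_m; set body := (X in whilem 7 _ X).
suff H : exec (whilem 7 (pred1 (Some true)) body)
   (st np i (encode_seq encode_nat l ++ e) gs k) (bnd * size l + 1)
   (st np i (false :: e) (gs ++ tokens (index_instrs (loc0 + k) l)) (k + (size l).*2)).
  by apply: exec_seq H _; exact: exec_pop.
elim: l gs k loc_m sz_m => [|j l IH] gs k loc_m sz_m.
  by rewrite cats0 muln0 addn0; exact: exec_while_exit.
rewrite encode_seq_cons /= size_cat size_encode_nat in sz_m; rewrite /= in loc_m.
have {}IH := IH (gs ++ [:: CNOT j (loc0 + k).+1]) k.+2.
have Ek : k.+2 + (size l).*2 = k + (size (j :: l)).*2 by rewrite /= doubleS; lia.
have Et : gs ++ [:: CNOT j (loc0 + k).+1] ++ tokens (index_instrs (loc0 + k.+2) l) =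
  gs ++ tokens (index_instrs (loc0 + k) (j :: l)) by rewrite !addnS.
rewrite -catA Ek Et in IH.
rewrite encode_seq_cons cat_cons -catA.
apply: (@exec_weaken _ _ _ ((900 * m + 900) + (bnd * size l + 1)).+2).
  by rewrite [size (_ :: _)]/= mulnS; lia.
apply: exec_while_step (IH _ _) => //; try lia.
clear IH; set e1 := encode_seq _ _ ++ e; rewrite /body.
apply: (@exec_weaken _ _ _ (1 + ((80 * m + 60) + (3 * (20 * m + 10) + ((30 * m + 40) +
  (3 * (20 * m + 10) + (80 * m + 60)).+1).+1).+1).+1).+1); first by lia.
apply: exec_seq (@exec_pop_e _ _ _ _ _ _ _ _ _ _ _) _.
apply: exec_seq (@exec_alloc np i (encode_nat j ++ e1) gs k _ _ _) _ => //; first by lia.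
have lock_m : loc0 + k.+1 <= m by lia.
apply: exec_seq (@exec_emit_regs 2 [:: Bit true; Bit true; Bit false]
  (catrev (gate_bits gs) out0)
  (catrev (query_bits k.+1) qout0) (loc0 + k.+1) np (encode_nat j ++ e1) i erefl erefl lock_m np_m i_m) _.
apply: exec_seq (@exec_number j _ _ _ _ _ _ _ _ _ _) _ => //; first by lia.
apply: exec_seq (@exec_emit_regs 2 [:: Unary 4; Unary 5; Bit false]
  (catrev (encode_nat (b + j)) (catrev [:: true; true; false] (catrev (gate_bits gs) out0)))
  (catrev (query_bits k.+1) qout0) (loc0 + k.+1) np e1 i erefl erefl lock_m np_m i_m) _.
have := @exec_alloc np i e1 (gs ++ [:: CNOT j (loc0 + k).+1]) k.+1 lock_m np_m i_m.
rewrite addnS /st gate_bits_cat catrev_cat.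
have -> : gate_bits [:: CNOT j (loc0 + k).+1] =
   [:: true; true; false] ++ encode_nat (b + j) ++ unary b ++ unary (loc0 + k).+1 ++ [:: false].
  by rewrite encode_nat_unary /gate_bits /encode_items /= cats0.
rewrite (catrev_cat [:: true; true; false] _ (catrev (gate_bits gs) out0)).
rewrite (catrev_cat (encode_nat (b + j)) _ (catrev [:: true; true; false] _)).
by rewrite /items_bits addnS.
Qed.

(** A list of registers stands for the qubit whose number is the sum of their values. *)
Definition hadamard_items rs := [:: Bit true; Bit false; Bit false] ++ map Unary rs ++ [:: Bit false].
Definition tgate_items rs := [:: Bit true; Bit false; Bit true] ++ map Unary rs ++ [:: Bit false].
Definition cnot_items rs ss := [:: Bit true; Bit true; Bit false] ++
  map Unary rs ++ [:: Bit false] ++ map Unary ss ++ [:: Bit false].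

Definition one_items := hadamard_items [:: 4; 5] ++ tgate_items [:: 4; 5] ++ tgate_items [:: 4; 5] ++
  tgate_items [:: 4; 5] ++ tgate_items [:: 4; 5] ++ hadamard_items [:: 4; 5].

Lemma items_bits_cat sg l1 l2 : items_bits sg (l1 ++ l2) = items_bits sg l1 ++ items_bits sg l2.
Proof. by rewrite /items_bits map_cat flatten_cat. Qed.

Lemma hadamard_items_bits sg r d : nth [::] sg 4 = unary b -> nth [::] sg r = unary d ->
  items_bits sg (hadamard_items [:: 4; r]) = gate_bits [:: Hadamard d].
Proof.
by move=> E1 E2; rewrite /items_bits /gate_bits /encode_items /= E1 E2 encode_nat_unary cats0.
Qed.

Lemma tgate_items_bits sg r d : nth [::] sg 4 = unary b -> nth [::] sg r = unary d ->
  items_bits sg (tgate_items [:: 4; r]) = gate_bits [:: Tgate d].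
Proof.
by move=> E1 E2; rewrite /items_bits /gate_bits /encode_items /= E1 E2 encode_nat_unary cats0.
Qed.

Lemma cnot_items_bits sg r s c d : nth [::] sg 4 = unary b -> nth [::] sg r = unary c ->
  nth [::] sg s = unary d ->
  items_bits sg (cnot_items [:: 4; r] [:: 4; s]) = gate_bits [:: CNOT c d].
Proof.
move=> E1 E2 E3; rewrite /items_bits /gate_bits /encode_items /= E1 E2 E3 cats0.
by rewrite -!encode_nat_unary -!catA.
Qed.

Lemma cnot0_items_bits sg s d : nth [::] sg 4 = unary b -> nth [::] sg s = unary d ->
  items_bits sg (cnot_items [:: 4] [:: 4; s]) = gate_bits [:: CNOT 0 d].
Proof.
move=> E1 E3; rewrite /items_bits /gate_bits /encode_items /= E1 E3 cats0.
by rewrite -!encode_nat_unary -!catA.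
Qed.

Definition one_m := emit 2 one_items.

Lemma exec_one np i e gs k : loc0 + k <= m -> np <= m -> i <= m ->
  exec one_m (st np i e gs k) (36 * (20 * m + 10)) (st np i e (gs ++ tokens [:: One (loc0 + k)]) k).
Proof.
move=> loc_m np_m i_m; apply: (@exec_emit_gates one_items) => //.
rewrite /one_items (items_bits_cat _ (hadamard_items _)) !(items_bits_cat _ (tgate_items _)).
rewrite (@hadamard_items_bits _ _ (loc0 + k)) // (@tgate_items_bits _ _ (loc0 + k)) //.
by rewrite -!gate_bits_cat.
Qed.

(** Register 9 is set to [q] for each block and decremented at each read; what remains after the
    reads is the number of padding tokens. *)
Definition token_m := seqm one_m (seqm alloc (seqm alloc
  (seqm (emit 2 (hadamard_items [:: 4; 6] ++ cnot_items [:: 4; 6] [:: 4; 5]))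
  (seqm alloc (seqm (push 6 true) (popcase 9 nop nop nop)))))).

Lemma tokens_cat a1 a2 : tokens (a1 ++ a2) = tokens a1 ++ tokens a2.
Proof. by rewrite /tokens map_cat flatten_cat. Qed.

Lemma exec_token np i e gs k : loc0 + k + 3 <= m -> np <= m -> i.+1 <= m ->
  exec token_m (st np i.+1 e gs k) bnd
    (st np.+1 i e (gs ++ tokens (read_instrs1 np (loc0 + k))) (k + 3)).
Proof.
move=> loc_m np_m i_m.
apply: (@exec_weaken _ _ _ (36 * (20 * m + 10) + ((80 * m + 60) + ((80 * m + 60) +
  (15 * (20 * m + 10) + ((80 * m + 60) + (2 + (0 + 4)).+1).+1).+1).+1).+1).+1).
  by lia.
apply: exec_seq (@exec_one np i.+1 e gs k _ _ _) _; try lia.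
apply: exec_seq (@exec_alloc np i.+1 e _ k _ _ _) _; try lia.
apply: exec_seq (@exec_alloc np i.+1 e _ k.+1 _ _ _) _; try lia.
apply: exec_seq (@exec_emit_gates _ [:: Hadamard np; CNOT np (loc0 + k).+2] np i.+1 e _ k.+2 _ _ _ _ _) _;
  rewrite //; try lia.
  rewrite (items_bits_cat _ (hadamard_items _)) (@hadamard_items_bits _ _ np) //.
  by rewrite (@cnot_items_bits _ _ _ np (loc0 + k).+2) -?gate_bits_cat -?addnS.
apply: exec_seq (@exec_alloc np i.+1 e _ k.+2 _ _ _) _; try lia.
rewrite -catA addn3 -[tokens [:: One _] ++ _]/(tokens (read_instrs1 np (loc0 + k))).
apply: exec_seq; first exact: exec_push.
by apply: exec_popcase => //; exact: exec_nop.
Qed.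

Definition read_m := seqm
  (whilem 7 (pred1 (Some true)) (seqm (pop 7) (seqm index_m token_m))) (pop 7).

Lemma exec_read ls np i e gs k : loc0 + (k + tokens_size ls) <= m -> np + size ls <= m ->
  i + size ls <= m -> size (encode_seq (encode_seq encode_nat) ls) <= m ->
  exec read_m (st np (i + size ls) (encode_seq (encode_seq encode_nat) ls ++ e) gs k)
    (bnd * (tokens_size ls).+1)
    (st (np + size ls) i e (gs ++ tokens (read_instrs np (loc0 + k) ls)) (k + tokens_size ls)).
Proof.
move=> loc_m np_m i_m sz_m; apply: (@exec_weaken _ _ _ ((bnd * tokens_size ls + 1) + 1).+1).
  by rewrite mulnS; lia.
rewrite /read_m; set body := (X in whilem 7 _ X).
suff H : exec (whilem 7 (pred1 (Some true)) body)
   (st np (i + size ls) (encode_seq (encode_seq encode_nat) ls ++ e) gs k) (bnd * tokens_size ls + 1)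
   (st (np + size ls) i (false :: e) (gs ++ tokens (read_instrs np (loc0 + k) ls)) (k + tokens_size ls)).
  by apply: exec_seq H _; exact: exec_pop.
elim: ls gs np k loc_m np_m i_m sz_m => [|l ls IH] gs np k loc_m np_m i_m sz_m.
  by rewrite cats0 muln0 !addn0; exact: exec_while_exit.
rewrite encode_seq_cons /= size_cat in sz_m; rewrite [size (_ :: _)]/= in np_m i_m.
have Es : tokens_size (l :: ls) = (size l).*2 + 3 + tokens_size ls by [].
rewrite Es in loc_m.
have {}IH := IH (gs ++ tokens (index_instrs (loc0 + k) l) ++
  tokens (read_instrs1 np (loc_after (loc0 + k) l))) np.+1 (k + (size l).*2 + 3).
have Ek : k + (size l).*2 + 3 + tokens_size ls = k + tokens_size (l :: ls) by rewrite Es; lia.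
have En : loc0 + (k + (size l).*2 + 3) = (loc_after (loc0 + k) l).+3 by rewrite /loc_after; lia.
have Et : (gs ++ tokens (index_instrs (loc0 + k) l) ++
     tokens (read_instrs1 np (loc_after (loc0 + k) l))) ++
     tokens (read_instrs np.+1 (loc_after (loc0 + k) l).+3 ls) =
   gs ++ tokens (read_instrs np (loc0 + k) (l :: ls)).
  by rewrite [read_instrs np _ _]/= !tokens_cat -!catA.
rewrite Ek En Et addSn in IH.
rewrite encode_seq_cons cat_cons -catA [size (_ :: _)]/= !addnS.
apply: (@exec_weaken _ _ _ ((1 + (bnd * (size l).+1 + bnd).+1).+1 + (bnd * tokens_size ls + 1)).+2).
  rewrite Es; move: (tokens_size ls) => T; rewrite mulnDr [bnd * (size l).+1]mulnS.
  have : bnd * size l <= bnd * (size l).*2 by rewrite leq_mul2l -addnn leq_addr orbT.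
  by rewrite [bnd * (_ + 3)]mulnDr; lia.
apply: exec_while_step (IH _ _ _ _) => //; try lia.
clear IH; set e1 := encode_seq _ _ ++ e.
apply: exec_seq (@exec_pop_e _ _ _ _ _ _ _ _ _ _ _) _.
apply: exec_seq (@exec_index l np (i + size ls).+1 e1 gs k _ _ _ _) _; try lia.
have := @exec_token np (i + size ls) e1 (gs ++ tokens (index_instrs (loc0 + k) l)) (k + (size l).*2).
by rewrite -catA addnA; apply; lia.
Qed.

Definition pad_m := loop 9 nop (seqm one_m (seqm alloc (seqm alloc
  (seqm (emit 2 (hadamard_items [:: 4; 5])) alloc)))).

Lemma exec_pad np i e gs k : loc0 + (k + 3 * i) <= m -> np <= m -> i <= m ->
  exec pad_m (st np i e gs k) (bnd * i + 1)
    (st np 0 e (gs ++ tokens (pad_instrs (loc0 + k) i)) (k + 3 * i)).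
Proof.
elim: i gs k => [|i IH] gs k loc_m np_m i_m.
  by rewrite cats0 !muln0 addn0; exact: exec_loop_nil.
apply: (@exec_weaken _ _ _ ((36 * (20 * m + 10) + ((80 * m + 60) + ((80 * m + 60) +
  (6 * (20 * m + 10) + (80 * m + 60)).+1).+1).+1).+1 + (bnd * i + 1) + 6)).
  by rewrite [bnd * _.+1]mulnS; lia.
have {}IH := IH (gs ++ tokens [:: One (loc0 + k); Zero (loc0 + k).+1; Coin (loc0 + k).+2]) k.+3.
have Ek : k.+3 + 3 * i = k + 3 * i.+1 by lia.
have El : loc0 + k.+3 = (loc0 + k).+3 by lia.
rewrite -catA -tokens_cat Ek El in IH.
apply: (@exec_loop_cons w 9 _ _ _ true (unary i) _ _ _ _ _ _ _ (IH _ _ _)) => //; try lia.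
apply: exec_seq (@exec_one np i e gs k _ _ _) _; try lia.
apply: exec_seq (@exec_alloc np i e _ k _ _ _) _; try lia.
apply: exec_seq (@exec_alloc np i e _ k.+1 _ _ _) _; try lia.
apply: exec_seq (@exec_emit_gates _ [:: Hadamard (loc0 + k).+2] np i e _ k.+2 _ _ _ _ _) _;
  rewrite //; try lia.
  by rewrite (@hadamard_items_bits _ _ (loc0 + k).+2) // -!addnS.
have := @exec_alloc np i e (gs ++ tokens [:: One (loc0 + k); Zero (loc0 + k).+1; Coin (loc0 + k).+2]) k.+2.
by rewrite -catA; apply; lia.
Qed.

(** The third qubit of the end token is allocated only by [accept_m]: its number has to be in
    register 5 when, after the remaining gates of the verifier, the accept bit is copied to it. *)
Definition end_m := seqm one_m (seqm alloc (seqm one_m alloc)).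

Lemma exec_end np e gs k : loc0 + (k + 2) <= m -> np <= m ->
  exec end_m (st np 0 e gs k) (3 * bnd)
    (st np 0 e (gs ++ tokens (end_instrs (loc0 + k))) (k + 2)).
Proof.
move=> loc_m np_m.
apply: (@exec_weaken _ _ _ (36 * (20 * m + 10) + ((80 * m + 60) +
  (36 * (20 * m + 10) + (80 * m + 60)).+1).+1).+1); first by lia.
apply: exec_seq (@exec_one np 0 e gs k _ _ _) _; try lia.
apply: exec_seq (@exec_alloc np 0 e _ k _ _ _) _; try lia.
apply: exec_seq (@exec_one np 0 e _ k.+1 _ _ _) _; try lia.
rewrite -catA -tokens_cat addnS addn2; apply: exec_alloc; lia.
Qed.

Definition accept_m := seqm (emit 2 (cnot_items [:: 4] [:: 4; 5])) alloc.

Lemma exec_accept np e gs k : loc0 + k.+1 <= m -> np <= m ->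
  exec accept_m (st np 0 e gs k) bnd (st np 0 e (gs ++ [:: CNOT 0 (loc0 + k)]) k.+1).
Proof.
move=> loc_m np_m.
apply: (@exec_weaken _ _ _ (8 * (20 * m + 10) + (80 * m + 60)).+1); first by lia.
apply: exec_seq (@exec_emit_gates _ [:: CNOT 0 (loc0 + k)] np 0 e gs k _ _ _ _ _) _;
  rewrite //; try lia.
  by rewrite (@cnot0_items_bits _ _ (loc0 + k)).
by apply: exec_alloc; lia.
Qed.

End Block.

(** Register 9, not yet in use, counts upwards as the qubit to be copied while the input length
    counts down; moving it back restores the length. *)
Definition input_m := seqm
  (loop 1 nop (seqm (emit 2 (cnot_items [:: 9] [:: 4; 9])) (push 9 true))) (move w 9 1).

Lemma exec_input n out qout b loc np e x enc m : n <= m -> b <= m -> loc <= m -> np <= m ->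
  exec input_m (regs n out qout b loc np e 0 x enc) (1000 * m.+1 * m.+1)
    (regs n (catrev (encode_items encode_gate (copy_input n b)) out) qout b loc np e 0 x enc).
Proof.
move=> n_m b_m loc_m np_m.
suff H k i o : i + k <= m -> exec (loop 1 nop (seqm (emit 2 (cnot_items [:: 9] [:: 4; 9])) (push 9 true)))
    (regs k o qout b loc np e i x enc) ((200 * m + 300) * k + 1)
    (regs 0 (catrev (encode_items encode_gate [seq CNOT j (b + j) | j <- iota i k]) o)
       qout b loc np e (i + k) x enc).
  apply: (@exec_weaken _ _ _ (((200 * m + 300) * n + 1) + (8 * n + 1)).+1).
    have : (200 * m + 300) * n <= (200 * m + 300) * m by rewrite leq_mul2l n_m orbT.
    nia.
  apply: exec_seq (H n 0 out n_m) _.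
  have := @exec_move w 9 1 (regs 0 (catrev (encode_items encode_gate (copy_input n b)) out) qout b loc np e n x enc) erefl erefl erefl.
  by rewrite size_nseq /upd /= catrev_unary cats0.
elim: k i o => [|k IH] i o ik_m.
  by rewrite muln0 addn0; exact: exec_loop_nil.
have {}IH := IH i.+1 (catrev (encode_items encode_gate [:: CNOT i (b + i)]) o).
rewrite -catrev_cat -encode_items_cat addSnnS in IH.
apply: (@exec_weaken _ _ _ ((8 * (20 * m + 10) + 2).+1 + ((200 * m + 300) * k + 1) + 6)).
  by rewrite mulnS; lia.
apply: (@exec_loop_cons w 1 _ _ _ true (unary k) _ _ _ _ _ _ _ (IH _)) => //; try lia.
have i_m : i <= m by lia.
have k_m : k <= m by lia.
have := @exec_emit_regs k b x enc m k_m b_m 2 (cnot_items [:: 9] [:: 4; 9]) o qout loc np e i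
  erefl erefl loc_m np_m i_m.
have -> : items_bits (regs k o qout b loc np e i x enc) (cnot_items [:: 9] [:: 4; 9]) =
  encode_items encode_gate [:: CNOT i (b + i)].
  by rewrite /items_bits /encode_items /= cats0 -encode_nat_unary /encode_nat -cats1 -!catA.
by move=> h; apply: exec_seq h _; exact: exec_push.
Qed.

(** The code is copied because every block reads it anew. Its leading number, the ancilla count, is
    added to the input length to give the first guess qubit (register 6); q + 1 further qubits lead
    to the first token qubit (register 5). *)
Definition setup_m :=
  seqm (move w 11 8) (seqm
    (loop 8 (seqm (push 11 false) (push 7 false)) (seqm (push 11 true) (push 7 true))) (seqm
    (loop 1 nop (seqm (push 9 true) (seqm (push 6 true) (push 5 true)))) (seqm
    (move w 9 1) (seqm
    (whilem 7 (pred1 (Some true)) (seqm (pop 7) (seqm (push 6 true) (push 5 true)))) (seqm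
    (pop 7) (seqm
    (push_many w 5 q.+1) (push_many w 9 q))))))).

Lemma exec_setup n out qout b x a e m : let enc := encode_nat a ++ e in
  n <= m -> q <= m -> size enc <= m ->
  exec setup_m (regs n out qout b 0 0 [::] 0 x enc) (100 * m.+1)
    (regs n out qout b (n + a + q.+1) (n + a) e q x enc).
Proof.
move=> enc n_m q_m sz_m.
have H1 v y1 y2 : exec (loop 8 (seqm (push 11 false) (push 7 false)) (seqm (push 11 true) (push 7 true)))
    [:: [::]; unary n; out; qout; unary b; unary 0; unary 0; y1; v; unary 0; unary x; y2]
    (11 * size v + 1)
    [:: [::]; unary n; out; qout; unary b; unary 0; unary 0; catrev v y1; [::]; unary 0; unary x; catrev v y2].
  elim: v y1 y2 => [|c v IH] y1 y2; first exact: exec_loop_nil.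
  apply: (@exec_weaken _ _ _ ((2 + 2).+1 + (11 * size v + 1) + 6)); first by rewrite /=; lia.
  apply: (@exec_loop_cons _ 8 _ _ _ c v) (IH (c :: y1) (c :: y2)) => //.
  by case: (c); (eapply exec_seq; apply: exec_push; by []).
have H2 k i np loc : exec (loop 1 nop (seqm (push 9 true) (seqm (push 6 true) (push 5 true))))
   (regs k out qout b loc np enc i x enc) (14 * k + 1)
   (regs 0 out qout b (k + loc) (k + np) enc (k + i) x enc).
  elim: k i np loc => [|k IH] i np loc; first exact: exec_loop_nil.
  apply: (@exec_weaken _ _ _ ((2 + (2 + 2).+1).+1 + (14 * k + 1) + 6)); first by lia.
  have {}IH := IH i.+1 np.+1 loc.+1; rewrite (addnS k loc) (addnS k np) (addnS k i) in IH.
  apply: (@exec_loop_cons w 1 _ _ _ true (unary k) _ _ _ _ _ _ _ IH) => //.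
  by do 2 (eapply exec_seq; [apply: exec_push; by []|]); apply: exec_push.
have H3 k np loc : exec (whilem 7 (pred1 (Some true)) (seqm (pop 7) (seqm (push 6 true) (push 5 true))))
   (regs n out qout b loc np (encode_nat k ++ e) 0 x enc) (9 * k + 1)
   (regs n out qout b (k + loc) (k + np) (false :: e) 0 x enc).
  elim: k np loc => [|k IH] np loc; first exact: exec_while_exit.
  apply: (@exec_weaken _ _ _ ((1 + (2 + 2).+1).+1 + (9 * k + 1)).+2); first by lia.
  have {}IH := IH np.+1 loc.+1; rewrite (addnS k loc) (addnS k np) in IH.
  apply: exec_while_step IH => //.
  apply: exec_seq (@exec_pop_e _ _ _ _ _ _ _ _ _ _ _) _.
  by (eapply exec_seq; [apply: exec_push; by []|]); apply: exec_push.
have a_m : a < m by move: sz_m; rewrite /enc size_cat size_encode_nat; lia.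
apply: (@exec_weaken _ _ _ ((8 * size enc + 1) + ((11 * size (rev enc) + 1) + ((14 * n + 1) +
  ((8 * n + 1) + ((9 * a + 1) + (1 + (3 * q.+1 + 3 * q).+1).+1).+1).+1).+1).+1).+1).
  by rewrite size_rev; lia.
apply: exec_seq (@exec_move w 11 8 (regs n out qout b 0 0 [::] 0 x enc) erefl erefl erefl) _.
apply: exec_seq (H1 (rev enc) [::] [::]) _; rewrite -/(rev _) revK.
apply: exec_seq (H2 n 0 0 0) _; rewrite !addn0.
have := @exec_move w 9 1 (regs 0 out qout b n n enc n x enc) erefl erefl erefl.
rewrite size_nseq /upd /= catrev_unary cats0 => h; apply: exec_seq h _.
apply: exec_seq (H3 a n n) _.
apply: exec_seq (@exec_pop_e _ _ _ _ _ _ _ _ _ _ _) _.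
rewrite ![a + n]addnC.
have h5 := @exec_push_many w 5 q.+1 (regs n out qout b (n + a) (n + a) e 0 x enc) erefl.
rewrite [nth _ _ 5]/= unaryD [q.+1 + _]addnC in h5; apply: exec_seq h5 _.
have := @exec_push_many w 9 q (regs n out qout b (n + a + q.+1) (n + a) e 0 x enc) erefl.
by rewrite [nth _ _ 9]/= cats0.
Qed.

Definition block_m := seqm input_m (seqm setup_m (seqm gates_m (seqm read_m (seqm pad_m
  (seqm end_m (seqm gates_m (seqm accept_m (seqm (move w 5 4) (clear w 6))))))))).

Lemma size_encode_seq T (f : T -> seq bool) s : size s < size (encode_seq f s).
Proof. by elim: s => //= x s IH; rewrite size_cat; lia. Qed.

(** Apart from the words written so far only the base changes, and it becomes that of the next
    block: the invariant of the main loop. As all lengths are at most [m], each phase fits in a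
    multiple of (m + 1)^2. *)
Lemma exec_block V n out qout b x m :
  size (pv_index V) <= q -> n <= m -> size (encode_pcp_verifier V) <= m ->
  b + block_width q n V <= m ->
  exec block_m (regs n out qout b 0 0 [::] 0 x (encode_pcp_verifier V))
    (12 * (2000 * m.+1 * m.+1))
    (regs n (catrev (encode_items encode_gate (block_gates q n V b)) out)
      (catrev (encode_items encode_nat (block_query q n V b)) qout)
      (b + block_width q n V) 0 0 [::] 0 x (encode_pcp_verifier V)).
Proof.
move=> r_q n_m sz_m w_m; set enc := encode_pcp_verifier V.
pose N := nqubits n V; pose S := token_start q n V; pose r := size (pv_index V).
pose k1 := tokens_size (pv_index V).
have Ew : block_width q n V = S + (k1 + 3 * (q - r) + 2).+1.
  by rewrite /block_width /end_start /pad_start locs_afterE -/S -/r -/k1; lia.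
have ES : S = N + q.+1 by [].
have N_n : n <= N by exact: leq_addr.
have sz4 : size (encode_nat (pv_ancillas V)) + (size (encode_seq encode_gate (pv_before V)) +
   (size (encode_seq (encode_seq encode_nat) (pv_index V)) +
    size (encode_seq encode_gate (pv_after V)))) <= m by rewrite -!size_cat.
have szb := size_encode_seq encode_gate (pv_before V).
have sza := size_encode_seq encode_gate (pv_after V).
pose o1 := catrev (encode_items encode_gate (copy_input n b)) out.
have b_m : b <= m by lia.
apply: (@exec_weaken _ _ _ (1000 * m.+1 * m.+1 + (100 * m.+1 +
  (2000 * m.+1 * (size (pv_before V)).+1 + (2000 * m.+1 * k1.+1 +
  ((2000 * m.+1 * (q - r) + 1) + (3 * (2000 * m.+1) + (2000 * m.+1 * (size (pv_after V)).+1 +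
  (2000 * m.+1 + ((8 * (S + (k1 + 3 * (q - r) + 2).+1) + 1) + (6 * (N + r) + 1)).+1).+1).+1).+1).+1).+1).+1).+1).+1).
  rewrite Ew in w_m; set U := 2000 * m.+1 * m.+1.
  have le a : a <= m.+1 -> 2000 * m.+1 * a <= U by move=> h; rewrite leq_mul2l h orbT.
  have h1 : 1000 * m.+1 * m.+1 <= U by rewrite /U !leq_mul2r orbT.
  have h2 := le 1 isT; have h3 : 2000 * m.+1 * 3 <= U by apply: le; lia.
  have h4 : 2000 * m.+1 * (size (pv_before V)).+1 <= U by apply: le; lia.
  have h5 : 2000 * m.+1 * (size (pv_after V)).+1 <= U by apply: le; lia.
  have h6 : 2000 * m.+1 * k1.+1 <= U by apply: le; lia.
  have h7 : 2000 * m.+1 * (q - r) <= U by apply: le; lia.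
  clearbody U; lia.
apply: exec_seq (@exec_input n out qout b 0 0 [::] x enc m n_m b_m _ _) _ => //.
apply: exec_seq (@exec_setup n o1 qout b x (pv_ancillas V) _ m n_m _ sz_m) _ => /=; first by lia.
rewrite -/enc -/(nqubits n V) -/N -ES.
set e2 := encode_seq (encode_seq encode_nat) (pv_index V) ++ encode_seq encode_gate (pv_after V).
set e1 := encode_seq encode_gate (pv_after V).
have -> : regs n o1 qout b S N (encode_seq encode_gate (pv_before V) ++ e2) q x enc =
   st n o1 qout b S x enc N q (encode_seq encode_gate (pv_before V) ++ e2) [::] 0.
  by rewrite /st addn0.
apply: exec_seq (@exec_gates n o1 qout b S x enc m n_m b_m (pv_before V) N q e2 [::] 0 _ _ _ _) _; try lia.
rewrite /e2 -{1}(subnK r_q).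
apply: exec_seq (@exec_read n o1 qout b S x enc m n_m b_m (pv_index V) N (q - r) e1 _ 0 _ _ _ _) _;
  rewrite -/k1 -/r; try lia.
apply: exec_seq (@exec_pad n o1 qout b S x enc m n_m b_m (N + r) (q - r) e1 _ (0 + k1) _ _ _) _; try lia.
apply: exec_seq (@exec_end n o1 qout b S x enc m n_m b_m (N + r) e1 _ (0 + k1 + 3 * (q - r)) _ _) _; try lia.
rewrite -[e1 in st _ _ _ _ _ _ _ _ _ e1]cats0.
apply: exec_seq (@exec_gates n o1 qout b S x enc m n_m b_m (pv_after V) (N + r) 0 [::] _ _ _ _ _ _) _; try lia.
apply: exec_seq (@exec_accept n o1 qout b S x enc m n_m b_m (N + r) [::] _ _ _ _) _; try lia.
rewrite add0n addn0 /st -Ew.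
set o2 := catrev (gate_bits _ _) _; set q2 := catrev (query_bits _ _ _) _.
have -> : o2 = catrev (encode_items encode_gate (block_gates q n V b)) out.
  rewrite /o2 /o1 -catrev_cat /gate_bits -encode_items_cat /block_gates /block_circuit -!catA.
  rewrite /token_instrs /end_start /pad_start !locs_afterE -/N -/S -/r -/k1.
  by rewrite -/(tokens _) !tokens_cat -!catA !addnA addn2.
have -> : q2 = catrev (encode_items encode_nat (block_query q n V b)) qout.
  by rewrite /q2 /query_bits /block_query -/S Ew addKn.
have h := @exec_move w 5 4 (regs n (catrev (encode_items encode_gate (block_gates q n V b)) out)
  (catrev (encode_items encode_nat (block_query q n V b)) qout) b (block_width q n V) (N + r)
  [::] 0 x enc) erefl erefl erefl.
rewrite /upd /= catrev_unary unaryD size_nseq Ew [_ + b]addnC in h.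
rewrite Ew; apply: exec_seq h _.
have := @exec_clear w 6 (regs n (catrev (encode_items encode_gate (block_gates q n V b)) out)
  (catrev (encode_items encode_nat (block_query q n V b)) qout) (b + (S + (k1 + 3 * (q - r) + 2).+1)) 0 (N + r)
  [::] 0 x enc) erefl.
by rewrite size_nseq.
Qed.

(** * Computing the number of samples in unary *)

Definition mul_m c := seqm
  (loop 10 nop (seqm (loop 1 nop (seqm (push 9 true) (push 7 true)))
    (seqm (move w 9 1) (push_many w 7 c)))) (move w 7 10).

Lemma exec_mul n out qout b x enc c m : n <= m -> c <= m -> x * (n + c) <= m -> x <= m ->
  exec (mul_m c) (regs n out qout b 0 0 [::] 0 x enc) (100 * m.+1 * m.+1)
    (regs n out qout b 0 0 [::] 0 (x * (n + c)) enc).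
Proof.
move=> n_m c_m xnc_m x_m.
have H1 k i e y : exec (loop 1 nop (seqm (push 9 true) (push 7 true)))
    (regs k out qout b 0 0 (unary e) i y enc) (11 * k + 1)
    (regs 0 out qout b 0 0 (unary (k + e)) (k + i) y enc).
  elim: k i e => [|k IH] i e; first exact: exec_loop_nil.
  apply: (@exec_weaken _ _ _ ((2 + 2).+1 + (11 * k + 1) + 6)); first by lia.
  have {}IH := IH i.+1 e.+1; rewrite (addnS k e) (addnS k i) in IH.
  apply: (@exec_loop_cons w 1 _ _ _ true (unary k) _ _ _ _ _ _ _ IH) => //.
  by eapply exec_seq; apply: exec_push; by [].
have H2 k e : k * (n + c) + e <= m -> k <= m -> exec (loop 10 nop
    (seqm (loop 1 nop (seqm (push 9 true) (push 7 true))) (seqm (move w 9 1) (push_many w 7 c))))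
    (regs n out qout b 0 0 (unary e) 0 k enc) ((40 * m.+1) * k + 1)
    (regs n out qout b 0 0 (unary (k * (n + c) + e)) 0 0 enc).
  elim: k e => [|k IH] e le_m k_m; first by rewrite muln0; exact: exec_loop_nil.
  have Ek : k * (n + c) + (c + (n + e)) = k.+1 * (n + c) + e by lia.
  have {}IH := IH (c + (n + e)); rewrite Ek in IH.
  apply: (@exec_weaken _ _ _ (((11 * n + 1) + ((8 * n + 1) + 3 * c).+1).+1 + (40 * m.+1 * k + 1) + 6)).
    by rewrite [_ * k.+1]mulnS; lia.
  apply: (@exec_loop_cons w 10 _ _ _ true (unary k) _ _ _ _ _ _ _ (IH _ _)) => //; try lia.
  apply: exec_seq (H1 n 0 e k) _; rewrite addn0.
  have := @exec_move w 9 1 (regs 0 out qout b 0 0 (unary (n + e)) n k enc) erefl erefl erefl.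
  rewrite size_nseq /upd /= catrev_unary cats0 => h; apply: exec_seq h _.
  have := @exec_push_many w 7 c (regs n out qout b 0 0 (unary (n + e)) 0 k enc) erefl.
  by rewrite [nth _ _ 7]/= unaryD.
apply: (@exec_weaken _ _ _ ((40 * m.+1 * x + 1) + (8 * (x * (n + c)) + 1)).+1).
  have : 40 * m.+1 * x <= 40 * m.+1 * m by rewrite leq_mul2l x_m orbT.
  by nia.
have {}H2 := H2 x 0; rewrite addn0 in H2; apply: exec_seq (H2 _ _) _ => //.
have := @exec_move w 7 10 (regs n out qout b 0 0 (unary (x * (n + c))) 0 0 enc) erefl erefl erefl.
by rewrite size_nseq /upd /= catrev_unary cats0.
Qed.

Fixpoint pow_m c k := if k is k'.+1 then seqm (pow_m c k') (mul_m c) else push 10 true.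

Lemma exec_pow n out qout b enc c m k : 0 < n + c -> n <= m -> c <= m -> (n + c) ^ k <= m ->
  exec (pow_m c k) (regs n out qout b 0 0 [::] 0 0 enc) (200 * m.+1 * m.+1 * k.+1)
    (regs n out qout b 0 0 [::] 0 ((n + c) ^ k) enc).
Proof.
move=> nc0 n_m c_m; elim: k => [|k IH] pow_m'.
  by apply: exec_weaken (@exec_push w 10 true (regs n out qout b 0 0 [::] 0 0 enc) erefl); nia.
have powk : (n + c) ^ k <= (n + c) ^ k.+1 by rewrite leq_pexp2l.
apply: (@exec_weaken _ _ _ (200 * m.+1 * m.+1 * k.+1 + 100 * m.+1 * m.+1).+1).
  by rewrite [_ * k.+2]mulnS; nia.
have {}IH := IH (leq_trans powk pow_m').
rewrite /= in IH; apply: exec_seq IH _; rewrite expnSr.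
by apply: exec_mul; rewrite -?expnSr //; exact: leq_trans pow_m'.
Qed.

(** * Running a given machine on the upper tapes *)

Definition lift_tm (M : turing_machine) off : machine w :=
  @Machine w (tm_state M) (tm_start M) (@tm_halt M)
    (fun s v =>
      let a := tm_trans s [tuple nth None v (off + i) | i < (tm_work M).+1] in
      (a.1, [tuple if (off <= i) && (i - off < (tm_work M).+1)
                   then nth (None, Stay) a.2 (i - off) else (nth None v i, Stay) | i < w.+1])).

Lemma lift_step M off s (tm : (tm_work M).+1.-tuple tape) (tp : w.+1.-tuple tape) :
  off + tm_work M <= w ->
  (forall i, i <= tm_work M -> same_tape (tape_at tp (off + i)) (nth empty_tape tm i)) ->
  exists tp', [/\ @step w (lift_tm M off) (s, tp) = ((@tm_step M (s, tm)).1, tp'),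
    forall i, i <= tm_work M ->
      same_tape (tape_at tp' (off + i)) (nth empty_tape (@tm_step M (s, tm)).2 i)
  & forall i, i < off -> tape_bits (tape_at tp' i) = tape_bits (tape_at tp i)].
Proof.
move=> le_w htp; case: (boolP (@tm_halt M s)) => hs.
  by exists tp; rewrite step_final // /tm_step /= hs.
have vE : [tuple nth None (view tp) (off + i) | i < (tm_work M).+1] =
          [tuple tape_read (tnth tm i) | i < (tm_work M).+1].
  apply: eq_from_tnth => i; rewrite !tnth_mktuple nth_view ifT; last by have := ltn_ord i; lia.
  by rewrite (tnth_nth empty_tape); apply: same_tape_read; apply: htp; rewrite -ltnS.
rewrite stepE // [trans _ _]/= vE /tm_step /= (negPf hs) /=.
set a := tm_trans _ _.
eexists; split; [by [] | |] => i lt_i.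
- have lt_w : off + i < w.+1 by lia.
  rewrite (tape_at_action (fun i => if (off <= i) && (i - off < (tm_work M).+1)
      then nth (None, Stay) a.2 (i - off) else (nth None (view tp) i, Stay))) //.
  rewrite leq_addr addKn /= ltnS lt_i.
  rewrite -(tnth_nth _ _ (Ordinal (lt_i : i < (tm_work M).+1))) -(tnth_nth _ [tuple _ | _ < _] (Ordinal (lt_i : i < (tm_work M).+1))).
  rewrite tnth_mktuple; apply: same_tape_move; apply: same_tape_write.
  by rewrite (tnth_nth empty_tape); apply: htp.
- have lt_w : i < w.+1 by lia.
  rewrite (tape_at_action (fun i => if (off <= i) && (i - off < (tm_work M).+1)
      then nth (None, Stay) a.2 (i - off) else (nth None (view tp) i, Stay))) //.
  rewrite leqNgt lt_i /= nth_view lt_w; exact: tape_bits_idle.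
Qed.

(** Only the output on its first tape is known when [M] halts. That tape becomes one more stack, and
    the contents of the tapes beyond it are hidden in an unspecified [rho']. *)
Lemma triple_lift M off ins t out sg rho : off + tm_work M <= w -> size sg = off ->
  (forall i, i <= tm_work M -> same_tape (rho (off + i)) (tape_of_bits (nth [::] ins i))) ->
  tm_computes M ins t out ->
  triple (lift_tm M off) (holds sg rho) t (fun tp => exists rho', holds (rcons sg out) rho' tp).
Proof.
move=> le_w sz_sg hrho [hhalt hout] tp [le_s hs hr].
have H u : exists tp', [/\ iter u (@step w (lift_tm M off)) (tm_start M, tp) =
     ((iter u (@tm_step M) (tm_init M ins)).1, tp'),
   forall i, i <= tm_work M ->
      same_tape (tape_at tp' (off + i)) (nth empty_tape (iter u (@tm_step M) (tm_init M ins)).2 i)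
  & forall i, i < off -> tape_bits (tape_at tp' i) = tape_bits (tape_at tp i)].
  elim: u => [|u [tp' [e h1 h2]]].
    exists tp; split=> // i le_i /=.
    apply: same_tape_trans (hr _ _ _) _; rewrite ?sz_sg ?leq_addr //; first by lia.
    rewrite (nth_mktuple_nat _ (fun i => tape_of_bits (nth [::] ins i))) //; exact: hrho.
  have [tp'' [e' h1' h2']] := @lift_step M off (iter u (@tm_step M) (tm_init M ins)).1
    (iter u (@tm_step M) (tm_init M ins)).2 tp' le_w h1.
  exists tp''; rewrite !iterS e [iter u _ _]surjective_pairing; split=> // i lt_i.
  by rewrite h2' ?h2.
have [tp' [e h1 h2]] := H t.
exists t, (iter t (@tm_step M) (tm_init M ins)).1, tp'; split=> //.
exists (tape_at tp'); split; rewrite ?size_rcons ?sz_sg; [by lia | move=> i lt_i | by []].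
rewrite nth_rcons sz_sg; case: (ltngtP i off) lt_i => [lt_i _|gt_i lt_i|-> _]; last 1 first.
- have := same_tape_bits (h1 0 isT); rewrite addn0 => ->.
  by rewrite -hout (tnth_nth empty_tape).
- by rewrite h2 // hs ?sz_sg.
- by rewrite ltnS leqNgt gt_i in lt_i.
Qed.

End Generator.

(** * Output lengths and running times *)

Lemma size_tape_bits t : size (tape_bits t) <= size t.2.
Proof.
rewrite /tape_bits size_pmap; apply: leq_trans (count_size _ _) _.
by rewrite size_take_min geq_minr.
Qed.

(** The increase by 2 occurs on an empty list: writing lists one cell and moving left lists
    another. *)
Lemma size_tape_action d s t : size (tape_move d (tape_write s t)).2 <= size t.2 + 2.
Proof.
case: t => l [|c r]; case: d => //=; first by rewrite addn2 leqnSn.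
  by rewrite addn2 2?leqW.
by rewrite addn2 leqW.
Qed.

Lemma size_iter_step M c t i :
  size (tnth (iter t (@tm_step M) c).2 i).2 <= size (tnth c.2 i).2 + 2 * t.
Proof.
elim: t => [|t IH]; first by rewrite muln0 addn0.
rewrite iterS; move: (iter t _ c) IH => c' IH; rewrite mulnSr addnA /tm_step.
case: ifP => _; first by apply: leq_trans IH _; rewrite leq_addr.
by rewrite tnth_mktuple; apply: leq_trans (size_tape_action _ _ _) _; rewrite leq_add2r.
Qed.

(** Gives the polynomial length of the code of the verifier, and with it of everything that the code
    describes. *)
Lemma size_tm_computes M ins t out : tm_computes M ins t out ->
  size out <= size (nth [::] ins 0) + 2 * t.
Proof.
case=> _ <-; apply: leq_trans (size_tape_bits _) _.
apply: leq_trans (size_iter_step _ _ _) _.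
by rewrite tnth_mktuple /= size_map.
Qed.

(* Lengths of intermediate outputs are bounded through running times instead of being
   computed. *)
Lemma size_exec w (F : machine w) sg t sg' r : size sg <= w.+1 -> r < size sg -> r < size sg' ->
  exec F sg t sg' -> size (nth [::] sg' r) <= size (nth [::] sg r) + 2 * t.
Proof.
move=> le_s lt_r lt_r' h.
have lt_rw : r < w.+1 by exact: leq_trans le_s.
pose tp := [tuple tape_of_bits (nth [::] sg i) | i < w.+1].
have tpE i : i < w.+1 -> tape_at tp i = tape_of_bits (nth [::] sg i).
  exact: (@nth_mktuple_nat _ _ _ (fun i => tape_of_bits (nth [::] sg i))).
have [|u [s [tp' [le_u e _ [_ hs _]]]]] := h (tape_at tp) tp.
  by split=> // i lt_i; rewrite tpE ?tape_bits_of_bits //; exact: leq_trans le_s.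
rewrite -(hs r lt_r'); apply: leq_trans (size_tape_bits _) _.
rewrite /tape_at -(tnth_nth _ _ (Ordinal lt_rw)).
have -> : tp' = (iter u (@step w F) (start F, tp)).2 by rewrite e.
apply: leq_trans (size_iter_step (M := to_tm F) _ _ _) _ => /=.
by rewrite (tnth_nth empty_tape) -/(tape_at tp r) tpE //= size_map; lia.
Qed.

(** * The complete generator *)

Section Main.

Variables (M : turing_machine) (q c k : nat).

Notation w := (11 + tm_work M).
Notation push := (push w).
Notation pop := (pop w).
Notation nop := (nop w).
Notation emit := (emit w).

(* The machine [M] is run on the tapes from 11 on, where it finds the input 1^n. *)
Definition copy_m := whilem 0 (predC1 None)
  (seqm (pop 0) (seqm (push 1 true) (seqm (push 4 true) (push 11 true)))).

(** Unlike a stack, the input tape of [M] has to be correct in all its cells, so it is filled as a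
    tape described by [rho]. *)
Lemma triple_push_extra r b sg rho : size sg <= r ->
  triple (push r b) (holds sg rho) 2
    (holds sg (fun i => if i == r then push_tape b (rho r) else rho i)).
Proof.
move=> le_r tp [le_s hs hr]; have [tp' [e h]] := step_push tp r b.
exists 2, (Some true), tp'; split=> //; split=> // i lt_i.
- rewrite h; last exact: leq_trans le_s.
  by rewrite ifF /= ?tape_bits_idle ?hs //; apply/negP => /eqP E; rewrite E ltnNge le_r in lt_i.
- move=> lt_w; rewrite h //; case: eqP => [Er|_].
    rewrite -Er; apply: same_tape_write; apply: same_tape_move.
    by rewrite (same_tape_read (hr _ lt_i lt_w)); apply: same_tape_write; exact: hr.
  apply: same_tape_trans (hr _ lt_i lt_w).
  exact: same_tape_trans (same_tape_idle _) (same_tape_idle _).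
Qed.

Lemma push_tape_unary n rho :
  same_tape rho (tape_of_bits (unary n)) -> same_tape (push_tape true rho) (tape_of_bits (unary n.+1)).
Proof.
move=> h; apply: (@same_tape_trans _ (push_tape true (tape_of_bits (unary n)))).
  rewrite /push_tape (same_tape_read h); apply: same_tape_write; apply: same_tape_move.
  exact: same_tape_write.
by split=> [//|[|[|i]]] //=; case: n {h} => //=; rewrite nth_nil.
Qed.

Lemma triple_copy n j rho : same_tape (rho 11) (tape_of_bits (unary j)) ->
  triple copy_m
    (holds [:: unary n; unary j; [::]; [::]; unary j; [::]; [::]; [::]; [::]; [::]; [::]] rho)
    (20 * n + 1)
    (fun tp => exists2 rho' : nat -> tape,
       holds [:: [::]; unary (n + j); [::]; [::]; unary (n + j); [::]; [::]; [::]; [::]; [::]; [::]] rho' tp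
     & same_tape (rho' 11) (tape_of_bits (unary (n + j))) /\
       forall i, i != 11 -> rho' i = rho i).
Proof.
elim: n j rho => [|n IH] j rho hj.
  have := @exec_while_exit w 0 (predC1 None)
     (seqm (pop 0) (seqm (push 1 true) (seqm (push 4 true) (push 11 true))))
     [:: unary 0; unary j; [::]; [::]; unary j; [::]; [::]; [::]; [::]; [::]; [::]] erefl erefl rho.
  by apply: triple_weaken => // tp h; exists rho.
pose rho1 i := if i == 11 then push_tape true (rho 11) else rho i.
have h1 : same_tape (rho1 11) (tape_of_bits (unary j.+1)) by exact: push_tape_unary.
have {}IH := IH j.+1 rho1 h1; rewrite (addnS n j) in IH.
set sg := [:: unary n.+1; unary j; [::]; [::]; unary j; [::]; [::]; [::]; [::]; [::]; [::]].
set sg1 := [:: unary n; unary j.+1; [::]; [::]; unary j.+1; [::]; [::]; [::]; [::]; [::]; [::]] in IH.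
have hb : triple (seqm (pop 0) (seqm (push 1 true) (seqm (push 4 true) (push 11 true))))
    (holds sg rho) (1 + (2 + (2 + 2).+1).+1).+1 (holds sg1 rho1).
  apply: triple_seq (@holds_idle w _ rho) (@exec_pop w 0 sg erefl erefl rho) _.
  apply: triple_seq (@holds_idle w _ rho) (@exec_push w 1 true _ _ rho) _ => //.
  apply: triple_seq (@holds_idle w _ rho) (@exec_push w 4 true _ _ rho) _ => //.
  exact: triple_push_extra.
apply: (@triple_weaken w _ (holds sg rho) _ (fun tp => exists2 rho' : nat -> tape,
       holds [:: [::]; unary (n + j).+1; [::]; [::]; unary (n + j).+1; [::]; [::]; [::]; [::]; [::]; [::]] rho' tp
     & same_tape (rho' 11) (tape_of_bits (unary (n + j).+1)) /\
       forall i, i != 11 -> rho' i = rho1 i) _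
   ((1 + (2 + (2 + 2).+1).+1).+1 + (20 * n + 1)).+2) => //; first by lia.
  move=> tp [rho' h2 [h3 h4]]; exists rho' => //; split=> // i ni.
  by rewrite h4 // /rho1 (negPf ni).
rewrite /copy_m in IH *.
apply: (triple_while_step _ (@holds_idle w sg rho) (@holds_idle w sg1 rho1) _ hb IH) => // tp h.
by rewrite (holds_read h).
Qed.

Definition answer_items := [:: Unary 1; Bit true; Bit false; Bit true; Bit true; Bit false; Bit false;
  Unary 1; Bit true; Bit false; Bit true; Bit true; Bit false; Unary 1; Bit true; Bit false; Bit false; Bit false].

Lemma answer_items_bits sg n : nth [::] sg 1 = unary n ->
  items_bits sg answer_items =
  encode_nat n.+1 ++ encode_seq encode_gate [:: CNOT 0 n.+1; CNOT n.+1 0].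
Proof.
move=> E; have H s : encode_nat n.+1 ++ s = unary n ++ [:: true, false & s].
  by rewrite /encode_nat -cats1 -[in LHS]addn1 nseqD -!catA.
by rewrite !encode_seq_cons /encode_gate -!catA !H /items_bits [map _ _]/= E.
Qed.

(** Everything on tape 2 is reversed. Each move reverses, so two moves put the query list there in
    the orientation in which it was kept. *)
Definition finish_m :=
  seqm (push 2 false) (seqm (move w 3 8) (seqm (move w 8 2) (seqm (push 2 false)
    (emit 2 answer_items)))).

(** The ancilla count opens the code but is known only once all blocks are placed: it is the final
    base minus the input length. *)
Definition output_m :=
  seqm (move w 2 0) (seqm (push 0 false)
    (seqm (loop 1 nop (popcase 4 nop nop nop)) (loop 4 nop (push 0 true)))).

(** [copy_m] also sets the base to the input length; the two pushes skip the constant qubit and the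
    answer qubit. *)
Definition main_m := seqm copy_m (seqm (lift_tm w M 11) (seqm (push 4 true) (seqm (push 4 true)
  (seqm (pow_m w c k) (seqm (loop 10 nop (block_m w q)) (seqm finish_m output_m)))))).

Section Run.

Variables (n : nat) (V : pcp_verifier) (m : nat).

Notation enc := (encode_pcp_verifier V).
Notation base := (block_base q n V).
Notation gates_of js := (flatten [seq block_gates q n V (base j) | j <- js]).
Notation query_of js := (flatten [seq block_query q n V (base j) | j <- js]).

Definition block_time := 12 * (2000 * m.+1 * m.+1) + 6.

Lemma exec_blocks x j : size (pv_index V) <= q -> n <= m -> size enc <= m -> base (j + x) <= m ->
  exec (loop 10 nop (block_m w q))
    (regs n (catrev (encode_items encode_gate (gates_of (iota 0 j))) [::])
            (catrev (encode_items encode_nat (query_of (iota 0 j))) [::]) (base j) 0 0 [::] 0 x enc)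
    (block_time * x + 1)
    (regs n (catrev (encode_items encode_gate (gates_of (iota 0 (j + x)))) [::])
            (catrev (encode_items encode_nat (query_of (iota 0 (j + x)))) [::])
            (base (j + x)) 0 0 [::] 0 0 enc).
Proof.
move=> r_q n_m sz_m; elim: x j => [|x IH] j base_m.
  by rewrite addn0 muln0; exact: exec_loop_nil.
have {}IH := IH j.+1; rewrite addSnnS in IH.
apply: (@exec_weaken _ _ _ (12 * (2000 * m.+1 * m.+1) + (block_time * x + 1) + 6)).
  by rewrite [_ * x.+1]mulnS /block_time; lia.
have Eb : base j + block_width q n V = base j.+1 by rewrite /block_base mulSn; lia.
have le_b : base j.+1 <= base (j + x.+1) by rewrite /block_base leq_add2l leq_mul2r; lia.
apply: (@exec_loop_cons w 10 _ _ _ true (unary x) _ _ _ _ _ _ _ (IH _)) => //.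
rewrite -[in iota 0 j.+1]addn1 iotaD add0n !map_cat !flatten_cat /= !cats0.
rewrite !(encode_items_cat _ (flatten _)) !(catrev_cat (encode_items _ (flatten _))) -Eb.
by apply: exec_block => //; rewrite Eb; exact: leq_trans base_m.
Qed.

Lemma exec_finish x : size (pv_index V) <= q -> n <= m -> size enc <= m -> base x <= m ->
  exec finish_m
    (regs n (catrev (encode_items encode_gate (gates_of (iota 0 x))) [::])
            (catrev (encode_items encode_nat (query_of (iota 0 x))) [::])
            (base x) 0 0 [::] 0 0 enc)
    (50 * (block_time * x) + 400 * m.+1)
    (regs n (rev (encode_seq encode_gate (gates_of (iota 0 x)) ++
                  encode_seq encode_nat (query_of (iota 0 x)) ++
                  encode_nat n.+1 ++ encode_seq encode_gate [:: CNOT 0 n.+1; CNOT n.+1 0]))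
      [::] (base x) 0 0 [::] 0 0 enc).
Proof.
move=> r_q n_m sz_m base_m.
have hx := @exec_blocks x 0 r_q n_m sz_m base_m.
have sq := size_exec (r := 3) _ _ _ hx; move/(_ isT isT isT): sq => sq.
rewrite [nth _ _ _]/= [nth _ _ _]/= add0n in sq.
set G := encode_items encode_gate (gates_of (iota 0 x)) in hx *.
set Qr := encode_items encode_nat (query_of (iota 0 x)) in hx sq *.
have {}sq : size Qr <= 2 * (block_time * x + 1) by move: sq; rewrite catrevE cats0 size_rev.
apply: (@exec_weaken w _ _ (2 + ((8 * size Qr + 1) + ((8 * size Qr + 1) + (2 + 18 * (20 * m + 10)).+1).+1).+1).+1).
  by move: sq; move: (block_time * x) => B; lia.
apply: exec_seq (@exec_push w 2 false [:: _; _; _; _; _; _; _; _; _; _; _; _] erefl) _.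
have h3 := @exec_move w 3 8 (regs n (false :: catrev G [::]) (catrev Qr [::]) (base x) 0 0 [::] 0 0 enc)
  erefl erefl erefl.
rewrite [nth _ _ 3]/= [nth _ _ 8]/= {1}catrevE cats0 size_rev -[catrev Qr _]/(rev Qr) -[catrev (rev Qr) _]/(rev (rev Qr)) revK in h3.
apply: exec_seq h3 _.
apply: exec_seq (@exec_move w 8 2 (upd (upd (regs n (false :: catrev G [::]) (rev Qr) (base x) 0 0 [::] 0 0 enc) 3 [::]) 8 Qr)
  erefl erefl erefl) _.
apply: exec_seq (@exec_push w 2 false [:: _; _; _; _; _; _; _; _; _; _; _; _] erefl) _.
have b_m : base x <= m := base_m.
have := @exec_emit_regs w n (base x) 0 enc m n_m b_m 2 answer_items
  (false :: catrev Qr (false :: catrev G [::])) [::] 0 0 [::] 0 erefl erefl erefl erefl erefl.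
rewrite (answer_items_bits _ (n := n)) //.
have -> : rev (encode_seq encode_gate (gates_of (iota 0 x)) ++ encode_seq encode_nat (query_of (iota 0 x)) ++
    encode_nat n.+1 ++ encode_seq encode_gate [:: CNOT 0 n.+1; CNOT n.+1 0]) =
  catrev (encode_nat n.+1 ++ encode_seq encode_gate [:: CNOT 0 n.+1; CNOT n.+1 0])
    (false :: catrev Qr (false :: catrev G [::])).
  rewrite !encode_seqE -!cats1 -/G -/Qr.
  by rewrite /rev (catrev_cat (G ++ _)) (catrev_cat (Qr ++ _)) (catrev_cat G) (catrev_cat Qr).
exact.
Qed.

Lemma exec_output s x b :
  exec output_m (regs n (rev s) [::] (n + b) 0 0 [::] 0 x enc)
    (8 * size s + 12 * n + 8 * b + 10)
    [:: encode_nat b ++ s; [::]; [::]; [::]; [::]; [::]; [::]; [::]; [::]; [::]; unary x; enc].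
Proof.
have H1 j : exec (loop 1 nop (popcase 4 nop nop nop))
    [:: false :: s; unary j; [::]; [::]; unary (j + b); [::]; [::]; [::]; [::]; [::]; unary x; enc]
    (10 * j + 1)
    [:: false :: s; [::]; [::]; [::]; unary b; [::]; [::]; [::]; [::]; [::]; unary x; enc].
  elim: j => [|j IH]; first exact: exec_loop_nil.
  apply: (@exec_weaken w _ _ ((0 + 4) + (10 * j + 1) + 6)); first by lia.
  apply: (@exec_loop_cons w 1 _ _ _ true (unary j) _ _ _ _ _ _ _ IH) => //.
  by apply: exec_popcase => //; exact: exec_nop.
have H2 j o : exec (loop 4 nop (push 0 true))
    [:: o; [::]; [::]; [::]; unary j; [::]; [::]; [::]; [::]; [::]; unary x; enc]
    (8 * j + 1)
    [:: unary j ++ o; [::]; [::]; [::]; [::]; [::]; [::]; [::]; [::]; [::]; unary x; enc].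
  elim: j o => [|j IH] o; first exact: exec_loop_nil.
  apply: (@exec_weaken w _ _ (2 + (8 * j + 1) + 6)); first by lia.
  have {}IH := IH (true :: o); rewrite unaryS in IH.
  apply: (@exec_loop_cons w 4 _ _ _ true (unary j) _ _ _ _ _ _ _ IH) => //.
  exact: exec_push.
apply: (@exec_weaken w _ _ ((8 * size (rev s) + 1) + (2 + ((10 * n + 1) + (8 * b + 1)).+1).+1).+1).
  by rewrite size_rev; lia.
apply: exec_seq (@exec_move w 2 0 (regs n (rev s) [::] (n + b) 0 0 [::] 0 x enc) erefl erefl erefl) _.
rewrite [nth _ _ 2]/= [nth _ _ 0]/= -[catrev _ [::]]/(rev (rev s)) revK.
apply: exec_seq (@exec_push w 0 false [:: _; _; _; _; _; _; _; _; _; _; _; _] erefl) _.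
apply: exec_seq (H1 n) _.
by rewrite /encode_nat cat_rcons; exact: H2.
Qed.

End Run.

Hypothesis c_gt0 : 0 < c.

Lemma main_computes n V t m :
  tm_computes M [:: unary n] t (encode_pcp_verifier V) -> size (pv_index V) <= q ->
  block_base q n V ((n + c) ^ k) <= m -> size (encode_pcp_verifier V) <= m ->
  n <= m -> c <= m -> (n + c) ^ k <= m ->
  tm_computes (to_tm main_m) [:: unary n]
    (t + 200 * m.+1 * m.+1 * k.+1 + 4000 * (block_time m * m + m.+1) * 4)
    (encode_query_circuit (sampling_circuit q n V ((n + c) ^ k))).
Proof.
move=> hM r_q base_m sz_m n_m c_m x_m; set x := (n + c) ^ k in base_m x_m *.
pose s := encode_seq encode_gate (flatten [seq block_gates q n V (block_base q n V j) | j <- iota 0 x]) ++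
  encode_seq encode_nat (flatten [seq block_query q n V (block_base q n V j) | j <- iota 0 x]) ++
  encode_nat n.+1 ++ encode_seq encode_gate [:: CNOT 0 n.+1; CNOT n.+1 0].
pose T := block_time m * x; set wd := block_width q n V in base_m.
have Tm : T <= block_time m * m by rewrite leq_mul2l x_m orbT.
have base0 : block_base q n V 0 = n.+2 by rewrite /block_base addn0 addn2.
have basex : block_base q n V x = n + (2 + x * wd) by rewrite /block_base addnA.
have hblocks := @exec_blocks n V m x 0 r_q n_m sz_m base_m; rewrite base0 in hblocks.
have hfinish := @exec_finish n V m x r_q n_m sz_m base_m.
have hpow := @exec_pow w n [::] [::] n.+2 (encode_pcp_verifier V) c m k _ n_m c_m x_m.
have {}hpow := hpow (leq_trans c_gt0 (leq_addl _ _)); rewrite -/x in hpow.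
have ss : size s <= 102 * T + 800 * m.+1 + 2.
  have := size_exec (r := 2) _ _ _ hblocks; move/(_ isT isT isT); rewrite /= -/T => h1.
  have := size_exec (r := 2) _ _ _ hfinish; move/(_ isT isT isT); rewrite /= -/T size_rev => h2.
  by apply: leq_trans h2 _; move: h1; rewrite add0n; lia.
have houtput := @exec_output n V s 0 (2 + x * wd); rewrite -basex in houtput.
have hall : exec (seqm (push 4 true) (seqm (push 4 true)
  (seqm (pow_m w c k) (seqm (loop 10 nop (block_m w q)) (seqm finish_m output_m)))))
  (regs n [::] [::] n 0 0 [::] 0 0 (encode_pcp_verifier V))
  (200 * m.+1 * m.+1 * k.+1 + 4000 * (block_time m * m + m.+1) * 3)
  [:: encode_nat (2 + x * wd) ++ s; [::]; [::]; [::]; [::]; [::]; [::]; [::]; [::]; [::]; [::];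
    encode_pcp_verifier V].
  apply: (@exec_weaken w _ _ (2 + (2 + (200 * m.+1 * m.+1 * k.+1 +
     ((block_time m * x + 1) + ((50 * (block_time m * x) + 400 * m.+1) +
     (8 * size s + 12 * n + 8 * (2 + x * wd) + 10)).+1).+1).+1).+1).+1).
    rewrite basex in base_m; rewrite -/T; move: (200 * m.+1 * m.+1 * k.+1) => U.
    by move: (block_time m * m) Tm => T' Tm; lia.
  apply: exec_seq (@exec_push w 4 true (regs _ _ _ _ _ _ _ _ _ _) erefl) _.
  apply: exec_seq (@exec_push w 4 true [:: _; _; _; _; _; _; _; _; _; _; _; _] erefl) _.
  apply: exec_seq hpow _; apply: exec_seq hblocks _.
  by apply: exec_seq hfinish houtput.
apply: triple_tm_computes.
(* Until [M] has run, only the tapes 0 to 10 count as stacks; those from 11 on are blank tapes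
   described by [rho]. *)
pose sg0 := [:: unary n; unary 0; [::]; [::]; unary 0; [::]; [::]; [::]; [::]; [::]; [::]].
have cl (sg : seq (seq bool)) : @idle_closed w (fun tp => exists rho, holds sg rho tp).
  by move=> tp [rho h]; exists rho; exact: holds_idle.
apply: (@triple_weaken w _ (holds sg0 (fun=> empty_tape)) _
   (fun tp => exists rho, holds [:: encode_nat (2 + x * wd) ++ s; [::]; [::]; [::]; [::]; [::]; [::];
     [::]; [::]; [::]; [::]; encode_pcp_verifier V] rho tp) _
   ((20 * n + 1) + (t + (200 * m.+1 * m.+1 * k.+1 + 4000 * (block_time m * m + m.+1) * 3)).+1).+1).
- move=> tp htp; split=> // i; rewrite /= => lt_i.
    rewrite htp ?tape_bits_of_bits; last by lia.
    by do 11 (case: i lt_i => [|i] lt_i //=); rewrite nth_nil.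
  by move=> lt_w; rewrite htp //; case: i lt_i {lt_w} => [|[|i]] //= _; rewrite nth_nil.
- by move: (200 * m.+1 * m.+1 * k.+1) (block_time m * m) => U T'; lia.
- by move=> tp [rho [_ /(_ 0 isT) ->]].
apply: triple_seq (@triple_copy n 0 (fun=> empty_tape) (same_tape_refl _)) _.
  by move=> tp [rho h hr]; exists rho => //; exact: holds_idle.
apply: (@triple_seq w _ _ _ _ _ _ _ (cl (regs n [::] [::] n 0 0 [::] 0 0 (encode_pcp_verifier V)))).
  move=> tp [rho h [h11 hrho]]; rewrite addn0 in h h11.
  apply: (triple_lift (leqnn _) erefl _ hM h) => -[|i] le_i; first by rewrite addn0.
  by rewrite hrho //= nth_nil.
by move=> tp [rho h]; have [u [st [tp' [h1 h2 h3 h4]]]] := hall rho tp h;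
  exists u, st, tp'; split=> //; exists rho.
Qed.

End Main.

Theorem sampling_circuit_uniform q (V : nat -> pcp_verifier) c k : 0 < c ->
  polytime_uniform (fun n => encode_pcp_verifier (V n)) ->
  (forall n, size (pv_index (V n)) <= q) ->
  polytime_uniform (fun n => encode_query_circuit (sampling_circuit q n (V n) ((n + c) ^ k))).
Proof.
move=> c_gt0 [M [t [t_poly hM]]] r_q.
(* [e] bounds the code of the verifier through its running time, [W] the width of a block, and [m]
   every length that occurs in the generator. *)
pose e n := n + 2 * t n; pose W n := n + 3 * e n + 4 * q + 6.
pose m n := n + 2 + (n + c) ^ k * W n + e n + q + c + (n + c) ^ k.
exists (to_tm (main_m M q c k)), (fun n => t n + 200 * (m n).+1 * (m n).+1 * k.+1 +
  4000 * (block_time (m n) * m n + (m n).+1) * 4); split.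
  have pS f : poly_bounded f -> poly_bounded (fun n => (f n).+1).
    move=> pf; apply: (@poly_bounded_leq _ (fun n => f n + 1)) => [n|]; first by rewrite addn1.
    exact: poly_boundedD pf (poly_bounded_const 1).
  have pX : poly_bounded (fun n => (n + c) ^ k).
    elim: (k) => [|k' IH]; first exact: poly_bounded_const.
    apply: (@poly_bounded_leq _ (fun n => (n + c) * (n + c) ^ k')) => [n|]; first by rewrite expnS.
    by apply: poly_boundedM IH; exact: poly_boundedD poly_bounded_id (poly_bounded_const c).
  have pe : poly_bounded e by rewrite /e; poly_bound.
  have pm : poly_bounded m by rewrite /m /W; poly_bound.
  by have pm1 := pS _ pm; rewrite /block_time; poly_bound.
move=> n; have sz := size_tm_computes (hM n); rewrite /= size_nseq -/(e n) in sz.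
have wd_le : block_width q n (V n) <= W n.
  rewrite /block_width /end_start /pad_start locs_afterE /token_start /nqubits.
  have sz4 : size (encode_nat (pv_ancillas (V n))) +
   size (encode_seq (encode_seq encode_nat) (pv_index (V n))) <= e n.
    by apply: leq_trans sz; rewrite /encode_pcp_verifier !size_cat; lia.
  rewrite size_encode_nat in sz4.
  have : tokens_size (pv_index (V n)) <= 2 * size (encode_seq (encode_seq encode_nat) (pv_index (V n))).
    elim: (pv_index (V n)) => //= l ls IH; rewrite /tokens_size /= -/(tokens_size ls) size_cat.
    have := size_encode_seq encode_nat l; lia.
  by rewrite /W; have := r_q n; lia.
have le_mul : (n + c) ^ k * block_width q n (V n) <= (n + c) ^ k * W n by rewrite leq_mul2l wd_le orbT.
by apply: main_computes => //; rewrite /m /block_base; lia.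
Qed.

(** * Strings of tokens *)

Definition target (a : instr) := match a with Zero d | One d | Coin d | Copy _ d => d end.

(** The constraint on basis states that an instruction leaves behind; a coin leaves none. *)
Definition satisfied (b : seq bool) (a : instr) : bool :=
  match a with
  | Zero d => ~~ nth false b d
  | Copy s d => nth false b d == nth false b s
  | One d => nth false b d
  | Coin _ => true
  end.

Definition is_coin (a : instr) := if a is Coin _ then true else false.

(** [U] is the set of qubits in use: targets come from outside it, and sources of copies from
    inside. *)
Fixpoint fresh_instrs W (U : pred nat) (s : seq instr) : bool :=
  if s is a :: s' then
    [&& (target a < W)%N, ~~ U (target a), if a is Copy i _ then U i else true
      & fresh_instrs W (predU1 (target a) U) s']
  else true.

Fixpoint index_tokens (o : seq bool) : seq bool :=
  if o is x :: o' then [:: false, x & index_tokens o'] else [::].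

Fixpoint read_tokens (os : seq (seq bool)) (zs : seq bool) : seq bool :=
  match os, zs with
  | o :: os', z :: zs' => index_tokens o ++ [:: true, false, z & read_tokens os' zs']
  | _, _ => [::]
  end.

Fixpoint pad_tokens (p : seq bool) : seq bool :=
  if p is x :: p' then [:: true, false, x & pad_tokens p'] else [::].

Definition block_tokens os zs p a := read_tokens os zs ++ pad_tokens p ++ [:: true; true; a].

Lemma size_index_tokens o : size (index_tokens o) = (size o).*2.
Proof. by elim: o => //= x o ->; rewrite doubleS. Qed.

Lemma size_pad_tokens p : size (pad_tokens p) = 3 * size p.
Proof. by elim: p => //= x p ->; lia. Qed.

Lemma index_tokens_inj o1 o2 s1 s2 : size o1 = size o2 ->
  index_tokens o1 ++ s1 = index_tokens o2 ++ s2 -> o1 = o2 /\ s1 = s2.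
Proof.
by elim: o1 o2 => [|x o1 IH] [|x2 o2] //= [] /IH{}IH [-> /IH[-> ->]].
Qed.

Lemma read_tokens_inj os1 os2 z1 z2 s1 s2 : map size os1 = map size os2 ->
  size z1 = size os1 -> size z2 = size os2 ->
  read_tokens os1 z1 ++ s1 = read_tokens os2 z2 ++ s2 -> [/\ os1 = os2, z1 = z2 & s1 = s2].
Proof.
elim: os1 os2 z1 z2 => [|o1 os1 IH] [|o2 os2] [|x1 z1] [|x2 z2] //= [eo eos] [e1] [e2].
rewrite -!catA => /(index_tokens_inj eo)[-> /= [-> /(IH _ _ _ eos e1 e2)[-> -> ->]]].
by [].
Qed.

Lemma pad_tokens_inj p1 p2 s1 s2 : size p1 = size p2 ->
  pad_tokens p1 ++ s1 = pad_tokens p2 ++ s2 -> p1 = p2 /\ s1 = s2.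
Proof.
by elim: p1 p2 => [|x p1 IH] [|x2 p2] //= [] /IH{}IH [-> /IH[-> ->]].
Qed.

(** The token string determines the measured addresses, the guesses and the accept bit once the
    shapes are known, so that different histories never share a basis state of the query
    register. *)
Lemma block_tokens_inj os1 os2 z1 z2 p1 p2 a1 a2 :
  map size os1 = map size os2 -> size z1 = size os1 -> size z2 = size os2 -> size p1 = size p2 ->
  block_tokens os1 z1 p1 a1 = block_tokens os2 z2 p2 a2 -> [/\ os1 = os2, z1 = z2, p1 = p2 & a1 = a2].
Proof.
move=> eos e1 e2 ep /(read_tokens_inj eos e1 e2)[-> -> /(pad_tokens_inj ep)[-> [->]]].
by [].
Qed.

Lemma check_run_index Q y o s st :
  check_run Q y (index_tokens o ++ s) st =
  check_run Q y s (CheckState (foldl (fun w b => decimate b w) (addr st) o) (bad st) (pos st) (neg st)).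
Proof. by elim: o st => [|b o IH] st /=; [case: st | rewrite IH]. Qed.

(** [bad] is tracked only up to emptiness, which is all that the end of a sample inspects. *)
Lemma check_run_read Q y os zs s bd p ng : size zs = size os ->
  exists2 bd', nilp bd' = nilp bd && (zs == [seq nth false y (nat_of_bits o) | o <- os]) &
    check_run Q y (read_tokens os zs ++ s) (CheckState y bd p ng) = check_run Q y s (CheckState y bd' p ng).
Proof.
elim: os zs bd => [|o os IH] [|z zs] bd //= => [_|[sz]]; first by exists bd; rewrite ?andbT.
rewrite -catA check_run_index /= /check_value /= head_foldl_decimate.
set bd1 := if _ then _ else _; have [bd' nil_bd' ->] := IH zs bd1 sz.
exists bd' => //; rewrite nil_bd' eqseq_cons andbA /bd1 [z == _]eq_sym.
by case: (_ == z); rewrite ?andbT ?andbF.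
Qed.

Lemma check_run_pad Q y r s bd p ng :
  exists2 bd', nilp bd' = nilp bd && all (pred1 (nth false y 0)) r &
    check_run Q y (pad_tokens r ++ s) (CheckState y bd p ng) = check_run Q y s (CheckState y bd' p ng).
Proof.
elim: r bd => [|x r IH] bd /=; first by exists bd; rewrite ?andbT.
rewrite /check_value /= -nth0.
set bd1 := if _ then _ else _; have [bd' nil_bd' ->] := IH bd1.
exists bd' => //; rewrite nil_bd' andbA /bd1 [x == _]eq_sym.
by case: (_ == x); rewrite ?andbT ?andbF.
Qed.

Definition sample_ok y (os : seq (seq bool)) (zs p : seq bool) (a : bool) :=
  [&& a, zs == [seq nth false y (nat_of_bits o) | o <- os] & all (pred1 (nth false y 0)) p].

Lemma check_run_block Q y os zs r a s p ng : size zs = size os ->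
  check_run Q y (block_tokens os zs r a ++ s) (CheckState y [::] p ng) =
  check_run Q y s (CheckState y [::] (if sample_ok y os zs r a then nseq Q true ++ p else p) (true :: ng)).
Proof.
move=> sz; rewrite /block_tokens -!catA.
have [bd1 nil1 ->] := check_run_read Q y (pad_tokens r ++ [:: true; true; a] ++ s) [::] p ng sz.
have [bd2 nil2 ->] := check_run_pad Q y r ([:: true; true; a] ++ s) bd1 p ng.
by rewrite /= /check_end /= nil2 nil1.
Qed.

Lemma eqseqE2 (T : eqType) (x y : T) s t : (x :: s == y :: t) = (x == y) && (s == t).
Proof. by []. Qed.

Lemma satisfied_index b loc l :
  all (satisfied b) (index_instrs loc l) =
  (bits_at b (iota loc (size l).*2) == index_tokens (bits_at b l)).
Proof.
elim: l loc => //= i l IH loc.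
by rewrite !eqseqE2 -IH eqbF_neg.
Qed.

Lemma bits_at_cat b l1 l2 : bits_at b (l1 ++ l2) = bits_at b l1 ++ bits_at b l2.
Proof. exact: map_cat. Qed.

Lemma satisfied_read b c loc ls :
  all (satisfied b) (read_instrs c loc ls) =
  (bits_at b (iota loc (tokens_size ls)) ==
   read_tokens [seq bits_at b l | l <- ls] (bits_at b (iota c (size ls)))).
Proof.
elim: ls c loc => //= l ls IH c loc.
rewrite !all_cat satisfied_index /= IH /loc_after.
have -> : tokens_size (l :: ls) = (size l).*2 + (3 + tokens_size ls) by rewrite addnA.
rewrite iotaD bits_at_cat eqseq_cat ?size_index_tokens ?size_map ?size_iota //.
congr (_ && _); rewrite iotaD bits_at_cat /= !eqseqE2 !addnS addn0.
by rewrite eqb_id eqbF_neg !andbA.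
Qed.

Lemma satisfied_pad b loc k :
  all (satisfied b) (pad_instrs loc k) =
  (bits_at b (iota loc (3 * k)) == pad_tokens [seq nth false b (loc + 3 * i + 2) | i <- iota 0 k]).
Proof.
elim: k loc => // k IH loc; rewrite mulnS iotaD bits_at_cat /= IH.
rewrite !eqseqE2 eqb_id eqbF_neg muln0 addn0 addn2 eqxx /= addn3 -[iota 1 k]/(iota (1 + 0) k) iotaDl -map_comp.
do 2 congr (_ && _); congr (_ == pad_tokens _).
by apply: eq_map => i /=; congr nth; lia.
Qed.

Lemma mem_index_targets loc l k :
  (k \in map target (index_instrs loc l)) = (loc <= k < loc + (size l).*2).
Proof.
elim: l loc => [|i l IH] loc /=; first by rewrite in_nil addn0; lia.
by rewrite !in_cons IH; lia.
Qed.

Lemma mem_read_targets c loc ls k :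
  (k \in map target (read_instrs c loc ls)) =
  (c <= k < c + size ls) || (loc <= k < loc + tokens_size ls).
Proof.
elim: ls c loc => [|l ls IH] c loc /=; first by rewrite in_nil !addn0; lia.
rewrite !map_cat !mem_cat mem_index_targets /= !in_cons IH /loc_after.
by rewrite /tokens_size /= -/(tokens_size ls); lia.
Qed.

Lemma mem_pad_targets loc r k :
  (k \in map target (pad_instrs loc r)) = (loc <= k < loc + 3 * r).
Proof.
elim: r loc => [|r IH] loc /=; first by rewrite in_nil muln0 addn0; lia.
by rewrite !in_cons IH; lia.
Qed.

Section Fresh.

Variables (W N S : nat).
Hypothesis NS : N < S.

(** Two regions grow while instructions allocate qubits: the verifier qubits and guesses, up to [c],
    and the tokens, from [S] up to [loc]. *)
Definition used_below (U : pred nat) c loc :=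
  (forall k, U k -> (k < c) || (S <= k < loc)) /\ (forall i, i < N -> U i).

Lemma fresh_next U c loc a s c' loc' : used_below U c loc ->
  c <= target a < W -> (target a < S) || (loc <= target a) ->
  (if a is Copy i _ then U i else true) ->
  c <= c' -> loc <= loc' -> (target a < c') || (S <= target a < loc') ->
  (used_below (predU1 (target a) U) c' loc' -> fresh_instrs W (predU1 (target a) U) s) ->
  fresh_instrs W U (a :: s).
Proof.
move=> [h1 h2] /andP[le_c lt_W] le_l src cc ll hd hs; rewrite /= lt_W src.
have -> : ~~ U (target a) by apply/negP => /h1; lia.
apply: hs; split=> [k /= /orP[/eqP->//|/h1]|i /h2 /= ->]; last by rewrite orbT.
by lia.
Qed.

Lemma fresh_token U c loc a s : used_below U c loc -> target a = loc -> c <= S <= loc ->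
  loc < W -> (if a is Copy i _ then U i else true) ->
  (used_below (predU1 loc U) c loc.+1 -> fresh_instrs W (predU1 loc U) s) ->
  fresh_instrs W U (a :: s).
Proof.
move=> hU e; subst loc => cS lt_W src hs.
by apply: (@fresh_next _ _ _ _ _ c (target a).+1 hU) => //; lia.
Qed.

Lemma fresh_index U c loc l s : used_below U c loc -> c <= S <= loc ->
  all (fun i => i < N) l -> loc + (size l).*2 <= W ->
  (forall U', used_below U' c (loc + (size l).*2) -> fresh_instrs W U' s) ->
  fresh_instrs W U (index_instrs loc l ++ s).
Proof.
elim: l U loc => [|i l IH] U loc hU cS; first by rewrite /= addn0 => _ _; apply.
rewrite [all _ _]/= [size _]/=; case/andP=> iN lN le_W hs.
apply: (fresh_token hU) => [//|||//|h1]; [lia|lia|].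
apply: (fresh_token h1) => [//||||h2]; [lia|lia|by case: h1 => _; apply|].
apply: (IH _ _ h2) => //; try lia.
by move=> U' hU'; apply: hs; rewrite doubleS !addnS -!addSn.
Qed.

Lemma fresh_read U c loc ls s : used_below U c loc -> N <= c -> c + size ls <= S -> S <= loc ->
  all (all (fun i => i < N)) ls -> loc + tokens_size ls <= W ->
  (forall U', used_below U' (c + size ls) (loc + tokens_size ls) -> fresh_instrs W U' s) ->
  fresh_instrs W U (read_instrs c loc ls ++ s).
Proof.
elim: ls U c loc => [|l ls IH] U c loc hU Nc cS Sl.
  by rewrite /= !addn0 => _ _; apply.
have -> : tokens_size (l :: ls) = (size l).*2 + 3 + tokens_size ls by [].
rewrite [all _ _]/=; case/andP=> lN lsN le_W hs; rewrite [size _]/= in cS hs *.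
rewrite [read_instrs _ _ _]/= -!catA.
apply: (fresh_index hU) => // [||U1 hU1]; try lia.
rewrite /loc_after in hU1 *; set d := loc + (size l).*2 in hU1 *.
have Sd : S <= d by rewrite /d; lia.
have dW : d + 3 <= W by rewrite /d; lia.
apply: (fresh_token hU1) => [//||||h1] //; try lia.
apply: (fresh_token h1) => [//||||h2] //; try lia.
apply: (@fresh_next _ _ _ (Coin c) _ c.+1 d.+2 h2) => [||||||h3] //; try (by rewrite /=; lia).
apply: (fresh_token h3) => [//||||h4]; rewrite /= ?eqxx //; try lia.
apply: (IH _ _ _ h4) => //; try lia.
by move=> U' hU'; apply: hs; move: hU'; congr used_below; rewrite /d; lia.
Qed.

Lemma fresh_pad U c loc r s : used_below U c loc -> c <= S <= loc ->
  loc + 3 * r <= W ->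
  (forall U', used_below U' c (loc + 3 * r) -> fresh_instrs W U' s) ->
  fresh_instrs W U (pad_instrs loc r ++ s).
Proof.
elim: r U loc => [|r IH] U loc hU cS; first by rewrite muln0 addn0 => _; apply.
move=> le_W hs.
apply: (fresh_token hU) => [//||||h1] //; try lia.
apply: (fresh_token h1) => [//||||h2] //; try lia.
apply: (fresh_token h2) => [//||||h3] //; try lia.
apply: (IH _ _ h3) => //; try lia.
by move=> U' hU'; apply: hs; move: hU'; congr used_below; lia.
Qed.

Lemma fresh_end U c loc : used_below U c loc -> c <= S <= loc -> loc + 3 <= W ->
  fresh_instrs W U (end_instrs loc).
Proof.
move=> hU cS le_W.
apply: (fresh_token hU) => [//||||h1] //; try lia.
apply: (fresh_token h1) => [//||||h2] //; try lia.
by apply: (fresh_token h2) => [//||||h3] //; lia.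
Qed.

End Fresh.

Lemma count_coins_index loc l : count is_coin (index_instrs loc l) = 0.
Proof. by elim: l loc => //= i l IH loc; rewrite IH. Qed.

Lemma count_coins_read c loc ls : count is_coin (read_instrs c loc ls) = size ls.
Proof. by elim: ls c loc => //= l ls IH c loc; rewrite !count_cat count_coins_index /= IH. Qed.

Lemma count_coins_pad loc r : count is_coin (pad_instrs loc r) = r.
Proof. by elim: r loc => //= r IH loc; rewrite IH. Qed.

Section TokenInstrs.

Variables (q n : nat) (V : pcp_verifier).
Hypothesis r_q : size (pv_index V) <= q.

Notation N := (nqubits n V).
Notation S := (token_start q n V).
Notation r := (size (pv_index V)).
Notation W := (block_width q n V).

Lemma block_widthE : W = S + tokens_size (pv_index V) + 3 * (q - r) + 3.
Proof. by rewrite /block_width /end_start /pad_start locs_afterE. Qed.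

Lemma fresh_token_instrs : all (all (fun i => i < N)) (pv_index V) ->
  fresh_instrs W (fun k => k < N) (token_instrs q n V).
Proof.
move=> idx_N; have NS : N < S by rewrite /token_start; lia.
have hU : used_below N S (fun k => k < N) N S by split=> // k ->.
rewrite /token_instrs /end_start /pad_start !locs_afterE.
apply: (fresh_read NS hU) => //; rewrite ?block_widthE; try by rewrite /token_start; lia.
move=> U1 hU1; apply: (fresh_pad NS hU1); rewrite ?block_widthE; try by rewrite /token_start; lia.
move=> U2 hU2; apply: (fresh_end NS hU2); rewrite ?block_widthE;
  by rewrite /token_start; lia.
Qed.

(** The purpose of padding: reads and pads together toss exactly [q] coins, whatever the number of
    reads. *)
Lemma count_coins_token_instrs : count is_coin (token_instrs q n V) = q.
Proof. by rewrite !count_cat count_coins_read count_coins_pad /=; lia. Qed.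

Lemma mem_token_targets k : k < W ->
  (k < N) || (k \in map target (token_instrs q n V)) = (k < N + r) || (S <= k).
Proof.
rewrite block_widthE /token_instrs !map_cat !mem_cat mem_read_targets mem_pad_targets.
by rewrite /end_start /pad_start locs_afterE /= !in_cons in_nil /token_start; lia.
Qed.

(** A padding coin is tossed directly on its token qubit and has no copy among the guesses, so its
    value is read back from the token region. *)
Definition pad_bits (b : seq bool) :=
  [seq nth false b (pad_start q n V + 3 * i + 2) | i <- iota 0 (q - r)].

Lemma satisfied_tokens (b : seq bool) :
  all (satisfied b) (token_instrs q n V) =
  (bits_at b (iota S (W - S)) ==
   block_tokens [seq bits_at b l | l <- pv_index V] (bits_at b (iota N r)) (pad_bits b) false).
Proof.
rewrite !all_cat satisfied_read satisfied_pad /=.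
have -> : W - S = tokens_size (pv_index V) + (3 * (q - r) + 3) by rewrite block_widthE; lia.
have sz : size (bits_at b (iota S (tokens_size (pv_index V)))) =
  size (read_tokens [seq bits_at b l | l <- pv_index V] (bits_at b (iota N r))).
  rewrite size_map size_iota; elim: (pv_index V) N => //= l ls IH c.
  by rewrite size_cat size_index_tokens size_map /= -IH /tokens_size /=; lia.
rewrite iotaD bits_at_cat eqseq_cat //; congr (_ && _).
rewrite iotaD bits_at_cat eqseq_cat; last by rewrite size_pad_tokens !size_map !size_iota.
rewrite /pad_bits /end_start /pad_start locs_afterE; congr (_ && _).
by rewrite /= !eqseqE2 !eqb_id eqbF_neg !andbT.
Qed.

End TokenInstrs.

Import Order.TTheory GRing.Theory Num.Theory.

Local Open Scope ring_scope.

(** * Amplitudes of the sampling circuit *)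

Lemma nth_mkt n (F : nat -> bool) k :
  nth false [tuple F (val i) | i < n] k = (k < n)%N && F k.
Proof.
case: ltnP => [lt_k|le_k]; last by rewrite nth_default ?size_tuple.
by rewrite -(tnth_nth false _ (Ordinal lt_k)) tnth_mktuple.
Qed.

Lemma eq_from_nth_tuple n (u v : n.-tuple bool) :
  (forall k, (k < n)%N -> nth false u k = nth false v k) -> u = v.
Proof.
move=> h; apply: eq_from_tnth => i; rewrite !(tnth_nth false); exact: h.
Qed.

Lemma nth_flip n i (b : n.-tuple bool) k :
  nth false (flip i b) k = nth false b k (+) ((k < n)%N && (k == i)).
Proof.
case: (ltnP k n) => [lt_k|le_k]; last by rewrite !nth_default ?size_tuple.
by rewrite -(tnth_nth false _ (Ordinal lt_k)) tnth_mktuple (tnth_nth false).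
Qed.

Lemma flipK n i : involutive (@flip n i).
Proof.
by move=> b; apply: eq_from_nth_tuple => k _; rewrite !nth_flip -addbA addbb addbF.
Qed.

Definition restr n B (s : seq bool) : n.-tuple bool := [tuple nth false s (B + i) | i < n].

Lemma nth_restr n B s k : nth false (restr n B s) k = (k < n)%N && nth false s (B + k).
Proof. exact: (@nth_mkt _ (fun k => nth false s (B + k))). Qed.

Lemma restr_id n (b : n.-tuple bool) : restr n 0 b = b.
Proof. by apply: eq_from_nth_tuple => k lt_k; rewrite nth_restr lt_k. Qed.

Section Quantum.

Local Open Scope complex_scope.

Variable R : realType.
Notation C := R[i].
Notation sqmod := (@sqmod R).
Notation qstate := (qstate R).

Lemma sqmodM z t : sqmod (z * t) = sqmod z * sqmod t.
Proof. by case: z t => [a b] [c d]; rewrite /sqmod /=; ring. Qed.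

Lemma sqmod0 : sqmod 0 = 0.
Proof. by rewrite /sqmod /= expr0n /= addr0. Qed.

Lemma sqmod1 : sqmod 1 = 1.
Proof. by rewrite /sqmod /= expr0n expr1n /= addr0. Qed.

Lemma sqmod_ge0 z : 0 <= sqmod z.
Proof. by rewrite addr_ge0 // sqr_ge0. Qed.

Lemma sqmodX z k : sqmod (z ^+ k) = sqmod z ^+ k.
Proof. by elim: k => [|k IH]; rewrite ?expr0 ?sqmod1 // !exprS sqmodM IH. Qed.

Lemma sqmod_nat (b : bool) : sqmod b%:R = b%:R.
Proof. by case: b; rewrite ?sqmod1 ?sqmod0. Qed.

Lemma sqmod_prod (I : finType) (F : I -> C) : sqmod (\prod_i F i) = \prod_i sqmod (F i).
Proof. by apply: (big_morph sqmod sqmodM sqmod1). Qed.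

Definition rsqrt2 : C := (Num.sqrt 2)^-1%:C.

Lemma sqrt2_sq : (Num.sqrt 2 : R)^-1 ^+ 2 = 2^-1.
Proof. by rewrite exprVn sqr_sqrtr. Qed.

Lemma rsqrt2_sq : rsqrt2 * rsqrt2 = 2^-1.
Proof.
have := sqrt2_sq; rewrite /rsqrt2; move: (Num.sqrt 2)^-1 => s hs.
have h2 : (2 : C) != 0 by rewrite pnatr_eq0.
apply: (mulIf h2); rewrite mulVf //.
have -> : (2 : C) = 2%:C by rewrite rmorph_nat.
by rewrite -!rmorphM /= -expr2 hs mulVf ?pnatr_eq0.
Qed.

Lemma sqmod_rsqrt2 : sqmod rsqrt2 = 2^-1.
Proof. by rewrite /sqmod /= sqrt2_sq expr0n addr0. Qed.

Definition tphase : C := (Num.sqrt 2)^-1 +i* (Num.sqrt 2)^-1.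

Lemma sqmod_tphase : sqmod tphase = 1.
Proof. by rewrite /sqmod /= sqrt2_sq; lra. Qed.

Lemma tphase4 : tphase ^+ 4 = -1.
Proof.
have := sqrt2_sq; rewrite /tphase; move: (Num.sqrt 2)^-1 => s hs.
have e2 : (s +i* s) * (s +i* s) = 0 +i* 1.
  by apply/eqP; rewrite eq_complex /=; apply/andP; split; apply/eqP; rewrite -?expr2 ?hs; lra.
by rewrite -[4%N]/(2 + 2)%N exprD expr2 e2; apply/eqP; rewrite eq_complex /=; apply/andP; split; apply/eqP; ring.
Qed.

(** * States seen through a window of qubits *)

Definition scale_state n (c : C) (psi : qstate n) : qstate n := [ffun b => c * psi b].

Lemma apply_gate_scale n c (psi : qstate n) g :
  apply_gate (scale_state c psi) g = scale_state c (apply_gate psi g).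
Proof.
apply/ffunP => b; case: g => [i|i|i j]; rewrite !ffunE //=; last by case: ifP.
  by ring.
by case: ifP => _; ring.
Qed.

Lemma run_circuit_scale n c (psi : qstate n) G :
  run_circuit G (scale_state c psi) = scale_state c (run_circuit G psi).
Proof.
by elim: G psi => //= g G IH psi; rewrite /run_circuit /= -IH -apply_gate_scale.
Qed.

Lemma run_circuit_cat n (psi : qstate n) G1 G2 :
  run_circuit (G1 ++ G2) psi = run_circuit G2 (run_circuit G1 psi).
Proof. by rewrite /run_circuit foldl_cat. Qed.

Definition overwrite m n B (v : seq bool) (c : seq bool) : m.-tuple bool :=
  [tuple if (B <= k < B + n)%N then nth false v (k - B) else nth false c k | k < m].

Lemma nth_overwrite m n B v c k : nth false (overwrite m n B v c) k =
  (k < m)%N && (if (B <= k < B + n)%N then nth false v (k - B) else nth false c k).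
Proof.
exact: (@nth_mkt _ (fun k => if (B <= k < B + n)%N then nth false v (k - B) else nth false c k)).
Qed.

(** The unnormalised state of the window [B, B + n) when the qubits outside it are fixed to their
    values in [c]. *)
Definition slice m n B (Phi : qstate m) (c : seq bool) : qstate n :=
  [ffun v : n.-tuple bool => Phi (overwrite m n B v c)].

Lemma overwrite_restr m n B (b : m.-tuple bool) : overwrite m n B (restr n B b) b = b.
Proof.
apply: eq_from_nth_tuple => k lt_k; rewrite nth_overwrite lt_k /= nth_restr.
case: ifP => // /andP[le_k lt_k']; rewrite subnKC // ltn_subLR //= lt_k' //.
Qed.

(** A gate inside the window never mixes amplitudes that differ outside it, so it acts on every
    slice separately. *)
Lemma slice_gate m n B (Phi : qstate m) c g : gate_wf n g -> (B + n <= m)%N ->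
  slice n B (apply_gate Phi (shift_gate B g)) c = apply_gate (slice n B Phi c) g.
Proof.
move=> wf_g le_m.
have nthE (v : n.-tuple bool) i : (i < n)%N -> nth false (overwrite m n B v c) (B + i) = nth false v i.
  by move=> lt_i; rewrite nth_overwrite leq_addr ltn_add2l lt_i addKn (leq_trans _ le_m) // ltn_add2l.
have flipE (v : n.-tuple bool) i : (i < n)%N ->
    flip (B + i) (overwrite m n B v c) = overwrite m n B (flip i v) c.
  move=> lt_i; apply: eq_from_nth_tuple => k lt_k; rewrite nth_flip !nth_overwrite lt_k /=.
  case: ifP => [/andP[le_k lt_k']|ni].
    by rewrite nth_flip ltn_subLR // lt_k' -{2}(subnKC le_k) eqn_add2l.
  case: eqP => [ek|_]; last by rewrite addbF.
  by rewrite ek leq_addr ltn_add2l lt_i in ni.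
apply/ffunP => v; case: g wf_g => [i|i|i j] /=; rewrite !ffunE.
- by move=> lt_i; rewrite nthE // flipE // !ffunE.
- by move=> lt_i; rewrite nthE.
- by case/and3P=> lt_i lt_j _; rewrite nthE // flipE // !ffunE.
Qed.

Lemma run_slice m n B (Phi : qstate m) G b : all (gate_wf n) G -> (B + n <= m)%N ->
  run_circuit (map (shift_gate B) G) Phi b = run_circuit G (slice n B Phi b) (restr n B b).
Proof.
move=> wf_G le_m; rewrite -{1}(overwrite_restr n B b).
suff <- : slice n B (run_circuit (map (shift_gate B) G) Phi) b = run_circuit G (slice n B Phi b).
  by rewrite ffunE.
elim: G Phi wf_G => //= g G IH Phi /andP[wf_g wf_G].
by rewrite /run_circuit /= -slice_gate // -/(run_circuit _ _) IH.
Qed.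

Lemma shift_gate0 g : shift_gate 0 g = g. Proof. by case: g. Qed.

Lemma run_slice0 m n (Phi : qstate m) G b : all (gate_wf n) G -> (n <= m)%N ->
  run_circuit G Phi b = run_circuit G (slice n 0 Phi b) (restr n 0 b).
Proof.
move=> wf_G le_m; rewrite -run_slice //; congr (run_circuit _ Phi b).
by rewrite -[LHS]map_id; apply: eq_map => g; rewrite shift_gate0.
Qed.

Definition norm2 n (psi : qstate n) : R := \sum_b sqmod (psi b).

Lemma norm2_gate n (psi : qstate n) g : gate_wf n g -> norm2 (apply_gate psi g) = norm2 psi.
Proof.
case: g => [i|i|i j] /= wf_g; rewrite /norm2.
- have nf (b : n.-tuple bool) : nth false (flip i b) i = ~~ nth false b i.
    by rewrite nth_flip wf_g eqxx addbT.
  (* The interference term of the two amplitudes; flipping the qubit [i] changes its sign, so it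
     sums to zero. *)
  pose cross (b : n.-tuple bool) := (-1) ^+ nth false b i *
    (complex.Re (psi b) * complex.Re (psi (flip i b)) + complex.Im (psi b) * complex.Im (psi (flip i b))).
  have E b : sqmod (apply_gate psi (Hadamard i) b) =
      2^-1 * (sqmod (psi b) + sqmod (psi (flip i b))) + cross b.
    rewrite ffunE sqmodM -/rsqrt2 sqmod_rsqrt2 /cross.
    case: (psi b) (psi (flip i b)) => [p q] [u v]; rewrite /sqmod.
    by case: (nth _ _ _); rewrite ?expr0 ?expr1 ?mul1r ?mulN1r /=; lra.
  have cross0 : \sum_b cross b = 0.
    have E2 : \sum_b cross b = - \sum_b cross b.
      rewrite {1}(reindex_inj (inv_inj (@flipK n i))) -sumrN; apply: eq_bigr => b _.
      rewrite /cross nf flipK; case: (nth _ _ _); rewrite ?expr0 ?expr1; ring.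
    by move: E2; lra.
  under eq_bigr => b _ do rewrite E.
  rewrite big_split /= cross0 addr0 -mulr_sumr big_split /=.
  rewrite -(reindex_inj (inv_inj (@flipK n i)) (P := predT) (F := fun b => sqmod (psi b))) /=.
  by lra.
- by apply: eq_bigr => b _; rewrite ffunE; case: ifP => // _; rewrite -/tphase sqmodM sqmod_tphase mul1r.
- case/and3P: wf_g => lt_i lt_j ij.
  pose f (b : n.-tuple bool) := if nth false b i then flip j b else b.
  have fK : involutive f.
    move=> b; rewrite /f; case E: (nth false b i); last by rewrite E.
    by rewrite nth_flip (negPf ij) andbF addbF E flipK.
  rewrite [RHS](reindex_inj (inv_inj fK)); apply: eq_bigr => b _.
  by rewrite ffunE /f; case: ifP.
Qed.

Lemma norm2_run n (psi : qstate n) G : all (gate_wf n) G -> norm2 (run_circuit G psi) = norm2 psi.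
Proof.
elim: G psi => //= g G IH psi /andP[wf_g wf_G].
by rewrite /run_circuit /= -/(run_circuit _ _) IH // norm2_gate.
Qed.

Lemma norm2_ket n (c : n.-tuple bool) : norm2 (ket R c) = 1.
Proof.
rewrite /norm2 (bigD1 c) //= big1 ?addr0 => [|b /negPf nb]; rewrite ffunE ?eqxx ?sqmod1 //.
by rewrite nb sqmod0.
Qed.

End Quantum.

(** * Effect of the instructions on a state *)

Definition zero_outside W (U : pred nat) (b : seq bool) : bool :=
  [forall k : 'I_W, U k || ~~ nth false b k].

Lemma zero_outside_flip W (U : pred nat) d (b : W.-tuple bool) : U d ->
  zero_outside W U (flip d b) = zero_outside W U b.
Proof.
move=> Ud; apply: eq_forallb => k; rewrite nth_flip ltn_ord /=.
by case: eqP => [->|_]; rewrite ?Ud ?addbF.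
Qed.

Lemma zero_outsideU1 W (U : pred nat) d (b : seq bool) : (d < W)%N -> ~~ U d ->
  zero_outside W U b = zero_outside W (predU1 d U) b && ~~ nth false b d.
Proof.
move=> lt_d nU; apply/forallP/andP => [h|[/forallP h nd] k].
  split; last by have := h (Ordinal lt_d); rewrite /= (negPf nU).
  by apply/forallP => k; have /orP[Uk|->] := h k; rewrite ?orbT //= Uk orbT.
have /orP[/orP[/eqP->|->]|->] := h k; rewrite ?orbT //.
by rewrite nd orbT.
Qed.

Section Tokens.

Variable R : realType.
Notation C := R[i].
Notation qstate := (qstate R).

Definition depends_on W (U : pred nat) (G : W.-tuple bool -> C) :=
  forall b b' : W.-tuple bool, (forall k, U k -> nth false b k = nth false b' k) -> G b = G b'.

Definition instr_coef (a : instr) : C := if is_coin a then rsqrt2 R else 1.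

(** The target is a factor |0>: the amplitude is a function [F] invariant under flipping the target,
    times the indicator that the target is 0. Each instruction thus reduces to a computation on a
    single qubit. *)
Lemma run_instr W (U : pred nat) (G : W.-tuple bool -> C) (Phi : qstate W) a :
  depends_on U G -> (forall b, Phi b = G b * (zero_outside W U b)%:R) ->
  (target a < W)%N -> ~~ U (target a) -> (if a is Copy i _ then U i else true) ->
  forall b, run_circuit (instr_gates a) Phi b =
    instr_coef a * (G b * (satisfied b a)%:R) * (zero_outside W (predU1 (target a) U) b)%:R.
Proof.
move=> depG PhiE lt_d nU src b; set d := target a in lt_d nU *.
pose F (b : W.-tuple bool) := G b * (zero_outside W (predU1 d U) b)%:R.
have PhiF b' : Phi b' = F b' * (~~ nth false b' d)%:R.
  by rewrite PhiE (zero_outsideU1 _ lt_d nU) /F -mulrA -natrM mulnb.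
have Fflip b' : F (flip d b') = F b'.
  rewrite /F zero_outside_flip /= ?eqxx //; congr (_ * _); apply: depG => k Uk.
  rewrite nth_flip; case: eqP => [ek|_]; last by rewrite andbF addbF.
  by rewrite -ek Uk in nU.
have nf (b' : W.-tuple bool) : nth false (flip d b') d = ~~ nth false b' d.
  by rewrite nth_flip lt_d eqxx addbT.
have H (Psi : qstate W) : (forall b, Psi b = F b * (~~ nth false b d)%:R) ->
   forall b, apply_gate Psi (Hadamard d) b = rsqrt2 R * F b.
  move=> E b'; rewrite ffunE -/(rsqrt2 R) !E Fflip nf; congr (_ * _).
  by case: (nth _ _ _); rewrite /= ?mulr1 ?mulr0 ?addr0 ?add0r ?mul1r.
suff -> : run_circuit (instr_gates a) Phi b = instr_coef a * (F b * (satisfied b a)%:R).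
  by rewrite /F; ring.
case: a @d lt_d nU src F PhiF Fflip nf H => [d'|d'|d'|s d'] d lt_d nU src F PhiF Fflip nf H;
  rewrite /instr_coef /= ?mul1r ?mulr1.
- by rewrite [LHS]PhiF.
- have P1E b' : apply_gate Phi (Hadamard d) b' = rsqrt2 R * F b' by rewrite H.
  rewrite -[LHS]/(apply_gate (run_circuit [:: Tgate d; Tgate d; Tgate d; Tgate d]
    (apply_gate Phi (Hadamard d))) (Hadamard d) b).
  move: (apply_gate Phi _) P1E => P1 P1E; set P2 := run_circuit _ P1.
  have P2E b' : P2 b' = (-1) ^+ nth false b' d * (rsqrt2 R * F b').
    rewrite /P2 /run_circuit /= !ffunE -/(tphase R); case: (nth _ _ _); last by rewrite expr0 mul1r P1E.
    by rewrite expr1 P1E -(tphase4 R) !exprS expr0; ring.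
  rewrite ffunE -/(rsqrt2 R) -/d !P2E Fflip nf.
  have := rsqrt2_sq R; case: (nth _ _ _); rewrite /= ?expr0 ?expr1 ?mulr1 ?mulr0 => hs.
    have -> : rsqrt2 R * (-1 * (-1 * (rsqrt2 R * F b)) + 1 * (rsqrt2 R * F b)) =
      rsqrt2 R * rsqrt2 R * 2 * F b by ring.
    by rewrite hs mulVf ?mul1r // pnatr_eq0.
  by ring.
- by rewrite H.
- rewrite /run_circuit /= ffunE !PhiF Fflip nf /d /=.
  by case: (nth _ _ s) => //; case: (nth _ _ _).
Qed.

(* If only bits of [U] matter and the rest is |0>, then after the instructions exactly
   the strings consistent with all of them survive. *)
Lemma run_instrs W s (U : pred nat) (G : W.-tuple bool -> C) (Phi : qstate W) :
  depends_on U G -> (forall b, Phi b = G b * (zero_outside W U b)%:R) ->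
  fresh_instrs W U s ->
  forall b, run_circuit (flatten (map instr_gates s)) Phi b =
    rsqrt2 R ^+ count is_coin s * (G b * (all (satisfied b) s)%:R) *
    (zero_outside W [pred k | U k || (k \in map target s)] b)%:R.
Proof.
elim: s U G Phi => [|a s IH] U G Phi depG PhiE /=.
  move=> _ b; rewrite expr0 mul1r mulr1 [LHS]PhiE; congr (_ * (nat_of_bool _)%:R).
  by apply: eq_forallb => k /=; rewrite in_nil orbF.
case/and4P=> lt_d nU src fr b; rewrite run_circuit_cat.
have srcd : if a is Copy i _ then i != target a else true.
  by case: a src nU {lt_d fr} => // i d /= Ui; apply: contraNneq => <-.
pose G' b := instr_coef a * (G b * (satisfied b a)%:R).
have depG' : depends_on (predU1 (target a) U) G'.
  move=> b1 b2 h; congr (_ * (_ * _)); first by apply: depG => k Uk; apply: h; rewrite /= Uk orbT.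
  case: a src {nU lt_d fr srcd G'} h => [d|d|d|i d] //= Ui h; rewrite (h d) ?eqxx //.
  by rewrite (h i) // Ui orbT.
rewrite (IH _ G' _ depG' (run_instr depG PhiE lt_d nU src) fr).
have -> : zero_outside W [pred k | U k || (k \in target a :: map target s)] b =
          zero_outside W [pred k | predU1 (target a) U k || (k \in map target s)] b.
  by apply: eq_forallb => k /=; rewrite in_cons orbCA orbA.
rewrite /G' /instr_coef -mulnb natrM; case: (is_coin a); rewrite ?add1n ?add0n ?exprS; ring.
Qed.

End Tokens.

(** * Sums over bit strings *)

Section Sums.

Variable M : nmodType.

Lemma sum_tuple_cat m k (F : seq bool -> M) :
  \sum_(b : (m + k).-tuple bool) F b =
  \sum_(u : m.-tuple bool) \sum_(v : k.-tuple bool) F (u ++ v).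
Proof.
rewrite pair_big /= (reindex (fun p : m.-tuple bool * k.-tuple bool => cat_tuple p.1 p.2)) //=.
have szt (b : (m + k).-tuple bool) : size (take m b) == m.
  by rewrite size_take_min size_tuple minnE; apply/eqP; lia.
have szd (b : (m + k).-tuple bool) : size (drop m b) == k.
  by rewrite size_drop size_tuple; apply/eqP; lia.
exists (fun b => (Tuple (szt b), Tuple (szd b))) => [[u v] _|b _].
  congr (_, _); apply: val_inj => /=.
    by rewrite take_size_cat ?size_tuple.
  by rewrite drop_size_cat ?size_tuple.
by apply: val_inj; rewrite /= cat_take_drop.
Qed.

Lemma sum_tuple_eq m k (F : seq bool -> M) : m = k ->
  \sum_(b : m.-tuple bool) F b = \sum_(b : k.-tuple bool) F b.
Proof. by move=> ->. Qed.

Lemma sum_image (I J : finType) (h : I -> J) (g : J -> M) : injective h ->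
  (forall j, g j != 0 -> exists i, j = h i) -> \sum_j g j = \sum_i g (h i).
Proof.
move=> h_inj hg; rewrite (bigID (fun j => j \in h @: setT)) /= [X in _ + X]big1 ?addr0.
  rewrite big_imset /=; last by move=> i j _ _; exact: h_inj.
  by apply: eq_bigl => i; rewrite in_setT.
move=> j nj; have [//|/hg[i ej]] := eqVneq (g j) 0.
by move: nj; rewrite ej imset_f ?in_setT // inE.
Qed.

End Sums.

(** * The state of a single block *)

Section Block.

Variables (R : realType) (q : nat) (V : pcp_verifier) (x : seq bool).

Notation n := (size x).
Hypothesis wfV : pcp_verifier_wf n V.
Hypothesis r_q : (size (pv_index V) <= q)%N.

Notation C := R[i].
Notation sqmod := (@sqmod R).
Notation qstate := (qstate R).
Notation N := (nqubits n V).
Notation S := (token_start q n V).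
Notation r := (size (pv_index V)).
Notation W := (block_width q n V).
Notation l := (flatten (pv_index V)).
Notation dataT := ((N + r).-tuple bool).
Notation idleT := ((S - (N + r)).-tuple bool).
Notation tokenT := ((W - S).-tuple bool).
Notation reads v := [seq bits_at v L | L <- pv_index V].
Notation blocks o := (reshape (shape (pv_index V)) o).

Definition block_init : qstate W := ket R [tuple nth false x i | i < W].
Definition block_state : qstate W := run_circuit (block_circuit q n V) block_init.

Definition tokens_state : qstate W :=
  run_circuit (flatten (map instr_gates (token_instrs q n V)))
    (run_circuit (pv_before V) block_init).

Definition psi : qstate N := pcp_state_before R V x.

Let N_W : (N + r < S)%N.
Proof. by rewrite /token_start; lia. Qed.

Let S_W : (S + 3 <= W)%N.
Proof. by rewrite block_widthE; lia. Qed.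

Let wf_before : all (gate_wf N) (pv_before V).
Proof. by case/and3P: wfV. Qed.

Let wf_index : all (all (fun i => i < N)%N) (pv_index V).
Proof. by case/and3P: wfV. Qed.

Let wf_after : all (gate_wf (N + r)) (pv_after V).
Proof. by case/and3P: wfV. Qed.

Lemma block_before b : run_circuit (pv_before V) block_init b =
  psi (restr N 0 b) * (zero_outside W (fun k => k < N)%N b)%:R.
Proof.
rewrite (@run_slice0 _ W N) //; last by lia.
have -> : slice N 0 block_init b =
  scale_state (zero_outside W (fun k => k < N)%N b)%:R (input_state R (pv_ancillas V) x).
  apply/ffunP => v; rewrite !ffunE -natrM mulnb; congr (nat_of_bool _)%:R.
  apply/eqP/andP => [e|[/forallP z /eqP e]].
    split.
      apply/forallP => k; case: ltnP => //= le_k.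
      have := f_equal (fun t : W.-tuple bool => nth false t k) e.
      rewrite nth_overwrite (@nth_mkt _ (nth false x)) ltn_ord /= add0n ltnNge le_k /= => ->.
      by rewrite nth_default //; move: le_k; rewrite /nqubits; lia.
    apply/eqP; apply: eq_from_nth_tuple => k lt_k.
    have := f_equal (fun t : W.-tuple bool => nth false t k) e.
    rewrite nth_overwrite !(@nth_mkt _ (nth false x)) /= add0n lt_k subn0.
    by have -> : (k < W)%N by have lt_k' : (k < N)%N := lt_k; lia.
  apply: eq_from_nth_tuple => k lt_k; rewrite nth_overwrite (@nth_mkt _ (nth false x)) lt_k /= add0n.
  case: ltnP => le_k; first by rewrite subn0 e (@nth_mkt _ (nth false x)) le_k.
  have := z (Ordinal lt_k); rewrite /= ltnNge le_k /= => /negPf ->.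
  by rewrite nth_default //; move: le_k; rewrite /nqubits; lia.
by rewrite run_circuit_scale ffunE mulrC.
Qed.

Definition data_ok (b : seq bool) : bool :=
  all (fun k => ~~ nth false b k) (iota (N + r) (S - (N + r))) &&
  (bits_at b (iota S (W - S)) ==
   block_tokens (reads b) (bits_at b (iota N r)) (pad_bits q n V b) false).

(** When the verifier is about to resume, a consistent basis state carries the amplitude of the
    state before measurement, damped uniformly by the [q] coins; all others have amplitude 0. *)
Lemma block_tokens_state b :
  tokens_state b =
  rsqrt2 R ^+ q * (psi (restr N 0 b) * (data_ok b)%:R).
Proof.
rewrite /tokens_state (@run_instrs R W _ (fun k => k < N)%N (fun b => psi (restr N 0 b)) _ _ block_before) //.
- rewrite count_coins_token_instrs // -mulrA; congr (_ * _).
  rewrite -mulrA -natrM mulnb; congr (_ * (nat_of_bool _)%:R).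
  rewrite satisfied_tokens // andbC; congr (_ && _).
  apply/forallP/allP => [h k|h k].
    rewrite mem_iota => hk; have lt_k : (k < W)%N by lia.
    by have := h (Ordinal lt_k); rewrite /= mem_token_targets //; lia.
  rewrite /= mem_token_targets //; have := h k; rewrite mem_iota.
  by case: (nth _ _ _); rewrite ?orbT //= => h'; apply/orP; left; apply/negPn/negP; lia.
- move=> b1 b2 h; congr (psi _); apply: eq_from_nth_tuple => k lt_k.
  by rewrite !nth_restr lt_k add0n h.
- exact: fresh_token_instrs.
Qed.

Definition before_accept : qstate W :=
  run_circuit (pv_before V ++ flatten (map instr_gates (token_instrs q n V)) ++ pv_after V) block_init.

(** The state inside [pcp_accept_prob] for the measurement outcome [o], with the guess [z] in place
    of the bits of a proof. *)
Definition after_state (o z : seq bool) : qstate (N + r) :=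
  run_circuit (pv_after V) (append_bits r (project l o psi) z).

Definition idle_zero (b : seq bool) := all (fun k => ~~ nth false b k) (iota (N + r) (S - (N + r))).
Definition token_bits (b : seq bool) := bits_at b (iota S (W - S)).

Lemma bits_at_restr m k s (L : seq nat) : all (fun i => i < m)%N L ->
  bits_at (restr m k s) L = [seq nth false s (k + i) | i <- L].
Proof. by move=> /allP h; apply/eq_in_map => i /h lt_i; rewrite nth_restr lt_i. Qed.

Lemma slice_before_accept (b : seq bool) (v : dataT) :
  slice (N + r) 0 tokens_state b v =
  rsqrt2 R ^+ q * (psi (restr N 0 v) *
   (idle_zero b && (token_bits b == block_tokens [seq bits_at v l | l <- pv_index V]
      (drop N v) (pad_bits q n V b) false))%:R).
Proof.
rewrite ffunE block_tokens_state; set b' := overwrite _ _ _ _ _.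
have lo k : (k < N + r)%N -> nth false b' k = nth false v k.
  move=> lt_k; rewrite nth_overwrite /= add0n lt_k subn0.
  by have -> : (k < W)%N by lia.
have hi k : (N + r <= k < W)%N -> nth false b' k = nth false b k.
  by case/andP=> le_k lt_k; rewrite nth_overwrite lt_k /= add0n ltnNge le_k.
have -> : restr N 0 b' = restr N 0 v.
  by apply: eq_from_nth_tuple => k lt_k; rewrite !nth_restr lt_k lo //; lia.
suff -> : data_ok b' = idle_zero b && (token_bits b == block_tokens [seq bits_at v l | l <- pv_index V]
  (drop N v) (pad_bits q n V b) false) by [].
rewrite /data_ok; congr andb; last congr eq_op.
- by apply: eq_in_all => k; rewrite mem_iota => hk; rewrite hi //; lia.
- by apply/eq_in_map => k; rewrite mem_iota => hk; rewrite hi //; lia.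
- congr block_tokens.
  + apply/eq_in_map => L /(allP wf_index)/allP LN; apply/eq_in_map => i /LN lt_i.
    by rewrite lo //; lia.
  + apply: (@eq_from_nth _ false); first by rewrite size_map size_iota size_drop size_tuple; lia.
    move=> k; rewrite size_map size_iota => lt_k.
    by rewrite (nth_map 0%N) ?size_iota // nth_iota // nth_drop lo //; lia.
  + apply/eq_in_map => i; rewrite mem_iota => hi'; rewrite hi //.
    by rewrite block_widthE /pad_start locs_afterE; lia.
Qed.

Lemma before_acceptE b : before_accept b =
  run_circuit (pv_after V) (slice (N + r) 0 tokens_state b) (restr (N + r) 0 b).
Proof.
by rewrite /before_accept !run_circuit_cat (@run_slice0 _ W (N + r)) //; lia.
Qed.

Lemma size_os_eq (os : seq (seq bool)) : shape os = shape (pv_index V) -> size os = r.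
Proof. by move=> e; rewrite -(size_map size) -/(shape os) e size_map. Qed.

Lemma nth_pad_tokens p s i : (i < size p)%N -> nth false (pad_tokens p ++ s) (3 * i + 2) = nth false p i.
Proof.
elim: p i => // c p IH [|i] // lt_i.
have -> : (3 * i.+1 + 2 = (3 * i + 2).+3)%N; [by lia | exact: IH].
Qed.

Lemma size_read_tokens os z : size z = size os ->
  size (read_tokens os z) = sumn [seq (k.*2 + 3)%N | k <- shape os].
Proof.
elim: os z => [|o os IH] [|c z] //= [] /IH e.
by rewrite size_cat size_index_tokens /= e; lia.
Qed.

Lemma pad_bits_tokens (b : seq bool) os z p a :
  shape os = shape (pv_index V) -> size z = r -> size p = (q - r)%N ->
  token_bits b = block_tokens os z p a -> pad_bits q n V b = p.
Proof.
move=> sh_os sz_z sz_p tb.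
have sz_os : size os = r by rewrite -(size_map size) -/(shape os) sh_os size_map.
have sz_rd : size (read_tokens os z) = tokens_size (pv_index V).
  by rewrite size_read_tokens ?sz_os // sh_os /tokens_size /shape -map_comp.
apply: (@eq_from_nth _ false); rewrite size_map size_iota ?sz_p // => i lt_i.
rewrite (nth_map 0%N) ?size_iota // nth_iota // add0n /pad_start locs_afterE.
rewrite -(@nth_pad_tokens p [:: true; true; a]) ?sz_p //.
have -> : nth false (pad_tokens p ++ [:: true; true; a]) (3 * i + 2) =
  nth false (token_bits b) (tokens_size (pv_index V) + (3 * i + 2)).
  by rewrite tb /block_tokens [RHS]nth_cat sz_rd ltnNge leq_addr /= addKn.
rewrite /token_bits (nth_map 0%N) ?size_iota ?nth_iota; rewrite ?block_widthE; try lia.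
by congr nth; lia.
Qed.

(** The remaining gates of the verifier leave the query register alone. Fixing the tokens there
    therefore projects the verifier on the outcome and the guess that they record, before these
    gates are applied. *)
Lemma before_accept_tokens (b : W.-tuple bool) os z p :
  shape os = shape (pv_index V) -> size z = r -> size p = (q - r)%N ->
  idle_zero b -> token_bits b = block_tokens os z p false ->
  before_accept b = rsqrt2 R ^+ q * after_state (flatten os) z (restr (N + r) 0 b).
Proof.
move=> sh_os sz_z sz_p ib tb; rewrite before_acceptE.
suff -> : slice (N + r) 0 tokens_state b =
  scale_state (rsqrt2 R ^+ q) (append_bits r (project l (flatten os) psi) z).
  by rewrite run_circuit_scale ffunE.
apply/ffunP => v; rewrite slice_before_accept ffunE; congr (_ * _).
rewrite ib tb [RHS]ffunE ffunE.
have -> : [tuple nth false v i | i < N] = restr N 0 v by [].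
have -> : bits_at (restr N 0 v) l = flatten (reads v).
  rewrite bits_at_restr; first by rewrite map_flatten; congr flatten.
  by apply/allP => i /flattenP[L /(allP wf_index)/allP LN /LN].
have sh_v : shape (reads v) = shape (pv_index V).
  by rewrite /shape -map_comp; apply: eq_map => L /=; rewrite size_map.
have sz_d : size (drop N v) = r by rewrite size_drop size_tuple; lia.
have -> : (block_tokens os z p false == block_tokens (reads v) (drop N v)
     (pad_bits q n V b) false) = (drop N v == z) && (flatten (reads v) == flatten os).
  apply/eqP/andP.
    have e1 : map size os = map size (reads v) by rewrite -/(shape _) sh_os -sh_v.
    have e2 : size (drop N v) = size (reads v) by rewrite sz_d size_map.
    have e3 : size p = size (pad_bits q n V b) by rewrite sz_p size_map size_iota.
    case/(block_tokens_inj e1 (etrans sz_z (esym (size_os_eq sh_os))) e2 e3) => <- <- _ _.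
    by rewrite !eqxx.
  case=> /eqP ez /eqP eo.
  have eos : reads v = os.
    by rewrite -[LHS]flattenK -[RHS]flattenK eo sh_v sh_os.
  by rewrite ez eos (pad_bits_tokens sh_os sz_z sz_p tb).
by case: (drop N v == z); case: (_ == flatten os); rewrite /= ?mulr1 ?mulr0.
Qed.

(** The last clause keeps a basis state of nonzero amplitude from which the addresses were copied:
    the range hypothesis on the verifier speaks of such states. *)
Lemma before_accept_support (b : W.-tuple bool) : before_accept b != 0 ->
  idle_zero b /\ exists os z p, [/\ shape os = shape (pv_index V), size z = r, size p = (q - r)%N,
    token_bits b = block_tokens os z p false &
    exists v : N.-tuple bool, psi v != 0 /\ os = reads v].
Proof.
rewrite before_acceptE; set Psi := slice _ _ _ _ => nz.
have [v nzv] : exists v, Psi v != 0.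
  apply/existsP; apply: contraNT nz => /existsPn nv.
  (* Linearity in the form at hand: a vanishing slice is 0 times itself and stays so under the
     gates. *)
  have -> : Psi = scale_state 0 Psi.
    by apply/ffunP => v; rewrite [RHS]ffunE mul0r; apply/eqP; have := nv v; rewrite negbK.
  by rewrite run_circuit_scale ffunE mul0r.
rewrite /Psi slice_before_accept in nzv.
have := nzv; rewrite !mulf_eq0 !negb_or => /and3P[_ nz_psi].
rewrite pnatr_eq0 eqb0 negbK => /andP[ib /eqP tb]; split=> //.
exists (reads v), (drop N v), (pad_bits q n V b); split=> //.
- by rewrite /shape -map_comp; apply: eq_map => L /=; rewrite size_map.
- by rewrite size_drop size_tuple; lia.
- by rewrite size_map size_iota.
exists (restr N 0 v); split=> //.
by apply/eq_in_map => L /(allP wf_index) LN; rewrite bits_at_restr.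
Qed.

Lemma last_block_tokens os z p a : last false (block_tokens os z p a) = a.
Proof. by rewrite /block_tokens catA last_cat. Qed.

Lemma token_bitsE (b : seq bool) :
  token_bits b = rcons (bits_at b (iota S (W - S).-1)) (nth false b W.-1).
Proof.
rewrite /token_bits; have {1}-> : (W - S = (W - S).-1 + 1)%N by lia.
by rewrite iotaD bits_at_cat /= cats1; congr (rcons _ (nth _ _ _)); lia.
Qed.

Lemma end_startE : (end_start q n V).+2 = W.-1.
Proof. by rewrite /block_width; lia. Qed.

Lemma block_stateE (b : W.-tuple bool) :
  block_state b = if nth false b 0 then before_accept (flip W.-1 b) else before_accept b.
Proof.
have -> : block_state = run_circuit [:: CNOT 0 (end_start q n V).+2] before_accept.
  by rewrite -run_circuit_cat -!catA.
by rewrite /run_circuit /= ffunE end_startE.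
Qed.

Lemma idle_zero_flip (b : W.-tuple bool) : idle_zero (flip W.-1 b) = idle_zero b.
Proof.
apply: eq_in_all => k; rewrite mem_iota => hk; rewrite nth_flip.
by have -> : (k == W.-1) = false by [lia]; rewrite andbF addbF.
Qed.

Lemma restr_flip (b : W.-tuple bool) : restr (N + r) 0 (flip W.-1 b) = restr (N + r) 0 b.
Proof.
apply: eq_from_nth_tuple => k lt_k; rewrite !nth_restr lt_k nth_flip add0n.
by have -> : (k == W.-1) = false by [lia]; rewrite andbF addbF.
Qed.

Lemma token_bits_flip (b : W.-tuple bool) os z p a :
  token_bits b = block_tokens os z p a <-> token_bits (flip W.-1 b) = block_tokens os z p (~~ a).
Proof.
have E c : block_tokens os z p c = rcons (read_tokens os z ++ pad_tokens p ++ [:: true; true]) c.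
  by rewrite /block_tokens !rcons_cat.
have pre : bits_at (flip W.-1 b) (iota S (W - S).-1) = bits_at b (iota S (W - S).-1).
  apply/eq_in_map => k; rewrite mem_iota => hk; rewrite nth_flip.
  by have -> : (k == W.-1) = false by [lia]; rewrite andbF addbF.
have lst : nth false (flip W.-1 b) W.-1 = ~~ nth false b W.-1.
  by rewrite nth_flip eqxx; have -> : (W.-1 < W)%N by [lia]; rewrite addbT.
rewrite !token_bitsE !E pre lst; split=> /rcons_inj[-> ea]; last by rewrite (negb_inj ea).
by rewrite ea.
Qed.

Lemma block_state_support (b : W.-tuple bool) : block_state b != 0 ->
  idle_zero b /\ exists os z p, [/\ shape os = shape (pv_index V), size z = r, size p = (q - r)%N,
    token_bits b = block_tokens os z p (nth false b 0) &
    exists v : N.-tuple bool, psi v != 0 /\ os = reads v].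
Proof.
rewrite block_stateE; case: (nth _ _ _) => /before_accept_support[]; last by [].
rewrite idle_zero_flip => ib [os [z [p [h1 h2 h3 h4 h5]]]]; split=> //.
by exists os, z, p; split=> //; apply/token_bits_flip.
Qed.

(** The last token bit is a copy of the first qubit, so a string on which the two differ has
    amplitude 0. *)
Lemma block_state_tokens (b : W.-tuple bool) os z p a :
  shape os = shape (pv_index V) -> size z = r -> size p = (q - r)%N ->
  idle_zero b -> token_bits b = block_tokens os z p a ->
  block_state b = rsqrt2 R ^+ q * after_state (flatten os) z (restr (N + r) 0 b) *
                  (a == nth false b 0)%:R.
Proof.
move=> h1 h2 h3 ib tb.
have [ea|na] := boolP (a == _); last first.
  rewrite mulr0; apply/eqP; apply: contraNT na => /block_state_support[_ [os' [z' [p' [_ _ _ tb' _]]]]].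
  by rewrite -(last_block_tokens os z p a) -tb tb' last_block_tokens.
rewrite mulr1 block_stateE -(eqP ea); case: a {ea} tb => tb.
  rewrite (before_accept_tokens h1 h2 h3) ?idle_zero_flip ?restr_flip //.
  exact: (proj1 (token_bits_flip b os z p true) tb).
exact: (before_accept_tokens h1 h2 h3 ib tb).
Qed.

Lemma wf_block_circuit : all (gate_wf W) (block_circuit q n V).
Proof.
have fresh := fresh_token_instrs r_q wf_index.
have wf_mono m G : (m <= W)%N -> all (gate_wf m) G -> all (gate_wf W) G.
  move=> le_m; apply: sub_all => -[i|i|i j] /=; lia.
have w1 : all (gate_wf W) (pv_before V) by apply: wf_mono wf_before; lia.
have w2 : all (gate_wf W) (pv_after V) by apply: wf_mono wf_after; lia.
rewrite /block_circuit !all_cat w1 w2 end_startE /=.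
apply/andP; split; last by rewrite andbT; lia.
suff gen (U : pred nat) : fresh_instrs W U (token_instrs q n V) -> (forall k, U k -> (k < W)%N) ->
    all (gate_wf W) (flatten (map instr_gates (token_instrs q n V))).
  by apply: gen fresh _ => k; lia.
elim: (token_instrs q n V) U => //= a s IH U /and4P[lt_d nU src fr] UW.
have UW' k : predU1 (target a) U k -> (k < W)%N.
  by rewrite /=; case/orP=> [/eqP->|] //; exact: UW.
rewrite all_cat (IH _ fr UW') andbT.
case: a lt_d nU src {fr UW'} => [d|d|d|i d] //= lt_d nU src; rewrite ?lt_d //= UW //=.
by rewrite andbT; apply: contraNneq nU => <-.
Qed.

Lemma norm2_block_state : norm2 block_state = 1.
Proof. by rewrite norm2_run ?norm2_ket // wf_block_circuit. Qed.

Variables (Q : nat) (y : seq bool).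
Hypothesis Q_gt0 : (0 < Q)%N.

(** A single sample checked on its own: as [Q] is positive, the counter becomes nonempty exactly
    when the sample agrees with [y] and accepts. *)
Definition success (t : seq bool) : bool :=
  (0 < size (pos (check_run Q y t (CheckState y [::] [::] [::]))))%N.

Lemma success_tokens os z p a : size z = size os ->
  success (block_tokens os z p a) = sample_ok y os z p a.
Proof.
move=> sz; rewrite /success -[block_tokens _ _ _ _]cats0 check_run_block //=.
by case: (sample_ok _ _ _ _ _) => //=; rewrite cats0 size_nseq.
Qed.

Lemma size_block_tokens os z p a :
  shape os = shape (pv_index V) -> size z = r -> size p = (q - r)%N ->
  size (block_tokens os z p a) = (W - S)%N.
Proof.
move=> h1 h2 h3; rewrite !size_cat size_pad_tokens h3 size_read_tokens ?h2 ?(size_os_eq h1) //.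
rewrite h1 /shape -map_comp -/(tokens_size (pv_index V)) block_widthE /=; lia.
Qed.

(** For each outcome [o], agreement with [y] singles out one guess and one padding, and acceptance
    fixes the last bit. What remains is the sum defining the acceptance probability, each term
    weighted by 2^-q from the coins. *)
Lemma success_prob :
  \sum_(b : W.-tuple bool) (success (token_bits b))%:R * sqmod (block_state b) =
  (2^-1) ^+ q * pcp_accept_prob R V x y.
Proof.
pose F s := (success (token_bits (restr W 0 s)))%:R * sqmod (block_state (restr W 0 s)).
have -> : \sum_(b : W.-tuple bool) (success (token_bits b))%:R * sqmod (block_state b) =
  \sum_(b : W.-tuple bool) F b by apply: eq_bigr => b _; rewrite /F restr_id.
have eW : W = (N + r + (S - (N + r) + (W - S)))%N by lia.
rewrite (sum_tuple_eq F eW) sum_tuple_cat.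
have sz_v (v : dataT) : size v = (N + r)%N := size_tuple v.
pose u0 := nseq (S - (N + r)) false.
(* The support of the query register, parametrised by outcome, guess, padding and accept bit. *)
pose h (i : (size l).-tuple bool * r.-tuple bool * ((q - r).-tuple bool * bool)) : (W - S).-tuple bool :=
  restr (W - S) 0 (block_tokens (blocks i.1.1) i.1.2 i.2.1 i.2.2).
have sh_o (o : (size l).-tuple bool) : shape (blocks o) = shape (pv_index V).
  by rewrite reshapeKl // size_tuple size_flatten.
have sz_bt (o : (size l).-tuple bool) (z : r.-tuple bool) (p : (q - r).-tuple bool) c :
   size (block_tokens (blocks o) z p c) = (W - S)%N.
  by rewrite size_block_tokens ?size_tuple.
have hE i : h i = block_tokens (blocks i.1.1) i.1.2 i.2.1 i.2.2 :> seq bool.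
  apply: (@eq_from_nth _ false); rewrite size_tuple ?sz_bt // => k lt_k.
  by rewrite nth_restr lt_k.
have h_inj : injective h.
  move=> [[o1 z1] [p1 a1]] [[o2 z2] [p2 a2]] /(f_equal (@tval _ _)); rewrite !hE /=.
  case/block_tokens_inj; rewrite ?size_tuple // -?/(shape _) ?sh_o //; try by rewrite size_reshape size_map.
  move=> eo ez ep ea; congr (_, _, (_, _)) => //; try exact: val_inj.
  apply: val_inj; rewrite /= -[LHS](@reshapeKr _ (shape (pv_index V))) ?eo ?reshapeKr //;
    by rewrite size_tuple size_flatten.
pose bt v u t := restr W 0 (v ++ (u ++ t)).
have nth_bt (v : dataT) (u : idleT) (t : tokenT) k :
    nth false (bt v u t) k = (k < W)%N && nth false (v ++ (u ++ t)) k by rewrite nth_restr.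
have bt_idle (v : dataT) (u : idleT) (t : tokenT) : idle_zero (bt v u t) = (u == u0 :> seq bool).
  rewrite /idle_zero; apply/allP/eqP => [hk|->].
    apply: (@eq_from_nth _ false); rewrite size_tuple ?size_nseq // => k lt_k.
    rewrite nth_nseq lt_k; have := hk (N + r + k)%N; rewrite mem_iota.
    have lt_W : (N + r + k < W)%N by lia.
    rewrite nth_bt lt_W nth_cat sz_v ifF; last by lia.
    rewrite addKn nth_cat size_tuple lt_k => hk'.
    by apply/negbTE/hk'; lia.
  move=> k; rewrite mem_iota => hk; rewrite nth_bt nth_cat sz_v ifF; last by lia.
  by rewrite nth_cat size_nseq ifT ?nth_nseq ?if_same ?andbF //; lia.
have bt_tok (v : dataT) (u : idleT) (t : tokenT) : token_bits (bt v u t) = t.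
  apply: (@eq_from_nth _ false); rewrite size_map size_iota ?size_tuple // => k lt_k.
  rewrite (nth_map 0%N) ?size_iota // nth_iota // nth_bt nth_cat sz_v ifF; last by lia.
  rewrite nth_cat size_tuple ifF; last by lia.
  have -> : (S + k < W)%N by lia.
  by congr nth; lia.
have bt_restr (v : dataT) (u : idleT) (t : tokenT) : restr (N + r) 0 (bt v u t) = v.
  apply: eq_from_nth_tuple => k lt_k; rewrite nth_restr lt_k nth_bt add0n nth_cat sz_v lt_k.
  by have -> : (k < W)%N by lia.
have bt_0 (v : dataT) (u : idleT) (t : tokenT) : idle_zero (bt v u t) -> nth false (bt v u t) 0 = nth false v 0.
  (* Without input, ancillas and reads, the first qubit of the block is an idle one. It is |0>, in
     accordance with the default value of [nth] on the empty tuple [v]. *)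
  move=> /allP hz; case: (posnP (N + r)) => [e0|gt0].
    rewrite [RHS]nth_default; last by rewrite sz_v e0.
    by apply/negbTE/hz; rewrite mem_iota; lia.
  by rewrite nth_bt nth_cat sz_v gt0; have -> : (0 < W)%N by lia.
pose K (o : seq bool) z (v : dataT) := sqmod (after_state o z v).
have FE v u t : F (v ++ (u ++ t)) = (success (token_bits (bt v u t)))%:R * sqmod (block_state (bt v u t)) by [].
transitivity (\sum_(v : dataT) \sum_(i : (size l).-tuple bool * r.-tuple bool * ((q - r).-tuple bool * bool))
   ((sample_ok y (blocks i.1.1) i.1.2 i.2.1 i.2.2) && (i.2.2 == nth false v 0))%:R *
   ((2^-1) ^+ q * K i.1.1 i.1.2 v)).
  apply: eq_bigr => v _; rewrite (sum_tuple_cat _ _ (fun s => F (v ++ s))).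
  (* Only the zero string occurs on the idle qubits. *)
  rewrite (bigD1 (nseq_tuple (S - (N + r)) false)) //= [X in _ + X]big1 ?addr0 => [|u nu]; last first.
    apply: big1 => t _; rewrite FE; have [->|/block_state_support[iz _]] := eqVneq (block_state (bt v u t)) 0.
      by rewrite sqmod0 mulr0.
    by rewrite bt_idle in iz; rewrite -(inj_eq val_inj) /= iz in nu.
  have iz (t : tokenT) : idle_zero (bt v u0 t) by rewrite (bt_idle v (nseq_tuple _ false)).
  rewrite (@sum_image _ _ _ h (fun t : (W - S).-tuple bool => F (v ++ (u0 ++ t)))) //; last first.
    move=> t; rewrite FE mulf_eq0 negb_or => /andP[_ nz].
    have /block_state_support[_ [os [z [p [h1 h2 h3 h4 _]]]]] : block_state (bt v u0 t) != 0.
      by apply: contraNneq nz => ->; rewrite sqmod0.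
    rewrite (bt_tok v (nseq_tuple _ false)) in h4.
    have so : size (flatten os) == size l by rewrite !size_flatten h1.
    have sz : size z == r by rewrite h2.
    have sp : size p == (q - r)%N by rewrite h3.
    exists (Tuple so, Tuple sz, (Tuple sp, nth false (bt v u0 t) 0)); apply: val_inj.
    by rewrite [LHS]h4 [RHS]hE [reshape _ _]/= -h1 flattenK.
  apply: eq_bigr => -[[o z] [p c]] _ /=; rewrite FE.
  have tb : token_bits (bt v u0 (h (o, z, (p, c)))) = block_tokens (blocks o) z p c.
    by rewrite (bt_tok v (nseq_tuple _ false)) hE.
  rewrite tb success_tokens; last by rewrite size_tuple size_reshape size_map.
  rewrite (block_state_tokens (sh_o o) _ _ (iz _) tb) ?size_tuple //.
  rewrite bt_0 // (bt_restr v (nseq_tuple _ false)) !sqmodM sqmodX sqmod_rsqrt2 sqmod_nat.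
  rewrite reshapeKr ?size_tuple ?size_flatten // -mulnb natrM /K; ring.
rewrite exchange_big /= /pcp_accept_prob mulr_sumr.
rewrite -(pair_bigA _ (fun (oz : (size l).-tuple bool * r.-tuple bool) (pc : (q - r).-tuple bool * bool) => \sum_(v : dataT)
  ((sample_ok y (blocks oz.1) oz.2 pc.1 pc.2) && (pc.2 == nth false v 0))%:R *
   ((2^-1) ^+ q * K oz.1 oz.2 v))) /=.
rewrite -(pair_bigA _ (fun (o : (size l).-tuple bool) (z : r.-tuple bool) => \sum_(pc : (q - r).-tuple bool * bool) \sum_(v : dataT)
  ((sample_ok y (blocks o) z pc.1 pc.2) && (pc.2 == nth false v 0))%:R *
   ((2^-1) ^+ q * K o z v))) /=.
apply: eq_bigr => o _.
set zo := bits_at y (positions V o).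
have zoE : zo = [seq nth false y (nat_of_bits s) | s <- reshape (shape (pv_index V)) o].
  by rewrite /zo /bits_at /positions -map_comp.
have sz_zo : size zo == r by rewrite zoE size_map size_reshape size_map.
(* Agreement with [y] leaves a single guess, the bits of [y] at the measured positions. *)
rewrite (bigD1 (Tuple sz_zo)) //= [X in _ + X]big1 ?addr0 => [|z nz]; last first.
  apply: big1 => -[p c] _; apply: big1 => v _; rewrite /sample_ok -zoE /=.
  by rewrite -(inj_eq val_inj) /= in nz; rewrite (negPf nz) andbF mul0r.
rewrite -(pair_bigA _ (fun (p : (q - r).-tuple bool) (c : bool) => \sum_(v : dataT)
  ((sample_ok y (blocks o) zo p c) && (c == nth false v 0))%:R *
   ((2^-1) ^+ q * K o zo v))) /=.
have all_p0 (p : (q - r).-tuple bool) : all (pred1 (nth false y 0)) p = (p == nseq_tuple (q - r) (nth false y 0)).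
  rewrite -(inj_eq val_inj) /=; apply/idP/eqP => [/all_pred1P ->|->]; first by rewrite size_tuple.
  by apply/all_pred1P; rewrite size_nseq.
(* Likewise a single padding, all of whose bits are the bit 0 of [y]. *)
rewrite (bigD1 (nseq_tuple (q - r) (nth false y 0))) //= [X in _ + X]big1 ?addr0 => [|p np]; last first.
  apply: big1 => c _; apply: big1 => v _; rewrite /sample_ok all_p0 (negPf np).
  by rewrite !andbF mul0r.
rewrite big_bool /= [X in _ + X]big1 ?addr0 => [|v _]; last by rewrite /sample_ok /= mul0r.
rewrite /prob_first_one mulr_sumr [RHS]big_mkcond /=; apply: eq_bigr => v _.
rewrite /sample_ok -zoE eqxx all_p0 eqxx /=.
by case: (nth false v 0); rewrite ?mul1r ?mul0r.
Qed.

End Block.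

Lemma addn_mul_inj w i j s t : (s < w)%N -> (t < w)%N -> (i * w + s = j * w + t)%N -> i = j.
Proof.
move=> lt_s lt_t e; have w0 : (0 < w)%N by lia.
by have := f_equal (divn^~ w) e; rewrite !divnMDl // !divn_small // !addn0.
Qed.

Lemma sum_blocks (M : nmodType) m w (H : {ffun 'I_m -> w.-tuple bool} -> M) : (0 < w)%N ->
  \sum_(c : (m * w).-tuple bool) H [ffun i : 'I_m => restr w (i * w) c] = \sum_f H f.
Proof.
move=> w0; pose h (c : (m * w).-tuple bool) := [ffun i : 'I_m => restr w (i * w) c].
have h_inj : injective h.
  move=> c1 c2 e; apply: eq_from_nth_tuple => k lt_k.
  have lt_d : (k %/ w < m)%N by rewrite ltn_divLR.
  have := f_equal (fun g : {ffun 'I_m -> w.-tuple bool} => nth false (g (Ordinal lt_d)) (k %% w)) e.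
  by rewrite !ffunE !nth_restr ltn_mod w0 /= -divn_eq.
have h_bij : bijective h.
  by apply: inj_card_bij h_inj _; rewrite card_ffun !card_tuple card_bool card_ord mulnC expnM.
by rewrite (reindex h) //; exact: onW_bij.
Qed.

(** * The circuit with all its blocks *)

Section Global.

Variables (R : realType) (q M : nat) (V : pcp_verifier) (x : seq bool).

Notation n := (size x).
Hypothesis wfV : pcp_verifier_wf n V.
Hypothesis r_q : (size (pv_index V) <= q)%N.

Notation C := R[i].
Notation sqmod := (@sqmod R).
Notation qstate := (qstate R).
Notation W := (block_width q n V).
Notation T := (n + (2 + M * W))%N.
Notation base := (block_base q n V).
Notation blk i b := (restr W (base i) b).
Notation bstate := (block_state R q V x).

Let W_gt0 : (0 < W)%N.
Proof. by rewrite /block_width; lia. Qed.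

(** Beyond the end of [x] the default value of [nth] makes this say that the constant qubit and the
    answer qubit are 0. *)
Definition head_ok (b : seq bool) := all (fun k => nth false b k == nth false x k) (iota 0 (n + 2)).

Definition zero_block : qstate W := ket R (nseq_tuple W false).

(** A product over the blocks, which is the independence of the samples: the input is a basis state,
    so copying it into a block entangles nothing. *)
Definition partial_state j : qstate T :=
  [ffun b : T.-tuple bool => (head_ok b)%:R *
    \prod_(i < M) (if (i < j)%N then bstate else zero_block) (blk i b)].

Lemma base_le j : (j < M)%N -> (base j + W <= T)%N.
Proof.
move=> lt_j; have : ((j + 1) * W <= M * W)%N by rewrite leq_mul2r addn1 lt_j orbT.
by rewrite mulnDl /block_base; lia.
Qed.

Lemma in_block k : (n + 2 <= k < T)%N -> exists i : 'I_M, exists2 t, (t < W)%N & k = (base i + t)%N.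
Proof.
move=> /andP[le_k lt_k]; have lt_d : ((k - (n + 2)) %/ W < M)%N by rewrite ltn_divLR //; lia.
exists (Ordinal lt_d), ((k - (n + 2)) %% W)%N; first by rewrite ltn_mod.
by rewrite /block_base /= -addnA -divn_eq; lia.
Qed.

Lemma partial_state0 : input_state R (2 + M * W) x = partial_state 0.
Proof.
apply/ffunP => b; rewrite !ffunE.
have -> : \prod_(i < M) (if (i < 0)%N then bstate else zero_block) (blk i b) =
  ([forall i : 'I_M, blk i b == nseq_tuple W false])%:R :> C.
  have [/forallP h|/forallPn[i ni]] := boolP [forall i : 'I_M, blk i b == nseq_tuple W false].
    by apply: big1 => i _; rewrite ffunE h.
  by rewrite (bigD1 i) //= ffunE (negPf ni) mul0r.
rewrite -natrM mulnb; congr (nat_of_bool _)%:R.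
apply/eqP/andP => [->|[/allP h /forallP z]].
  split.
    apply/allP => k; rewrite mem_iota => hk; rewrite (@nth_mkt _ (nth false x)).
    by have -> : (k < T)%N by lia.
  apply/forallP => i; apply/eqP; apply: eq_from_nth_tuple => k lt_k.
  rewrite nth_restr (@nth_mkt _ (nth false x)) lt_k /= nth_nseq if_same [nth _ x _]nth_default ?andbF //.
  by rewrite /block_base; lia.
apply: eq_from_nth_tuple => k lt_k; rewrite (@nth_mkt _ (nth false x)) lt_k /=.
case: (ltnP k (n + 2)) => le_k; first by apply/eqP/h; rewrite mem_iota.
have [|i [t lt_t ek]] := @in_block k; first by rewrite le_k lt_k.
rewrite [RHS]nth_default; last by lia.
have := f_equal (fun u : W.-tuple bool => nth false u t) (eqP (z i)).
by rewrite nth_restr lt_t -ek /= nth_nseq if_same.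
Qed.

Lemma blk_other (b b' : T.-tuple bool) i j : i != j ->
  (forall k, (base j <= k < base j + W)%N = false -> nth false b' k = nth false b k) ->
  blk i b' = blk i b.
Proof.
move=> ij h; apply: eq_from_nth_tuple => k lt_k; rewrite !nth_restr lt_k h //.
apply/negP => hk; case/eqP: ij.
apply: (@addn_mul_inj W i j k (base i + k - base j)) => //; first by lia.
by move: hk; rewrite /block_base; lia.
Qed.

Lemma head_ok_other (b b' : T.-tuple bool) j :
  (forall k, (base j <= k < base j + W)%N = false -> nth false b' k = nth false b k) ->
  head_ok b' = head_ok b.
Proof.
move=> h; apply: eq_in_all => k; rewrite mem_iota => hk; rewrite h //.
by rewrite /block_base; lia.
Qed.

Definition rest_amp j (b : T.-tuple bool) : C := (head_ok b)%:R *
  \prod_(i < M | i != j :> nat) (if (i < j)%N then bstate else zero_block) (blk i b).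

Lemma rest_amp_other j (b b' : T.-tuple bool) :
  (forall k, (base j <= k < base j + W)%N = false -> nth false b' k = nth false b k) ->
  rest_amp j b' = rest_amp j b.
Proof.
move=> h; rewrite /rest_amp (head_ok_other h); congr (_ * _).
by apply: eq_bigr => i ij; rewrite (blk_other ij h).
Qed.

Lemma partial_stateE j (b : T.-tuple bool) : (j < M)%N ->
  partial_state j b = rest_amp j b * zero_block (blk j b) /\
  partial_state j.+1 b = rest_amp j b * bstate (blk j b).
Proof.
move=> lt_j; split; rewrite ffunE (bigD1 (Ordinal lt_j)) //= ?ltnn ?ltnSn /rest_amp -mulrA;
  congr (_ * _); rewrite mulrC; congr (_ * _).
apply: eq_big => i; first by rewrite -val_eqE.
by rewrite -val_eqE /= => ij; rewrite ltnS leq_eqVlt (negPf ij).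
Qed.

Definition prefix_block m : W.-tuple bool := [tuple nth false (take m x) i | i < W].

(** On strings whose head is [x], the CNOT from the input qubit [m] flips its target exactly when
    that bit of [x] is 1, so the block stays a basis state holding a prefix of [x]. *)
Lemma run_copy_input j m (b : T.-tuple bool) : (j < M)%N -> (m <= n)%N ->
  run_circuit [seq CNOT i (base j + i) | i <- iota 0 m] (partial_state j) b =
  rest_amp j b * (blk j b == prefix_block m)%:R.
Proof.
move=> lt_j; have le_T := base_le lt_j.
have n_W : (n <= W)%N by rewrite /block_width /end_start /pad_start locs_afterE /token_start /nqubits; lia.
elim: m b => [|m IH] b le_m.
  rewrite [LHS](proj1 (partial_stateE _ lt_j)) ffunE; congr (_ * (_ == _)%:R).
  apply: eq_from_nth_tuple => k lt_k; rewrite (@nth_mkt _ (nth false (take 0 x))) lt_k.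
  by rewrite take0 nth_nil nth_nseq if_same.
have -> : iota 0 m.+1 = iota 0 m ++ [:: m] by rewrite -addn1 iotaD.
rewrite map_cat run_circuit_cat.
rewrite [LHS]ffunE.
have out k : (base j <= k < base j + W)%N = false ->
    nth false (flip (base j + m) b) k = nth false b k.
  move=> hk; rewrite nth_flip; case: eqP => [ek|_]; last by rewrite andbF addbF.
  by move: hk; rewrite ek; lia.
rewrite !IH ?(rest_amp_other out); try by lia.
have [hb|hb] := boolP (head_ok b); last by rewrite /rest_amp (negPf hb) !mul0r if_same.
have -> : nth false b m = nth false x m.
  by apply/eqP; move/allP: hb; apply; rewrite mem_iota; lia.
have px k : nth false (prefix_block m.+1) k = nth false (prefix_block m) k (+) ((k == m) && nth false x m).
  rewrite !(@nth_mkt _ (nth false (take _ x))); case: (ltnP k W) => lt_k /=; last by case: eqP => // ek; lia.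
  have sz : size (take m x) = m by rewrite size_takel // ltnW.
  rewrite (take_nth false le_m) nth_rcons sz; case: (ltngtP k m) => [lt|gt|->]; rewrite ?addbF //.
    by rewrite [nth _ (take _ _) _]nth_default // sz ltnW.
  by rewrite [nth _ (take _ _) _]nth_default // sz.
case: (boolP (nth false x m)) => xm; congr (_ * (nat_of_bool _)%:R).
  have E : prefix_block m.+1 = flip m (prefix_block m).
    apply: eq_from_nth_tuple => k lt_k; rewrite px nth_flip lt_k xm andbT //.
  have -> : blk j (flip (base j + m) b) = flip m (blk j b).
    apply: eq_from_nth_tuple => k lt_k; rewrite nth_restr nth_flip nth_flip nth_restr lt_k eqn_add2l /=.
    by have -> : (base j + k < T)%N by lia.
  by rewrite E (can2_eq (@flipK _ m) (@flipK _ m)).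
congr (_ == _); apply: eq_from_nth_tuple => k _; rewrite px (negPf xm) andbF addbF //.
Qed.

Lemma run_block j (b : T.-tuple bool) : (j < M)%N ->
  run_circuit (block_gates q n V (base j)) (partial_state j) b = partial_state j.+1 b.
Proof.
move=> lt_j; have le_T := base_le lt_j; rewrite (proj2 (partial_stateE _ lt_j)).
rewrite /block_gates run_circuit_cat (@run_slice _ _ W) //; last exact: wf_block_circuit.
have -> : slice W (base j) (run_circuit (copy_input n (base j)) (partial_state j)) b =
   scale_state (rest_amp j b) (block_init R q V x).
  apply/ffunP => v; rewrite !ffunE run_copy_input //.
  have out k : (base j <= k < base j + W)%N = false ->
      nth false (overwrite T W (base j) v b) k = nth false b k.
    by move=> hk; rewrite nth_overwrite hk; case: ltnP => // le_k; rewrite nth_default // size_tuple.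
  rewrite (rest_amp_other out); congr (_ * (_ == _)%:R).
    apply: eq_from_nth_tuple => k lt_k; rewrite nth_restr nth_overwrite lt_k leq_addr ltn_add2l lt_k addKn /=.
    by have -> : (base j + k < T)%N by lia.
  by rewrite /prefix_block take_size.
by rewrite run_circuit_scale ffunE.
Qed.

Lemma run_blocks m : (m <= M)%N ->
  run_circuit (flatten [seq block_gates q n V (base j) | j <- iota 0 m]) (input_state R (2 + M * W) x) =
  partial_state m.
Proof.
elim: m => [|m IH] le_m; first exact: partial_state0.
have -> : iota 0 m.+1 = iota 0 m ++ [:: m] by rewrite -addn1 iotaD.
rewrite map_cat flatten_cat run_circuit_cat IH /= ?cats0; last by lia.
by apply/ffunP => b; exact: run_block.
Qed.

Lemma partial_stateM (b : T.-tuple bool) :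
  partial_state M b = (head_ok b)%:R * \prod_(i < M) bstate (blk i b).
Proof. by rewrite ffunE; congr (_ * _); apply: eq_bigr => i _; rewrite ltn_ord. Qed.

(* The two gates leave the old value of the qubit [a] in the first position. *)
Lemma prob_first_one_swap m a (phi : qstate m) : (0 < a < m)%N ->
  prob_first_one (run_circuit [:: CNOT 0 a; CNOT a 0] phi) =
  \sum_(b : m.-tuple bool | nth false b a) sqmod (phi b).
Proof.
case/andP=> a0 am; have m0 : (0 < m)%N by lia.
pose f (b : m.-tuple bool) := if nth false b a then flip 0 b else b.
pose g (b : m.-tuple bool) := if nth false b 0 then flip a b else b.
have fK : involutive f.
  move=> b; rewrite /f; case E: (nth false b a); last by rewrite E.
  by rewrite nth_flip E flipK am gtn_eqF //= addbF.
have gK : involutive g.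
  move=> b; rewrite /g; case E: (nth false b 0); last by rewrite E.
  by rewrite nth_flip E flipK m0 ltn_eqF //= addbF.
have fgK : cancel (f \o g) (g \o f) by move=> b /=; rewrite fK gK.
have gfK : cancel (g \o f) (f \o g) by move=> b /=; rewrite gK fK.
rewrite /prob_first_one (reindex (f \o g)); last by exists (g \o f) => b _; [exact: fgK | exact: gfK].
apply: eq_big => b.
  rewrite /f /g /=; case E0: (nth false b 0); case Ea: (nth false b a) => //=;
  rewrite ?nth_flip ?am ?m0 ?eqxx /= ?Ea ?E0 //= ?nth_flip ?am ?m0 ?eqxx ?E0 //=;
  by rewrite ?(ltn_eqF a0) ?(gtn_eqF a0) ?andbF ?addbF ?E0.
move=> _; congr sqmod.
have run2 c : run_circuit [:: CNOT 0 a; CNOT a 0] phi c = phi (g (f c)).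
  by rewrite /run_circuit /= !ffunE /f /g; case: (nth false c a); case: (nth _ _ 0).
by rewrite run2 /= fK gK.
Qed.

Lemma query_out : n.+1 \notin flatten [seq block_query q n V (base j) | j <- iota 0 M].
Proof.
apply/negP => /flattenP[s /mapP[j _ ->]]; rewrite mem_iota /block_base; lia.
Qed.

Definition block_string (L : pred (seq bool)) (f : {ffun 'I_M -> W.-tuple bool}) : bool :=
  L (flatten [seq token_bits q V x (f i) | i <- enum 'I_M]).

(** The oracle only moves amplitudes to the other value of the answer qubit, so the acceptance
    probability is that of a string of [L] when the blocks are drawn independently with weights
    given by their squared amplitudes. *)
Lemma query_prob (L : pred (seq bool)) :
  query_accept_prob R L (sampling_circuit q n V M) x =
  \sum_(f : {ffun 'I_M -> W.-tuple bool}) (block_string L f)%:R * \prod_i sqmod (bstate (f i)).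
Proof.
(* Thanks to the constant qubit, the answer qubit is not the first one even for the empty input. *)
rewrite /query_accept_prob prob_first_one_swap; last by rewrite /=; lia.
rewrite [qc_before _]/= run_blocks //.
set qs := qc_query _; have qsE : qs = flatten [seq block_query q n V (base j) | j <- iota 0 M] by [].
have lt_a : (n.+1 < T)%N by lia.
have head_a (b : T.-tuple bool) : head_ok b -> nth false b n.+1 = false.
  move/allP => h; have hin : n.+1 \in iota 0 (n + 2) by rewrite mem_iota; lia.
  by rewrite (eqP (h _ hin)) nth_default.
have bits_flip (b : T.-tuple bool) : bits_at (flip n.+1 b) qs = bits_at b qs.
  apply/eq_in_map => k hk; rewrite nth_flip; case: eqP => [ek|_]; last by rewrite andbF addbF.
  by have := query_out; rewrite -qsE -ek hk.
have bits_qs (b : T.-tuple bool) : bits_at b qs = flatten [seq token_bits q V x (blk i b) | i : 'I_M].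
  rewrite qsE /bits_at map_flatten -map_comp; congr flatten.
  rewrite -val_enum_ord -map_comp; apply: eq_map => i /=.
  rewrite /block_query /token_bits /bits_at iotaDl -map_comp; apply/eq_in_map => k.
  rewrite mem_iota => hk /=; rewrite nth_restr.
  by have -> : (k < W)%N by move: hk; have := block_widthE q n V; lia.
(* After reindexing by a flip of the answer qubit, only strings in [L] contribute: the others would
   need the answer qubit to be 1 before the query, where the amplitude is 0. *)
transitivity (\sum_(b : T.-tuple bool | ~~ nth false b n.+1)
   (L (bits_at b qs))%:R * sqmod (partial_state M b)).
  rewrite (reindex_inj (inv_inj (@flipK T n.+1))); apply: eq_big => b.
    by rewrite nth_flip lt_a eqxx addbT.
  rewrite nth_flip lt_a eqxx addbT => nb; rewrite ffunE /= -/qs bits_flip.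
  case: ifP => _; first by rewrite flipK mul1r.
  rewrite mul0r partial_stateM; case: (boolP (head_ok _)) => [/head_a|_]; last by rewrite mul0r sqmod0.
  by rewrite nth_flip lt_a eqxx addbT (negPf nb).
pose F s : R := (head_ok s && L (flatten [seq token_bits q V x (blk i s) | i : 'I_M]))%:R *
  \prod_(i < M) sqmod (bstate (blk i s)).
transitivity (\sum_(b : T.-tuple bool) F b).
  rewrite big_mkcond /=; apply: eq_bigr => b _; rewrite /F partial_stateM sqmodM sqmod_nat sqmod_prod -bits_qs.
  case: (boolP (head_ok b)) => [/head_a -> /=|_]; first by rewrite mul1r.
  by rewrite !mul0r mulr0 if_same.
rewrite (sum_tuple_eq F (addnA n 2 _)) sum_tuple_cat.
have [u0 u0E] : exists u0 : (n + 2).-tuple bool, forall k, (k < n + 2)%N -> nth false u0 k = nth false x k.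
  by exists [tuple nth false x i | i < n + 2] => k lt_k; rewrite (@nth_mkt _ (nth false x)) lt_k.
have head_cat (u : (n + 2).-tuple bool) (c : (M * W).-tuple bool) : head_ok (u ++ c) = (u == u0).
  apply/allP/eqP => [h|-> k].
    apply: eq_from_nth_tuple => k lt_k; rewrite u0E //.
    by have := h k; rewrite mem_iota /= lt_k nth_cat size_tuple lt_k; move/(_ isT)/eqP ->.
  by rewrite mem_iota nth_cat size_tuple /= => lt_k; rewrite lt_k u0E.
have blk_cat (u : (n + 2).-tuple bool) (c : (M * W).-tuple bool) i : blk i (u ++ c) = restr W (i * W) c.
  apply: eq_from_nth_tuple => k lt_k; rewrite !nth_restr lt_k nth_cat size_tuple ifF.
    by congr nth; rewrite /block_base; lia.
  by rewrite /block_base; lia.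
rewrite (bigD1 u0) //= [X in _ + X]big1 ?addr0 => [|u nu]; last first.
  by apply: big1 => c _; rewrite /F head_cat (negPf nu) mul0r.
pose H (f : {ffun 'I_M -> W.-tuple bool}) : R :=
  (block_string L f)%:R * \prod_i sqmod (bstate (f i)).
rewrite -[RHS](sum_blocks H W_gt0); apply: eq_bigr => c _.
rewrite /F /H head_cat eqxx andTb /block_string; congr (_%:R * _).
  congr (nat_of_bool (L (flatten _))); apply: eq_map => i.
  by rewrite ffunE blk_cat.
by apply: eq_bigr => i _; rewrite ffunE blk_cat.
Qed.

Lemma sampling_circuit_wf : query_circuit_wf n (sampling_circuit q n V M).
Proof.
apply/and4P; split=> /=.
- have all_flatten g : all (gate_wf T) (flatten g) = all (all (gate_wf T)) g.
    by elim: g => //= s g IH; rewrite all_cat IH.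
  rewrite all_flatten all_map; apply/allP => j; rewrite mem_iota => /= lt_j.
  have le_T := base_le lt_j.
  rewrite /block_gates all_cat !all_map; apply/andP; split.
    have n_W : (n <= W)%N by rewrite /block_width /end_start /pad_start locs_afterE /token_start /nqubits; lia.
    apply/allP => i; rewrite mem_iota => /= lt_i; apply/and3P; split; move: le_T; rewrite /block_base; lia.
  by apply: sub_all (wf_block_circuit wfV r_q) => -[i|i|i k] /=; lia.
- rewrite query_out /=.
  elim: (M) => // m IH; rewrite -addn1 iotaD map_cat flatten_cat /= cats0 cat_uniq IH iota_uniq andbT /=.
  apply/hasPn => k; rewrite mem_iota => /andP[le_k _]; apply/negP => /flattenP[s /mapP[j]].
  rewrite mem_iota => /= lt_j ->; rewrite mem_iota => /andP[_ lt_k].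
  have : (j.+1 * W <= m * W)%N by rewrite leq_mul2r lt_j orbT.
  by rewrite mulSn; move: le_k lt_k; rewrite /block_base; have := block_widthE q n V; lia.
- apply/andP; split; first by lia.
  apply/allP => k /flattenP[s /mapP[j]]; rewrite mem_iota => /= lt_j ->; rewrite mem_iota => hk.
  by have := base_le lt_j; have := block_widthE q n V; lia.
- by apply/and3P; split; lia.
Qed.

End Global.

(** * Concentration *)

Section Tail.

Variables (R : realType) (T : finType) (P : T -> R).
Hypothesis P_ge0 : forall t, 0 <= P t.
Hypothesis P_sum1 : \sum_t P t = 1.

Variable (s : pred T).

Definition hits m (f : {ffun 'I_m -> T}) : nat := \sum_i s (f i).

Definition hit_prob : R := \sum_t (s t)%:R * P t.

Lemma sum_prod m : \sum_(f : {ffun 'I_m -> T}) \prod_i P (f i) = 1.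
Proof.
rewrite -(bigA_distr_bigA (fun (_ : 'I_m) t => P t)) big1 // => i _; exact: P_sum1.
Qed.

(** The generating function of a sum of independent indicators: the sum over all tuples of samples
    factors into one sum for each sample. *)
Lemma moment m (a : R) :
  \sum_(f : {ffun 'I_m -> T}) a ^+ hits f * \prod_i P (f i) = (1 + hit_prob * (a - 1)) ^+ m.
Proof.
have -> : 1 + hit_prob * (a - 1) = \sum_t a ^+ s t * P t.
  rewrite -[X in X + _]P_sum1 /hit_prob mulr_suml -big_split /=; apply: eq_bigr => t _.
  by case: (s t); rewrite /= ?expr1 ?expr0; ring.
rewrite -[in RHS](card_ord m) -prodr_const bigA_distr_bigA; apply: eq_bigr => f _.
by rewrite /hits -prodrXr big_split.
Qed.

(* Markov's inequality for [u ^+ (Q * hits f)]: with [u > 1] it bounds the upper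
   tail of [hits], with [u < 1] the lower one. *)
Lemma tail_bound m (E : pred {ffun 'I_m -> T}) (u rho : R) Q : 0 < u -> 0 <= rho ->
  0 <= hit_prob <= 1 ->
  (forall f, E f -> u ^+ m <= u ^+ (Q * hits f)) ->
  1 + hit_prob * (u ^+ Q - 1) <= rho * u ->
  \sum_(f | E f) \prod_i P (f i) <= rho ^+ m.
Proof.
move=> u0 rho0 /andP[p0 p1] hE hu.
have um : 0 < u ^+ m by rewrite exprn_gt0.
have prod0 (f : {ffun 'I_m -> T}) : 0 <= \prod_i P (f i) by apply: prodr_ge0.
rewrite -(ler_pM2r um); apply: (@le_trans _ _ ((1 + hit_prob * (u ^+ Q - 1)) ^+ m)); last first.
  rewrite -exprMn lerXn2r // ?nnegrE; last by rewrite mulr_ge0 // ltW.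
  have : 0 <= hit_prob * u ^+ Q by rewrite mulr_ge0 // exprn_ge0 // ltW.
  by rewrite mulrBr mulr1; lra.
rewrite -moment mulr_suml [leRHS](bigID E) /= -[leLHS]addr0; apply: lerD.
  apply: ler_sum => f Ef; rewrite mulrC ler_wpM2r // -exprM; exact: hE.
by apply: sumr_ge0 => f _; rewrite mulr_ge0 // -exprM exprn_ge0 // ltW.
Qed.

Lemma hit_prob_bounds : 0 <= hit_prob <= 1.
Proof.
apply/andP; split; first by apply: sumr_ge0 => t _; rewrite mulr_ge0.
rewrite -P_sum1; apply: ler_sum => t _.
by case: (s t); rewrite ?mul1r ?mul0r.
Qed.

End Tail.

(** * Explicit rates without exponentials *)

Section Constants.

Variable R : realType.

Lemma bernoulli (t : R) m : 0 <= t -> 1 + m%:R * t <= (1 + t) ^+ m.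
Proof.
move=> t0; elim: m => [|m IH]; first by rewrite mul0r expr0 addr0.
have mt : 0 <= m%:R * t * t by rewrite !mulr_ge0.
have := ler_wpM2l (_ : 0 <= 1 + t) IH; rewrite exprS => h.
apply: le_trans (h _); last by rewrite addr_ge0.
by rewrite -natr1; nra.
Qed.

(** An upper bound on a power of 1 - t, from (1 - t)(1 + t) <= 1 and Bernoulli's inequality for 1 +
    t. *)
Lemma bernoulli_inv (t : R) m : 0 <= t <= 1 -> (1 - t) ^+ m * (1 + m%:R * t) <= 1.
Proof.
move=> /andP[t0 t1]; apply: (@le_trans _ _ ((1 - t) ^+ m * (1 + t) ^+ m)).
  by rewrite ler_wpM2l ?exprn_ge0 ?subr_ge0 // bernoulli.
rewrite -exprMn -[leRHS](expr1n _ m) lerXn2r ?nnegrE //; nra.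
Qed.

Lemma bernoulli_neg (t : R) m : 0 <= t <= 1 -> 1 - m%:R * t <= (1 - t) ^+ m.
Proof.
move=> /andP[t0 t1]; elim: m => [|m IH]; first by rewrite mul0r expr0 subr0.
have mt : 0 <= m%:R * t * t by rewrite !mulr_ge0.
have := ler_wpM2l (_ : 0 <= 1 - t) IH; rewrite exprS => h.
apply: le_trans (h _); last by rewrite subr_ge0.
by rewrite -natr1; nra.
Qed.

Variable Q : nat.
Hypothesis Q_gt0 : (0 < Q)%N.

Notation e := (Q%:R^-1 : R).

Let Qe : Q%:R * e = 1 :> R. Proof. by rewrite mulfV // pnatr_eq0 -lt0n. Qed.
Let e0 : 0 < e. Proof. by rewrite invr_gt0 ltr0n. Qed.
Let e1 : e <= 1. Proof. by rewrite invf_le1 ?ltr0n // ler1n. Qed.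

(* With e = 1/Q, the events compare [hits] to its threshold m/Q. When the mean is at
   most 2e/3 the exponent base is 1 + e/4, when it is at least 4e/3 it is 1 - e/8;
   both choices leave room for the common rate 1 - e/45. *)
Definition decay : R := 1 - e / 45.

Lemma decay_ge0 : 0 <= decay. Proof. by rewrite /decay; move: e0 e1; lra. Qed.

Lemma upper_rate (p : R) : 0 <= p -> p <= 2 / 3 * e ->
  1 + p * ((1 + e / 4) ^+ Q - 1) <= decay * (1 + e / 4).
Proof.
move=> p0 pe; set a := _ ^+ Q.
(* Since (1 + e/4)(1 - e/4) <= 1, it suffices that (1 - e/4)^Q >= 1 - Q e/4 = 3/4. *)
have h1 : a <= 4 / 3.
  have h := @bernoulli_neg (e / 4) Q; have : 3 / 4 <= (1 - e / 4) ^+ Q.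
    by apply: le_trans (h _); move: Qe e0 e1; [nra | lra].
  move=> h2; have a0 : 0 <= a by rewrite exprn_ge0 //; move: e0; lra.
  have : a * (1 - e / 4) ^+ Q <= 1.
    rewrite -exprMn -[leRHS](expr1n _ Q) lerXn2r ?nnegrE //; move: e0 e1; nra.
  by nra.
have a1 : 1 <= a by rewrite exprn_ege1 //; move: e0; lra.
(* The left side is at most 1 + 2e/9 and the right side is 1 + e/4 - e/45 - e^2/180. As 1/4 - 2/9 =
   1/36 = 1/45 + 1/180 and e <= 1, the rate 1/45 just fits. *)
by rewrite /decay; move: e0 e1; nra.
Qed.

Lemma lower_rate (p : R) : p <= 1 -> 4 / 3 * e <= p ->
  1 + p * ((1 - e / 8) ^+ Q - 1) <= decay * (1 - e / 8).
Proof.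
move=> p1 pe; set a := _ ^+ Q.
have h1 : a <= 8 / 9.
  have := @bernoulli_inv (e / 8) Q; have -> : 1 + Q%:R * (e / 8) = 9 / 8 by move: Qe; lra.
  move=> h; have : a * (9 / 8) <= 1 by apply: h; move: e0 e1; lra.
  by lra.
(* The left side is at most 1 - 4e/27, and 4/27 exceeds 1/8 + 1/45 = 53/360. *)
by rewrite /decay; move: e0 e1; nra.
Qed.

(** Every 45 Q samples at least halve the bound: (1 - e/45)^(45 Q) is at most the inverse of 1 + 45
    Q e/45 = 2. *)
Lemma decay_half k m : (45 * Q * k <= m)%N -> decay ^+ m <= 2^-1 ^+ k.
Proof.
move=> le_m; have d0 := decay_ge0; have d1 : decay <= 1 by rewrite /decay; move: e0; lra.
apply: (@le_trans _ _ (decay ^+ (45 * Q * k))); first by rewrite ler_wiXn2l.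
rewrite exprM lerXn2r ?nnegrE ?exprn_ge0 ?invr_ge0 //.
have := @bernoulli_inv (e / 45) (45 * Q); rewrite -/decay.
have -> : 1 + (45 * Q)%:R * (e / 45) = 2 by rewrite natrM; move: Qe; lra.
move=> h; have : decay ^+ (45 * Q) * 2 <= 1 by apply: h; move: e0 e1; lra.
by lra.
Qed.

End Constants.

(** * Correctness of the single query *)

Section Instance.

Variables (R : realType) (q M p : nat) (V : pcp_verifier) (x : seq bool).

Notation n := (size x).
Hypothesis wfV : pcp_verifier_wf n V.
Hypothesis r_q : (size (pv_index V) <= q)%N.
Hypothesis rangeV : pcp_in_range R V x p.

Notation sqmod := (@sqmod R).
Notation W := (block_width q n V).
Notation S := (token_start q n V).
Notation bstate := (block_state R q V x).
Notation Q := (2 ^ q.+1)%N.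
Notation tok b := (token_bits q V x b).
Notation weight f := (\prod_i sqmod (bstate (f i))).
Notation string f := (flatten [seq tok (f i) | i <- enum 'I_M]).
Notation blocks := {ffun 'I_M -> W.-tuple bool}.
Notation hits_of y f := (hits (fun b : W.-tuple bool => success Q y (tok b)) f).

Let Q_gt0 : (0 < Q)%N. Proof. by rewrite expn_gt0. Qed.

Lemma positions_bits (v : (nqubits n V).-tuple bool) : 
  positions V (bits_at v (flatten (pv_index V))) = map nat_of_bits [seq bits_at v L | L <- pv_index V].
Proof.
have -> : bits_at v (flatten (pv_index V)) = flatten [seq bits_at v L | L <- pv_index V].
  exact: map_flatten.
rewrite /positions; congr map; rewrite -[RHS]flattenK; congr reshape.
by rewrite /shape -map_comp; apply: eq_map => L /=; rewrite size_map.
Qed.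

Lemma block_sumq : \sum_(b : W.-tuple bool) sqmod (bstate b) = 1.
Proof. exact: norm2_block_state. Qed.

(** Restricted to blocks in the support, where the query register is a sequence of complete samples;
    each of them leaves [addr] reset to [y] and [bad] empty for the next. *)
Lemma check_run_string y (s : seq (W.-tuple bool)) st : addr st = y -> bad st = [::] ->
  (forall b, b \in s -> bstate b != 0) ->
  size (neg (check_run Q y (flatten [seq tok b | b : W.-tuple bool <- s]) st)) = (size (neg st) + size s)%N /\
  size (pos (check_run Q y (flatten [seq tok b | b : W.-tuple bool <- s]) st)) =
    (size (pos st) + Q * count (fun b : W.-tuple bool => success Q y (tok b)) s)%N.
Proof.
elim: s st => [|b s IH] st /=; first by rewrite muln0 !addn0.
case: st => w bd ps ng /= -> -> nz.
have nzb : bstate b != 0 by apply: nz; rewrite mem_head.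
have [_ [os [z [pd [h1 h2 h3 h4 _]]]]] := block_state_support wfV r_q nzb.
have so : size z = size os by rewrite h2 (size_os_eq h1).
rewrite {1 2}h4 check_run_block //.
have nz' c : c \in s -> bstate c != 0 by move=> hc; apply: nz; rewrite in_cons hc orbT.
have [-> ->] := IH (CheckState y [::] (if sample_ok y os z pd (nth false b 0) then nseq Q true ++ ps else ps)
  (true :: ng)) erefl erefl nz'.
rewrite h4 success_tokens //=; case: (sample_ok _ _ _ _ _); split; rewrite ?size_cat ?size_nseq; nia.
Qed.

Lemma weight_neq0 (f : blocks) : weight f != 0 -> forall i, bstate (f i) != 0.
Proof.
move=> nz i; apply: contraNneq nz => e; rewrite (bigD1 i) //= e.
by rewrite sqmod0 mul0r.
Qed.

Lemma check_string y (f : blocks) : weight f != 0 ->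
  check Q y (string f) = (M <= Q * hits_of y f)%N.
Proof.
move=> /weight_neq0 nz; rewrite /check.
have -> : [seq tok (f i) | i <- enum 'I_M] = [seq tok b | b : W.-tuple bool <- map f (enum 'I_M)] by rewrite -map_comp.
have nz' b : b \in map f (enum 'I_M) -> bstate b != 0 by move=> /mapP[i _ ->].
have [-> ->] := @check_run_string y (map f (enum 'I_M)) (CheckState y [::] [::] [::]) erefl erefl nz'.
rewrite /= !add0n size_map size_enum_ord; congr (_ <= _ * _)%N.
by rewrite count_map /hits -sum1_count big_mkcond /= big_enum /=; apply: eq_bigr => i _; case: (success _ _ _).
Qed.

(** Makes a genuine proof an admissible NP witness: its length p is below the number of samples,
    hence below the length of the query. *)
Lemma size_string (f : blocks) : (M <= size (string f))%N.
Proof.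
rewrite -[X in (X <= _)%N](size_enum_ord M); elim: (enum 'I_M) => //= i s IH.
rewrite size_cat size_map size_iota; have := block_widthE q n V; lia.
Qed.

Lemma hit_probE y : hit_prob (fun b : W.-tuple bool => sqmod (bstate b)) (fun b : W.-tuple bool => success Q y (tok b)) =
  (2^-1) ^+ q * pcp_accept_prob R V x y.
Proof. exact: success_prob. Qed.

Let two_pow : (Q%:R)^-1 = 2^-1 * (2^-1) ^+ q :> R.
Proof. by rewrite natrX exprS invfM exprVn. Qed.

Lemma query_prob_yes (L : pred (seq bool)) y :
  (forall f : blocks, check Q y (string f) -> L (string f)) ->
  2 / 3 <= pcp_accept_prob R V x y -> (45 * Q * 2 <= M)%N ->
  2 / 3 <= query_accept_prob R L (sampling_circuit q n V M) x.
Proof.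
move=> hL acc le_M; rewrite query_prob // /block_string.
pose P (b : W.-tuple bool) := sqmod (bstate b).
have P0 b : 0 <= P b := sqmod_ge0 _.
have P1 : \sum_b P b = 1 := block_sumq.
have w0 (f : blocks) : 0 <= weight f by apply: prodr_ge0 => i _; exact: sqmod_ge0.
have := sum_prod P1 M; rewrite (bigID (fun f : blocks => (M <= Q * hits_of y f)%N)) /= => tot.
have pr := hit_probE y; have pb := hit_prob_bounds P0 P1 (fun b : W.-tuple bool => success Q y (tok b)).
have tail : \sum_(f : blocks | ~~ (M <= Q * hits_of y f)%N) weight f <= decay R Q ^+ M.
  apply: (tail_bound P0 P1 (E := fun f => ~~ (M <= Q * hits_of y f)%N) (u := 1 - Q%:R^-1 / 8) _ _ pb).
  - by have : Q%:R^-1 <= 1 :> R; [rewrite invf_le1 ?ltr0n // ler1n | lra].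
  - exact: decay_ge0.
  - move=> f; rewrite -ltnNge => /ltnW lt_f; apply: ler_wiXn2l lt_f.
    + by have : Q%:R^-1 <= 1 :> R; [rewrite invf_le1 ?ltr0n // ler1n | lra].
    + by have : 0 <= Q%:R^-1 :> R; [rewrite invr_ge0 | lra].
  - apply: lower_rate => //; first by case/andP: pb.
    have c0 : 0 <= 2^-1 ^+ q :> R by rewrite exprn_ge0 // invr_ge0.
    by rewrite pr two_pow; nra.
(* With twice 45 Q samples the error is at most 1/4, which is below 1/3. *)
have half := decay_half R Q_gt0 le_M.
have main : \sum_(f : blocks | (M <= Q * hits_of y f)%N) weight f <=
  \sum_(f : blocks) (L (string f))%:R * weight f.
  rewrite big_mkcond /=; apply: ler_sum => f _.
  have [->|nz] := eqVneq (weight f) 0; first by rewrite mulr0 if_same.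
  case: ifP => hf; last by rewrite mulr_ge0.
  by rewrite hL ?mul1r // check_string.
move: main tail half tot; rewrite /P expr2; lra.
Qed.

Lemma bits_at_positions (y y' : seq bool) (v : (nqubits n V).-tuple bool) : psi R V x v != 0 ->
  (forall i, (i < p)%N -> nth false y i = nth false y' i) ->
  bits_at y (positions V (bits_at v (flatten (pv_index V)))) =
  bits_at y' (positions V (bits_at v (flatten (pv_index V)))).
Proof. by move=> nz h; apply/eq_in_map => i hi; apply: h; exact: (allP (rangeV nz)). Qed.

(** Outcomes that address a position from [p] on have amplitude 0 before the measurement, so they
    contribute nothing. *)
Lemma accept_prob_prefix (y y' : seq bool) :
  (forall i, (i < p)%N -> nth false y i = nth false y' i) ->
  pcp_accept_prob R V x y = pcp_accept_prob R V x y'.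
Proof.
move=> h; rewrite /pcp_accept_prob; apply: eq_bigr => o _; congr prob_first_one; congr run_circuit.
apply/ffunP => b; rewrite !ffunE; set v : (nqubits n V).-tuple bool := [tuple nth false b i | i < _].
case: (eqVneq (bits_at v _) o) => [eo|_]; last by rewrite !if_same.
have [->|nz] := eqVneq (pcp_state_before R V x v) 0; first by rewrite !if_same.
by rewrite -eo (bits_at_positions nz h).
Qed.

(** One bit more than [p]: padding looks at bit 0, which lies beyond a proof of length 0. *)
Lemma success_prefix (y y' : seq bool) (b : W.-tuple bool) : bstate b != 0 ->
  (forall i, (i < p.+1)%N -> nth false y i = nth false y' i) ->
  success Q y (tok b) = success Q y' (tok b).
Proof.
move=> nz h; have [_ [os [z [pd [h1 h2 h3 -> [v [nzv eos]]]]]]] := block_state_support wfV r_q nz.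
rewrite !success_tokens ?h2 ?(size_os_eq h1) // /sample_ok h //; congr [&& _, _ == _ & _].
have := @bits_at_positions y y' v nzv (fun i hi => h i (ltnW hi)).
by rewrite positions_bits -eos /bits_at -!map_comp.
Qed.

(** Union bound over the 2^(p+1) relevant prefixes: each is accepted with probability at most
    2^-(p+3), which adds up to 1/4. *)
Lemma query_prob_no (L : pred (seq bool)) :
  (forall f : blocks, L (string f) -> exists y, check Q y (string f)) ->
  (forall y : p.-tuple bool, pcp_accept_prob R V x y <= 1 / 3) -> (45 * Q * (p + 3) <= M)%N ->
  query_accept_prob R L (sampling_circuit q n V M) x <= 1 / 3.
Proof.
move=> hL acc le_M; rewrite query_prob // /block_string.
pose P (b : W.-tuple bool) := sqmod (bstate b).
have P0 b : 0 <= P b := sqmod_ge0 _.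
have P1 : \sum_b P b = 1 := block_sumq.
have w0 (f : blocks) : 0 <= weight f by apply: prodr_ge0 => i _; exact: sqmod_ge0.
have tail (y : p.+1.-tuple bool) : \sum_(f : blocks | (M <= Q * hits_of y f)%N) weight f <= decay R Q ^+ M.
  have pb := hit_prob_bounds P0 P1 (fun b : W.-tuple bool => success Q y (tok b)).
  apply: (tail_bound P0 P1 (E := fun f => (M <= Q * hits_of y f)%N) (u := 1 + Q%:R^-1 / 4) _ _ pb).
  - by have : 0 <= Q%:R^-1 :> R; [rewrite invr_ge0 | lra].
  - exact: decay_ge0.
  - move=> f lt_f; apply: ler_weXn2l lt_f.
    by have : 0 <= Q%:R^-1 :> R; [rewrite invr_ge0 | lra].
  - apply: upper_rate => //; first by case/andP: pb.
    have c0 : 0 <= 2^-1 ^+ q :> R by rewrite exprn_ge0 // invr_ge0.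
    have a1 : pcp_accept_prob R V x y <= 1 / 3.
      (* Soundness is assumed for proofs of length [p], so the extra bit is cut off here. *)
      rewrite (@accept_prob_prefix y (restr p 0 y)) ?acc // => i lt_i.
      by rewrite nth_restr lt_i.
    by rewrite hit_probE two_pow; nra.
have half := decay_half R Q_gt0 le_M.
apply: (@le_trans _ _ (\sum_(y : p.+1.-tuple bool) \sum_(f : blocks | (M <= Q * hits_of y f)%N) weight f)).
  rewrite (eq_bigr _ (fun y _ => big_mkcond _ _)) exchange_big /=; apply: ler_sum => f _.
  have [->|nz] := eqVneq (weight f) 0.
    by rewrite mulr0 big1 // => y _; rewrite if_same.
  case: (boolP (L _)) => [/hL[y]|_]; last first.
    by rewrite mul0r; apply: sumr_ge0 => y _; case: ifP.
  (* A witness may have any length; its first p + 1 bits, extended by zeros if it is shorter, give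
     the term of the union that accounts for [f]. *)
  rewrite check_string // => hy; rewrite mul1r (bigD1 (restr p.+1 0 y)) //= ifT.
    by rewrite lerDl; apply: sumr_ge0 => y' _; case: ifP.
  move: hy; congr (_ <= _ * _)%N; apply: eq_bigr => i _; congr nat_of_bool.
  apply: success_prefix; first exact: weight_neq0.
  by move=> k lt_k; rewrite nth_restr lt_k.
apply: (@le_trans _ _ (\sum_(y : p.+1.-tuple bool) 2^-1 ^+ (p + 3))).
  by apply: ler_sum => y _; apply: le_trans (tail y) half.
rewrite sumr_const card_tuple card_bool -[X in X <= _]mulr_natl natrX.
have -> : (p + 3 = 2 + p.+1)%N by [lia]; rewrite exprD.
have -> : (2 : R) ^+ p.+1 * (2^-1 ^+ 2 * 2^-1 ^+ p.+1) = 1 / 4; last by lra.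
rewrite mulrCA -exprMn mulfV ?pnatr_eq0 // expr1n expr2; lra.
Qed.

End Instance.

Local Open Scope classical_set_scope.

Theorem theorem6p2 (R : realType) (q : nat) : QCPCP R q `<=` BQP_NP1 R.
Proof.
move=> A [p [V [[[k p_le] V_unif V_wf V_range] [Hyes Hno]]]].
(* With X = (n + c)^k there are at least c X samples, and (k + 4) X >= n^k + k + 3 >= p n + 3, which
   is what the union bound asks for; hence the factor k + 4. *)
pose Q := (2 ^ q.+1)%N; pose c := (45 * Q * (k + 4))%N.
have Q_gt0 : (0 < Q)%N by rewrite expn_gt0.
have c_gt0 : (0 < c)%N by rewrite /c; nia.
pose M n := ((n + c) ^ k.+1)%N.
have M_ge n : (45 * Q * (p n + 3) <= M n)%N.
  have le1 : (n ^ k <= (n + c) ^ k)%N by case: (k) => // k'; rewrite leq_exp2r // leq_addr.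
  have gt0 : (0 < (n + c) ^ k)%N by rewrite expn_gt0 addn_gt0 c_gt0 orbT.
  rewrite /M expnS; apply: (@leq_trans (c * (n + c) ^ k)%N); last by rewrite leq_mul2r leq_addl orbT.
  rewrite /c -(mulnA (45 * Q)%N) leq_mul2l; apply/orP; right.
  have kX : (k <= k * (n + c) ^ k)%N by rewrite leq_pmulr.
  rewrite mulnDl; move: (p_le n) le1 gt0 kX; move: ((n + c) ^ k)%N (n ^ k)%N (p n) => X Y Z.
  by clear; lia.
(* The witness bound is linear in the query because the query has at least one bit per sample, and
   there are more samples than proof bits. *)
pose L s := `[< exists y, (size y <= size s ^ 1 + 1)%N /\ check Q y s >].
exists L, (fun n => sampling_circuit q n (V n) (M n)); split; first split.
- exists (fun s y => check Q y s), 1%N; split; first exact: check_polytime.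
  by move=> s; split=> [/asboolP|h] //; apply/asboolP.
- by apply: sampling_circuit_uniform => // n; case: (V_wf n).
- move=> n; have [wfV rV] := V_wf n.
  (* Well-formedness depends only on the input length, so any input of length [n] serves. *)
  by have := @sampling_circuit_wf q (M n) (V n) (nseq n false); rewrite size_nseq; apply.
split=> x hx; have [wfV rV] := V_wf (size x).
- have [y hy] := Hyes x hx; apply: (query_prob_yes wfV rV _ hy); last by have := M_ge (size x); nia.
  move=> f hf; apply/asboolP; exists y; split=> //; rewrite expn1 size_tuple.
  by have := size_string wfV rV f; have := M_ge (size x); nia.
- apply: (query_prob_no wfV rV (V_range x) _ (Hno x hx) (M_ge _)) => f /asboolP[y [_ hy]].
  by exists y.
Qed.
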